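(* Let $A\ge 0$ be a self-adjoint operator with $\ker A=\{0\}$ on a Hilbert space $\mathcal{H}$, let $C_t=e^{-tA}$, $t \geq 0$, be the corresponding hermitian contraction semigroup, and let $(\mathcal{E},\mathcal{E}_+,\theta,U)$ be the associated $L^2$-model $\mathcal{E}=L^2(\mathbb{R},Q;\mathcal{H})$ of its dilation, with spectral subspaces $\mathcal{E}_F$ for closed subsets $F\subseteq\mathbb{R}$ (all defined in the context). Then the spectral subspaces have the following properties: (i) The subspaces $\mathcal{E}_F$ of $\mathcal{E}$ are closed. (ii) $U_t\mathcal{E}_F=\mathcal{E}_{F+t}$ for $t\in\mathbb{R}$. (iii) $\mathcal{E}_0=\mathcal{E}_{\{0\}}$ and $\mathcal{E}_+=\mathcal{E}_{[0,\infty[}$.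
   Context: For $x\in\mathbb{R}$, put $Q(x):=\frac1\pi A(A^2+x^2)^{-1}$, so that $\int_{\mathbb{R}}Q(x)\,dx=\mathbf{1}$. $\mathcal{E}:=L^2(\mathbb{R},Q;\mathcal{H})$ is the $\mathcal{H}$-valued $L^2$-space with scalar product $$\langle f,g\rangle_{\mathcal{E}}=\int_{\mathbb{R}}\langle Q(x)f(x),g(x)\rangle\,dx$$ (the Hilbert space completion of the space of measurable functions $f:\mathbb{R}\to\mathcal{H}$ with $\int\langle Q(x)f(x),f(x)\rangle dx<\infty$, modulo null functions). $\mathcal{H}$ embeds isometrically in $\mathcal{E}$ as the subspace of constant functions. On $\mathcal{E}$ one has the unitary one-parameter group $(U_tf)(x)=e^{-itx}f(x)$ and the unitary involution $(\theta f)(x)=f(-x)$. $\mathcal{E}_+$ is the closed subspace generated by $U_t\mathcal{H}$, $t>0$, and $\mathcal{E}_0=\{f\in\mathcal{E}_+:\theta f=f\}$; then $(\mathcal{E},\mathcal{E}_+,\theta)$ is a reflection positive Hilbert space ($\langle\theta f,f\rangle\ge0$ on $\mathcal{E}_+$), and $\mathcal{E}_0=\mathcal{H}$ (the constant functions). Let $P$ be the spectral measure of $A$. For $0<a<b<\infty$ put $\mathcal{H}_{a,b}=P([a,b])\mathcal{H}$, $P_{a,b}=P([a,b])$ and $\mathcal{E}_{a,b}=\{f\in\mathcal{E}:f(\mathbb{R})\subseteq\mathcal{H}_{a,b}\}$; as a topological vector space $\mathcal{E}_{a,b}$ is $L^2(\mathbb{R},\frac{dx}{\pi(1+x^2)};\mathcal{H}_{a,b})$.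 $P_{a,b}$ acts pointwise on $\mathcal{E}$ as the orthogonal projection $\mathcal{E}\to\mathcal{E}_{a,b}$. Each $f\in\mathcal{E}_{a,b}$ defines an $\mathcal{H}_{a,b}$-valued tempered distribution (distributions are antilinear in the test function) $$\Xi(f)(\phi)=\int_{\mathbb{R}}\overline{\tilde\phi(x)}\,f(x)\,dx,\qquad \tilde\phi(x)=(2\pi)^{-1/2}\int_{\mathbb{R}}\phi(y)e^{ixy}\,dy,\qquad\phi\in\mathcal{S}(\mathbb{R}),$$ i.e. $\Xi(f)$ is the Fourier transform of $f$. For a closed subset $F\subseteq\mathbb{R}$ the spectral subspace is $$\mathcal{E}_F:=\{f\in\mathcal{E}:\ \mathrm{supp}(\Xi(P_{a,b}f))\subseteq -F\ \text{ for all }0<a<b<\infty\}.$$ *)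

(* Defs.v *)
From HB Require Import structures.
From mathcomp Require Import all_boot all_order all_algebra.
From mathcomp Require Import complex.
From mathcomp Require Import all_classical all_reals all_analysis.

Set Implicit Arguments.
Unset Strict Implicit.
Unset Printing Implicit Defensive.

Import Order.TTheory GRing.Theory Num.Theory.
Import numFieldNormedType.Exports.
Local Open Scope classical_set_scope.
Local Open Scope complex_scope.
Local Open Scope ring_scope.

(* A complex Hilbert space is a completeNormedModType R[i] together with
   ip : {dot H for Num.conj} such that hilbert_norm ip holds.  Such an ip is
   linear in its first argument and antilinear in its second one. *)
Definition hilbert_norm (R : realType) (H : completeNormedModType R[i])
    (ip : {dot H for Num.conj}) : Prop :=
  forall x : H, `|x| ^+ 2 = ip x x.

Definition subspace (R : realType) (H : completeNormedModType R[i])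
    (V : set H) : Prop :=
  V 0 /\ forall (a : R[i]) u v, V u -> V v -> V (a *: u + v).

Definition closed_subspace (R : realType) (H : completeNormedModType R[i])
    (V : set H) : Prop :=
  subspace V /\ closed V.

(* An unbounded operator; the values of op_app outside op_dom are junk. *)
Record operator (R : realType) (H : completeNormedModType R[i]) := Operator {
  op_dom : set H ;
  op_app :> H -> H }.

Section operators.
Variables (R : realType) (H : completeNormedModType R[i]).
Variable ip : {dot H for Num.conj}.
Variable A : operator H.

Definition linear_operator : Prop :=
  subspace (op_dom A) /\
  forall (a : R[i]) u v, op_dom A u -> op_dom A v ->
    A (a *: u + v) = a *: A u + A v.

(* The last clause is the equality of the graphs of A and of its adjoint. *)
Definition self_adjoint : Prop :=
  [/\ linear_operator, closure (op_dom A) = setT &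
      forall v w, (op_dom A v /\ A v = w) <->
                  (forall u, op_dom A u -> ip (A u) v = ip u w)].

Definition nonneg_operator : Prop :=
  forall v, op_dom A v -> 0 <= ip (A v) v.

Definition ker_operator : set H := [set v | op_dom A v /\ A v = 0].

End operators.

(* Projection-valued measures on the Borel sets of the real line; the values
   on non-measurable sets are junk. *)
Record pvm (R : realType) (H : completeNormedModType R[i])
    (ip : {dot H for Num.conj}) := Pvm {
  pvm_proj :> set R -> H -> H ;
  pvm_linear : forall B, measurable B -> forall (a : R[i]) u v,
    pvm_proj B (a *: u + v) = a *: pvm_proj B u + pvm_proj B v ;
  pvm_sym : forall B, measurable B -> forall u v,
    ip (pvm_proj B u) v = ip u (pvm_proj B v) ;
  pvm_setI : forall B C, measurable B -> measurable C -> forall v,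
    pvm_proj (B `&` C) v = pvm_proj B (pvm_proj C v) ;
  pvm_set0 : forall v, pvm_proj set0 v = 0 ;
  pvm_setT : forall v, pvm_proj setT v = v ;
  pvm_sigma_additive : forall v,
    semi_sigma_additive (fun B => (complex.Re (ip (pvm_proj B v) v))%:E) }.

Section scalar_measure.
Variables (R : realType) (H : completeNormedModType R[i]).
Variable ip : {dot H for Num.conj}.
Variables (P : pvm ip) (v : H).

(* For measurable B this is <P(B) v, v> (see pvm_scalarE); written this way it
   is nonnegative on every set B, as required of a library measure. *)
Definition pvm_scalar (B : set R) : \bar R :=
  (complex.Re (ip (P B v) (P B v)))%:E.

Lemma pvm_scalarE B : measurable B ->
  pvm_scalar B = (complex.Re (ip (P B v) v))%:E.
Proof. by move=> mB; rewrite /pvm_scalar -pvm_sym // -pvm_setI // setIid. Qed.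

Let pvm_scalar0 : pvm_scalar set0 = 0%E.
Proof. by rewrite pvm_scalarE // pvm_set0 linear0l. Qed.

Let pvm_scalar_ge0 B : (0 <= pvm_scalar B)%E.
Proof.
have := @dnorm_ge0 _ _ ip (P B v).
by rewrite lee_fin lecE => /andP[].
Qed.

Let pvm_scalar_sigma_additive : semi_sigma_additive pvm_scalar.
Proof.
move=> F mF tF mUF.
rewrite pvm_scalarE //; under eq_fun do under eq_bigr do rewrite pvm_scalarE //.
exact: pvm_sigma_additive.
Qed.

HB.instance Definition _ := isMeasure.Build _ _ _ pvm_scalar
  pvm_scalar0 pvm_scalar_ge0 pvm_scalar_sigma_additive.

End scalar_measure.

Section functional_calculus.
Variables (R : realType) (H : completeNormedModType R[i]).
Variable ip : {dot H for Num.conj}.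
Variables (A : operator H) (P : pvm ip).

(* A = \int x dP(x): the domain consists of the v with
   \int x^2 d<P v, v> < oo, and the quadratic form <A v, v> on it (hence, by
   polarization, the operator A) is the integral of x. *)
Definition is_spectral_measure : Prop :=
  op_dom A = [set v | (\int[pvm_scalar P v]_x (x ^+ 2)%:E < +oo)%E] /\
  forall v, op_dom A v -> ip (A v) v = (\int[pvm_scalar P v]_x x)%:C.

(* T = \int g(x) dP(x) for a real function g bounded on the support of P. *)
Definition is_spectral_integral (g : R -> R) (T : H -> H) : Prop :=
  linear T /\ forall v, ip (T v) v = (\int[pvm_scalar P v]_x g x)%:C.

Definition is_exp_semigroup (C : R -> H -> H) : Prop :=
  forall t, 0 <= t -> is_spectral_integral (fun x => expR (- t * x)) (C t).

(* Q(x) = pi^-1 A (A^2 + x^2)^-1.  For x != 0 it is an everywhere defined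
   bounded operator; Q(0) is only relevant up to a Lebesgue-null set. *)
Definition Qop (x : R) (v : H) : H :=
  xget 0 [set u | exists w, [/\ op_dom A w, op_dom A (A w),
    A (A w) + (x ^+ 2)%:C *: w = v & u = (pi^-1)%:C *: A w]].

End functional_calculus.

(* Integral of a complex function against Lebesgue measure. *)
Definition cintegral (R : realType) (f : R -> R[i]) : R[i] :=
  (\int[lebesgue_measure]_x complex.Re (f x)) +i*
  (\int[lebesgue_measure]_x complex.Im (f x)).

Definition expi (R : realType) (t : R) : R[i] := cos t +i* sin t.

Section vector_functions.
Variables (R : realType) (H : completeNormedModType R[i]).
Variable ip : {dot H for Num.conj}.

Definition vsimple (s : R -> H) : Prop :=
  finite_set (range s) /\ forall v, measurable (s @^-1` [set v]).

(* H need not be separable, so measurability is strong measurability. *)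
Definition strongly_measurable (f : R -> H) : Prop :=
  exists s : nat -> R -> H, (forall n, vsimple (s n)) /\
    forall x, s n x @[n --> \oo] --> f x.

(* Vector-valued Lebesgue integral, characterized by testing against H; it
   exists by Riesz' theorem as soon as `|f| is integrable, and is then the
   Bochner integral. *)
Definition vintegral (f : R -> H) : H :=
  xget 0 [set v | forall w, ip v w = cintegral (fun x => ip (f x) w)].

End vector_functions.

Section test_functions.
Variable R : realType.

Definition schwartz_real (u : R -> R) : Prop :=
  (forall n x, derivable (derive1n n u) x 1) /\
  (forall k n, exists M, forall x, `|x| ^+ k * `|derive1n n u x| <= M).

Definition schwartz (phi : R -> R[i]) : Prop :=
  schwartz_real (fun x => complex.Re (phi x)) /\
  schwartz_real (fun x => complex.Im (phi x)).

Definition supp (phi : R -> R[i]) : set R := closure [set x | phi x != 0].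

Definition fourier (phi : R -> R[i]) (x : R) : R[i] :=
  ((Num.sqrt (2 * pi))^-1)%:C * cintegral (fun y => phi y * expi (x * y)).

Variable V : zmodType.

Definition vanishes_on (T : (R -> R[i]) -> V) (O : set R) : Prop :=
  forall phi, schwartz phi -> compact (supp phi) -> supp phi `<=` O ->
    T phi = 0.

Definition dsupport (T : (R -> R[i]) -> V) : set R :=
  ~` (\bigcup_(O in [set O | open O /\ vanishes_on T O]) O).

End test_functions.

Section model.
Variables (R : realType) (H : completeNormedModType R[i]).
Variable ip : {dot H for Num.conj}.
Variables (A : operator H) (P : pvm ip).

(* The measurable functions f with \int <Q(x) f(x), f(x)> dx < oo, before
   completion and before passing to the quotient by null functions. *)
Definition preL2 (f : R -> H) : Prop :=
  strongly_measurable f /\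
  (\int[lebesgue_measure]_x
    (complex.Re (ip (Qop A x (f x)) (f x)))%:E < +oo)%E.

Definition Hab (a b : R) : set H := range (P `[a, b]%classic).

(* The Fourier transform of f. *)
Definition Xi (f : R -> H) (phi : R -> R[i]) : H :=
  vintegral ip (fun x => Num.conj (fourier phi x) *: f x).

Variables (E : completeNormedModType R[i]) (ipE : {dot E for Num.conj}).
Variable J : (R -> H) -> E.

(* E is a Hilbert space completion of preL2 modulo null functions, J f being
   the class of f; the values of J outside preL2 are junk. *)
Definition is_L2_completion : Prop :=
  [/\ hilbert_norm ipE,
      forall (a : R[i]) f g, preL2 f -> preL2 g ->
        J (fun x => a *: f x + g x) = a *: J f + J g,
      forall f g, preL2 f -> preL2 g ->
        ipE (J f) (J g) = cintegral (fun x => ip (Qop A x (f x)) (g x)) &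
      closure (J @` [set f | preL2 f]) = setT].

(* G is the operator on E acting on functions as T. *)
Definition is_extension (T : (R -> H) -> R -> H) (G : E -> E) : Prop :=
  continuous G /\ forall f, preL2 f -> G (J f) = J (T f).

Definition is_translation_group (U : R -> E -> E) : Prop :=
  forall t, is_extension (fun f x => expi (- (t * x)) *: f x) (U t).

Definition is_reflection (theta : E -> E) : Prop :=
  is_extension (fun f x => f (- x)) theta.

Definition is_cutoff (Pab : R -> R -> E -> E) : Prop :=
  forall a b, 0 < a -> a < b ->
    is_extension (fun f x => P `[a, b]%classic (f x)) (Pab a b).

Variables (U : R -> E -> E) (theta : E -> E) (Pab : R -> R -> E -> E).

Definition Eplus : set E :=
  smallest (@closed_subspace R E)
    [set xi | exists t v, 0 < t /\ xi = U t (J (fun=> v))].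

Definition Ezero : set E := [set xi | Eplus xi /\ theta xi = xi].

(* Pab a b xi lies in E_{a,b}, hence is the class of a function f with values
   in Hab a b; Xi f does not depend on its choice. *)
Definition spectral_subspace (F : set R) : set E :=
  [set xi | forall a b, 0 < a -> a < b -> exists f,
    [/\ preL2 f, forall x, Hab a b (f x), Pab a b xi = J f &
        dsupport (Xi f) `<=` [set - x | x in F]]].

End model.

(* Main.v *)
Require Import Defs.
From HB Require Import structures.
From mathcomp Require Import all_boot all_order all_algebra.
From mathcomp Require Import complex.
From mathcomp Require Import all_classical all_reals all_analysis.
From mathcomp Require Import measurable_realfun ring lra.

Set Implicit Arguments.
Unset Strict Implicit.
Unset Printing Implicit Defensive.

Import Order.TTheory GRing.Theory Num.Theory.
Import numFieldNormedType.Exports.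
Local Open Scope classical_set_scope.
Local Open Scope complex_scope.
Local Open Scope ring_scope.

(** Write w(x) = 1 / (1 + x^2).  On a spectral window H_(a,b) the operators
    Q(x) are comparable with w(x), so that there the completion E is the
    weighted space L^2(w dx; H_(a,b)), and all four claims are statements about
    Fourier supports in that concrete space, transported to E by the cutoffs
    P_(a,b).  These are contractions commuting with U_t and theta, and
    as the window exhausts ]0,oo[ they tend strongly to the identity, because A
    has no kernel (Pab_id, limit_windows).

    Comparability (rQ_wt) comes from solving A^2 u + x^2 u = v by minimising an
    energy (resolvent_ex), and from the commutation of the spectral projections
    with A (A_pvm).  Constant functions have finite norm in E: on a
    dyadic piece ]a, 2a] of the spectrum the integral of <Q(x) v, v> is at most
    2 |v|^2, and the pieces add up (Qint_le).  Riesz-Fischer then represents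
    every P_(a,b) xi by a window function (Pab_repr).

    The support condition is turned into countably many scalar conditions.
    A smooth partition of unity shows that the support of Xi f lies in a closed
    set S exactly when Xi f kills all test functions supported off S
    (local_global, dsupport_ann).  Since the Fourier transform of a test
    function is O(w), this condition is stable under limits in L^2(w dx), which
    makes the spectral subspaces closed; translating test functions shows that
    U_t translates them, and E_+ lies in E_([0,oo[) since the Fourier transform of exp(-itx) is
    concentrated at the point -t (ann_exp).

    For the converse inclusions let z = (1 - ix) / (1 + ix).  The powers z^n, for
    n in Z, are orthogonal for w dx (cayley_orth) and total, because their
    closure under bounded pointwise limits contains all Borel
    indicators (gz_Borel).  If Xi f vanishes on ]0,oo[, then f is
    orthogonal to z^n for n < 0: test functions concentrating near 0 give the
    vanishing of the integrals of f against all functions in the bounded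
    pointwise closure of exp(-isx), s > 0, and z^(n+1) w, n >= 0, is one of them
    (geS_kernel, ann_moments).  So f is a limit of combinations of the z^n,
    n >= 0 (trig_split), which lie in E_+ as they too are
    bounded pointwise limits of combinations of exp(-isx), s > 0 (Ep_cayley).
    When the support is {0} the same argument applied to f(x) and to f(-x)
    leaves only n = 0, that is, constant functions, which theta fixes; conversely
    theta reflects supports, so that a theta-invariant element of E_+ has its
    support in [0,oo[ and in ]-oo,0]. *)

(** * Real-valued norms *)

Section realnorm.
Context {R : realType}.

(** Norms take values in R[i]; the real part carries all the information and
    lives in an ordered field. *)
Definition nm {V : normedModType R[i]} (x : V) : R := complex.Re `|x|.

Lemma cReD (x y : R[i]) : complex.Re (x + y) = complex.Re x + complex.Re y.
Proof. by case: x y => [a b] [c d]. Qed.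
Lemma cImD (x y : R[i]) : complex.Im (x + y) = complex.Im x + complex.Im y.
Proof. by case: x y => [a b] [c d]. Qed.
Lemma cReN (x : R[i]) : complex.Re (- x) = - complex.Re x.
Proof. by case: x. Qed.
Lemma cImN (x : R[i]) : complex.Im (- x) = - complex.Im x.
Proof. by case: x. Qed.
Lemma cReM (x y : R[i]) : complex.Re (x * y) =
  complex.Re x * complex.Re y - complex.Im x * complex.Im y.
Proof. by case: x y => [a b] [c d]. Qed.
Lemma cImM (x y : R[i]) : complex.Im (x * y) =
  complex.Re x * complex.Im y + complex.Im x * complex.Re y.
Proof. by case: x y => [a b] [c d]. Qed.
Lemma cReC (x : R[i]) : complex.Re (Num.conj x) = complex.Re x.
Proof. by case: x. Qed.
Lemma cImC (x : R[i]) : complex.Im (Num.conj x) = - complex.Im x.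
Proof. by case: x. Qed.
Lemma complexP (x y : R[i]) : complex.Re x = complex.Re y ->
  complex.Im x = complex.Im y -> x = y.
Proof. by case: x y => [a b] [c d] /= -> ->. Qed.

Lemma conjR (a : R) : Num.conj (a%:C : R[i]) = a%:C.
Proof. by apply: complexP; rewrite ?cReC ?cImC /= ?oppr0. Qed.

Section nm.
Variable V : normedModType R[i].
Implicit Types x y : V.

Lemma nmE x : `|x| = (nm x)%:C.
Proof.
have : 0 <= `|x| by [].
by rewrite /nm lecE /=; case: (`|x|) => a b /= /andP[/eqP -> _].
Qed.

Lemma nm_ge0 x : 0 <= nm x.
Proof. by have : 0 <= `|x| by []; rewrite nmE lecE /= => /andP[]. Qed.

Lemma nm0 : nm (0 : V) = 0.
Proof. by rewrite /nm normr0. Qed.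

Lemma nm_eq0 x : nm x = 0 -> x = 0.
Proof. by move=> h; apply/normr0_eq0; rewrite nmE h. Qed.

Lemma nmN x : nm (- x) = nm x.
Proof. by rewrite /nm normrN. Qed.

Lemma nmD x y : nm (x + y) <= nm x + nm y.
Proof. by have := ler_normD x y; rewrite !nmE -rmorphD /= lecR. Qed.

Lemma nmB x y : nm (x - y) = nm (y - x).
Proof. by rewrite /nm distrC. Qed.

Lemma nm_tri z x y : nm (x - y) <= nm (x - z) + nm (z - y).
Proof. by rewrite (_ : x - y = (x - z) + (z - y)) ?nmD // addrA subrK. Qed.

Definition cm (a : R[i]) : R := complex.Re `|a|.

Lemma cmE a : `|a| = (cm a)%:C.
Proof. by rewrite /cm normc_def. Qed.

Lemma cm_ge0 a : 0 <= cm a.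
Proof. by rewrite /cm normc_def sqrtr_ge0. Qed.

Lemma cmM a b : cm (a * b) = cm a * cm b.
Proof. by rewrite /cm normrM !cmE -rmorphM. Qed.

Lemma cmD a b : cm (a + b) <= cm a + cm b.
Proof. by have := ler_normD a b; rewrite !cmE -rmorphD /= lecR. Qed.

Lemma cm_sqr a : cm a ^+ 2 = complex.Re a ^+ 2 + complex.Im a ^+ 2.
Proof.
case: a => a b; rewrite /cm /= sqr_sqrtr //.
by rewrite addr_ge0 // sqr_ge0.
Qed.

Lemma cm_Re a : `|complex.Re a| <= cm a.
Proof.
rewrite -ler_sqr ?nnegrE ?cm_ge0 // cm_sqr -normrX ger0_norm ?sqr_ge0 //.
by rewrite lerDl sqr_ge0.
Qed.

Lemma cm_Im a : `|complex.Im a| <= cm a.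
Proof.
rewrite -ler_sqr ?nnegrE ?cm_ge0 // cm_sqr -normrX ger0_norm ?sqr_ge0 //.
by rewrite lerDr sqr_ge0.
Qed.

Lemma cm_le a : cm a <= `|complex.Re a| + `|complex.Im a|.
Proof.
rewrite -ler_sqr ?nnegrE ?cm_ge0 ?addr_ge0 // cm_sqr sqrrD.
rewrite !real_normK ?num_real // addrAC lerDl.
by rewrite mulrn_wge0 // mulr_ge0.
Qed.

Lemma cm0 : cm 0 = 0. Proof. by rewrite /cm normr0. Qed.
Lemma cm1 : cm 1 = 1. Proof. by rewrite /cm normr1. Qed.
Lemma cmN a : cm (- a) = cm a. Proof. by rewrite /cm normrN. Qed.
Lemma cm_conj a : cm (Num.conj a) = cm a.
Proof. by rewrite /cm norm_conjC. Qed.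
Lemma cmR (a : R) : cm a%:C = `|a|.
Proof. by rewrite /cm normc_def /= expr0n addr0 sqrtr_sqr. Qed.
Lemma cm_eq0 a : cm a = 0 -> a = 0.
Proof. by move=> h; apply/normr0_eq0; rewrite cmE h. Qed.

Lemma nmZ (a : R[i]) x : nm (a *: x) = cm a * nm x.
Proof. by rewrite /nm normrZ cmE nmE -rmorphM. Qed.

Lemma posC (e : R[i]) : 0 < e -> exists2 e' : R, e = e'%:C & 0 < e'.
Proof.
by case: e => a b; rewrite ltcE /= => /andP[/eqP -> ?]; exists a.
Qed.

Lemma cvg_nm (u : nat -> V) (l : V) :
  (u n @[n --> \oo] --> l) <-> (nm (u n - l) @[n --> \oo] --> 0).
Proof.
split.
  move=> /cvgrPdist_lt h; apply/cvgrPdist_lt => e e0.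
  have e0' : 0 < e%:C :> R[i] by rewrite ltcR.
  near=> n; rewrite sub0r normrN ger0_norm ?nm_ge0 // nmB.
  have : `|l - u n| < e%:C by near: n; exact: h.
  by rewrite nmE ltcR.
move=> /cvgrPdist_lt h; apply/cvgrPdist_lt => e e0.
have [e' ee e0'] := posC e0.
near=> n; rewrite ee nmE ltcR nmB.
have : `|0 - nm (u n - l)| < e' by near: n; exact: h.
by rewrite sub0r normrN ger0_norm ?nm_ge0.
Unshelve. all: by end_near. Qed.

Lemma nm_cvg (u : nat -> V) (l : V) :
  (u n @[n --> \oo] --> l) -> (nm (u n) @[n --> \oo] --> nm l).
Proof.
move=> /cvg_nm /cvgrPdist_lt h; apply/cvgrPdist_lt => e e0.
near=> n.
have : `|0 - nm (u n - l)| < e by near: n; exact: h.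
rewrite sub0r normrN ger0_norm ?nm_ge0 // => h1.
have h2 := nm_tri l (u n) 0; have h3 := nm_tri (u n) l 0.
rewrite !subr0 in h2 h3; rewrite (nmB l) in h3.
by rewrite ltr_norml; apply/andP; split; lra.
Unshelve. all: by end_near. Qed.

Lemma cvg_uniq (u : nat -> V) (l l' : V) :
  (u n @[n --> \oo] --> l) -> (u n @[n --> \oo] --> l') -> l = l'.
Proof. by move=> h h'; exact: (cvg_unique _ h h'). Qed.

Lemma closure_nm (S : set V) (l : V) :
  closure S l <-> (forall e : R, 0 < e -> exists2 x, S x & nm (l - x) < e).
Proof.
split.
  move=> h e e0; have e0' : 0 < e%:C :> R[i] by rewrite ltcR.
  have [x [Sx]] := h _ (nbhsx_ballx l e%:C e0').
  by rewrite -ball_normE /= nmE ltcR => ?; exists x.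
move=> h B /nbhs_ballP[e /= e0 eB].
have [e' ee e0'] := posC e0.
have [x Sx lx] := h _ e0'; exists x; split => //; apply: eB.
by rewrite -ball_normE /= ee nmE ltcR.
Qed.

Lemma closure_seq (S : set V) (l : V) :
  closure S l -> exists2 u : nat -> V, (forall n, S (u n)) & 
    u n @[n --> \oo] --> l.
Proof.
move=> /closure_nm h.
have h' n : exists x, S x /\ nm (l - x) < (n.+1%:R)^-1.
  by have [|x ? ?] := h (n.+1%:R)^-1; [rewrite invr_gt0 | exists x].
have [u hu] := choice h'; exists u => [n|]; first by case: (hu n).
apply/cvg_nm; apply: (@squeeze_cvgr _ _ _ _ (fun=> 0) (@harmonic R)).
- near=> n; rewrite nm_ge0 /= nmB; apply: ltW; exact: (hu n).2.
- exact: cvg_cst.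
- exact: cvg_harmonic.
Unshelve. all: by end_near. Qed.

Lemma closed_seq (S : set V) : 
  closed S <-> (forall (u : nat -> V) (l : V), (forall n, S (u n)) ->
    u n @[n --> \oo] --> l -> S l).
Proof.
split.
  move=> cS u l uS ul; apply: (@closed_cvg _ _ \oo _ u S cS _ l ul); near=> n; exact: uS.
by move=> h l /closure_seq[u uS ul]; exact: h uS ul.
Unshelve. all: by end_near. Qed.

End nm.
End realnorm.

Section complete.
Context {R : realType} (V : completeNormedModType R[i]).

Lemma cauchy_nm (u : nat -> V) :
  (forall e : R, 0 < e -> exists N, forall n m, (N <= n)%N -> (N <= m)%N ->
     nm (u n - u m) < e) -> exists l : V, u n @[n --> \oo] --> l.
Proof.
move=> h; suff: cvgn u by move=> hu; exists (lim (u @ \oo)).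
apply/cauchy_cvgP/cauchy_exP => e e0.
have [e' ee e0'] := posC e0.
have [N hN] := h _ e0'; exists (u N), N => // n /= Nn.
by rewrite ee -ball_normE /= nmE ltcR; exact: hN.
Qed.

End complete.

(** * Complex inner products *)

Lemma disc_le {R : realType} (a b c : R) :
  (forall t, 0 <= a + t * (2 * b) + t ^+ 2 * c) -> b ^+ 2 <= a * c.
Proof.
move=> h; have [c0|c0] := eqVneq c 0.
  have [-> |b0] := eqVneq b 0; first by rewrite c0 expr0n mulr0.
  have := h (- (a + 1) / (2 * b)).
  rewrite c0 mulr0 addr0 divfK ?mulf_neq0 ?pnatr_eq0 //; lra.
have cp : 0 < c.
  rewrite lt_def c0 /= leNgt; apply/negP => cn.
  have h1 := h 0; have h2 := h 1; have h3 := h (-1).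
  pose k := (a + 1 + `|2 * b|) / - c + 1.
  have k1 : 1 <= k.
    by rewrite /k lerDr divr_ge0 ?addr_ge0 //; lra.
  have kc : k * - c = a + 1 + `|2 * b| - c.
    by rewrite /k mulrDl mul1r divfK // oppr_eq0.
  have := h k; have : `|2 * b| >= 2 * b by apply: ler_norm.
  nra.
have := h (- b / c).
have -> : a + - b / c * (2 * b) + (- b / c) ^+ 2 * c = (a * c - b ^+ 2) / c.
  by field.
by rewrite pmulr_lge0 ?invr_gt0 // subr_ge0.
Qed.

Section hilbert.
Context {R : realType} {H : completeNormedModType R[i]}.
Variable ip : {dot H for Num.conj}.
Hypothesis hH : hilbert_norm ip.

(** The value of ip with its type displayed as R[i], so that ring rewriting
    applies. *)
Definition cip (x y : H) : R[i] := ip x y.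
Definition rip (x y : H) : R := complex.Re (cip x y).

Lemma ipDl x y z : cip (x + y) z = cip x z + cip y z.
Proof. exact: linearDl. Qed.
Lemma ipNl x z : cip (- x) z = - cip x z.
Proof. exact: linearNl. Qed.
Lemma ipBl x y z : cip (x - y) z = cip x z - cip y z.
Proof. exact: linearBl. Qed.
Lemma ipZl (a : R[i]) x z : cip (a *: x) z = a * cip x z.
Proof. exact: linearZl_LR. Qed.
Lemma ip0l z : cip 0 z = 0.
Proof. exact: linear0l. Qed.
Lemma ipDr x y z : cip z (x + y) = cip z x + cip z y.
Proof. exact: linearDr. Qed.
Lemma ipNr x z : cip z (- x) = - cip z x.
Proof. exact: linearNr. Qed.
Lemma ipZr (a : R[i]) x z : cip z (a *: x) = Num.conj a * cip z x.
Proof. exact: linearZr_LR. Qed.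
Lemma ip0r z : cip z 0 = 0.
Proof. exact: linear0r. Qed.
Lemma ipC x y : cip x y = Num.conj (cip y x).
Proof. by rewrite /cip hermC /= expr0 mul1r. Qed.

Lemma ip_nm x : cip x x = (nm x ^+ 2)%:C.
Proof. by rewrite /cip -hH nmE rmorphXn. Qed.

Lemma rip_nm x : rip x x = nm x ^+ 2.
Proof. by rewrite /rip ip_nm. Qed.

Lemma ripC x y : rip x y = rip y x.
Proof. by rewrite /rip ipC; case: (cip y x). Qed.
Lemma ripDl x y z : rip (x + y) z = rip x z + rip y z.
Proof. by rewrite /rip ipDl cReD. Qed.
Lemma ripDr x y z : rip z (x + y) = rip z x + rip z y.
Proof. by rewrite /rip ipDr cReD. Qed.
Lemma ripNl x z : rip (- x) z = - rip x z.
Proof. by rewrite /rip ipNl cReN. Qed.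
Lemma ripNr x z : rip z (- x) = - rip z x.
Proof. by rewrite /rip ipNr cReN. Qed.
Lemma ripBl x y z : rip (x - y) z = rip x z - rip y z.
Proof. by rewrite ripDl ripNl. Qed.
Lemma ripBr x y z : rip z (x - y) = rip z x - rip z y.
Proof. by rewrite ripDr ripNr. Qed.
Lemma ripZl (a : R) x z : rip (a%:C *: x) z = a * rip x z.
Proof. by rewrite /rip ipZl cReM /= mul0r subr0. Qed.
Lemma ripZr (a : R) x z : rip z (a%:C *: x) = a * rip z x.
Proof. by rewrite ripC ripZl ripC. Qed.
Lemma rip0l z : rip 0 z = 0. Proof. by rewrite /rip ip0l. Qed.
Lemma rip0r z : rip z 0 = 0. Proof. by rewrite /rip ip0r. Qed.
Lemma Im_rip x y : complex.Im (cip x y) = rip x ('i *: y).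
Proof.
by rewrite /rip ipZr cReM cReC cImC; case: (cip x y) => a b /=; ring.
Qed.

Lemma nmD_sqr x y : nm (x + y) ^+ 2 = nm x ^+ 2 + 2 * rip x y + nm y ^+ 2.
Proof. by rewrite -!rip_nm ripDl !ripDr (ripC y x); ring. Qed.
Lemma nmB_sqr x y : nm (x - y) ^+ 2 = nm x ^+ 2 - 2 * rip x y + nm y ^+ 2.
Proof. by rewrite nmD_sqr ripNr nmN; ring. Qed.

Lemma rip_cs x y : `|rip x y| <= nm x * nm y.
Proof.
rewrite -ler_sqr ?nnegrE ?mulr_ge0 ?nm_ge0 // real_normK ?num_real //.
rewrite exprMn; apply: disc_le => t.
have := sqr_ge0 (nm (x + t%:C *: y)).
rewrite nmD_sqr ripZr nmZ cmR exprMn real_normK ?num_real //.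
by congr (_ <= _); ring.
Qed.

Lemma ip_cs x y : cm (cip x y) <= nm x * nm y.
Proof.
have [/cm_eq0 -> |h] := eqVneq (cm (cip x y)) 0.
  by rewrite cm0 mulr_ge0 ?nm_ge0.
have : rip x ((cip x y) *: y) <= nm x * nm (cip x y *: y).
  exact: le_trans (ler_norm _) (rip_cs _ _).
have -> : rip x (cip x y *: y) = cm (cip x y) ^+ 2.
  by rewrite /rip ipZr cm_sqr cReM cReC cImC; ring.
by rewrite nmZ expr2 mulrCA ler_pM2l // lt_def h cm_ge0.
Qed.

Lemma ip_ext x : (forall y, cip x y = 0) -> x = 0.
Proof.
move=> h; apply: nm_eq0; apply/eqP; rewrite -sqrf_eq0 -rip_nm /rip h //.
Qed.

Lemma rip_ext x : (forall y, rip x y = 0) -> x = 0.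
Proof.
by move=> h; apply: nm_eq0; apply/eqP; rewrite -sqrf_eq0 -rip_nm h.
Qed.

Lemma cvg_ip (u : nat -> H) (l : H) y : u n @[n --> \oo] --> l ->
  rip (u n) y @[n --> \oo] --> rip l y.
Proof.
move=> /cvg_nm ul; apply: (@cvg_sub0 _ _ _ _ _ _ (fun=> rip l y)); last exact: cvg_cst.
apply/norm_cvg0P; apply: (@squeeze_cvgr _ _ _ _ (fun=> 0)
   (fun n => nm (u n - l) * nm y)).
- by near=> n; rewrite normr_ge0 /=; have := rip_cs (u n - l) y; rewrite ripBl.
- exact: cvg_cst.
- by rewrite -(mul0r (nm y)); apply: cvgMl.
Unshelve. all: by end_near. Qed.

End hilbert.

(** * Self-adjoint operators *)

Section selfadjoint.
Context {R : realType} {H : completeNormedModType R[i]}.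
Variable ip : {dot H for Num.conj}.
Hypothesis hH : hilbert_norm ip.
Variable A : operator H.
Hypothesis hA : self_adjoint ip A.
Hypothesis hA0 : nonneg_operator ip A.

Local Notation "<| x , y |>" := (cip ip x y).
Local Notation rip := (rip ip).

Lemma domP v w : (forall u, op_dom A u -> <|A u, v|> = <|u, w|>) ->
  op_dom A v /\ A v = w.
Proof. by case: hA => _ _ h ?; apply/h. Qed.

Lemma domlc (a : R[i]) u v : op_dom A u -> op_dom A v -> op_dom A (a *: u + v).
Proof. by case: hA => -[[_ h] _] _ _; exact: h. Qed.

Lemma Alc (a : R[i]) u v : op_dom A u -> op_dom A v ->
  A (a *: u + v) = a *: A u + A v.
Proof. by case: hA => -[_ h] _ _; exact: h. Qed.

Lemma dom0 : op_dom A 0. Proof. by case: hA => -[[]]. Qed.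

Lemma A0 : A 0 = 0.
Proof.
by have := Alc (-1) dom0 dom0; rewrite scaler0 addr0 scaleN1r addNr.
Qed.

Lemma domZ (a : R[i]) u : op_dom A u -> op_dom A (a *: u).
Proof. by move=> h; rewrite -[_ *: _]addr0; apply: domlc => //; exact: dom0. Qed.
Lemma AZ (a : R[i]) u : op_dom A u -> A (a *: u) = a *: A u.
Proof.
by move=> h; rewrite -[_ *: _]addr0 Alc ?A0 ?addr0 //; exact: dom0.
Qed.
Lemma domD u v : op_dom A u -> op_dom A v -> op_dom A (u + v).
Proof. by move=> h1 h2; rewrite -[u]scale1r; exact: domlc. Qed.
Lemma AD u v : op_dom A u -> op_dom A v -> A (u + v) = A u + A v.
Proof. by move=> h1 h2; rewrite -{1}[u]scale1r Alc // scale1r. Qed.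
Lemma domB u v : op_dom A u -> op_dom A v -> op_dom A (u - v).
Proof. by move=> h1 h2; rewrite -scaleN1r; apply: domD => //; by apply: domZ. Qed.
Lemma AB u v : op_dom A u -> op_dom A v -> A (u - v) = A u - A v.
Proof.
by move=> h1 h2; have ? := domZ (-1) h2; rewrite -scaleN1r AD // AZ // scaleN1r.
Qed.

Lemma Asym u v : op_dom A u -> op_dom A v -> <|A u, v|> = <|u, A v|>.
Proof. by move=> hu hv; case: hA => _ _ h; have [h' _] := h v (A v); exact: h'. Qed.

Lemma rAsym u v : op_dom A u -> op_dom A v -> rip (A u) v = rip u (A v).
Proof. by move=> hu hv; rewrite /rip Asym. Qed.

Lemma rA_ge0 v : op_dom A v -> 0 <= rip (A v) v.
Proof. by move=> /hA0; rewrite lecE => /andP[]. Qed.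

Lemma dom_dense v (e : R) : 0 < e -> exists2 u, op_dom A u & nm (v - u) < e.
Proof.
case: hA => _ dA _; have : closure (op_dom A) v by rewrite dA.
by move=> /closure_nm; apply.
Qed.

(** Real parts suffice because the domain is dense: test against an element of
    the domain close to w. *)
Lemma perp_dom w : (forall u, op_dom A u -> rip w u = 0) -> w = 0.
Proof.
move=> h; apply: nm_eq0; apply/eqP; rewrite -[_ == _]negbK; apply/negP => w0.
have wp : 0 < nm w by rewrite lt_def w0 nm_ge0.
have [u du wu] := dom_dense w wp.
have : nm (w - u) ^+ 2 < nm w ^+ 2 by rewrite ltr_sqr ?nnegrE ?nm_ge0.
rewrite (nmB_sqr hH) h // mulr0 subr0 -subr_lt0 addrAC subrr add0r.
by rewrite ltNge sqr_ge0.
Qed.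

(** A coincides with its adjoint, and adjoints are closed. *)
Lemma A_closed (u : nat -> H) (l w : H) : (forall n, op_dom A (u n)) ->
  u n @[n --> \oo] --> l -> A (u n) @[n --> \oo] --> w ->
  op_dom A l /\ A l = w.
Proof.
move=> du ul Aw; apply: domP => v dv.
have rr (x : H) : op_dom A x -> rip (A x) l = rip x w.
  move=> dx; have h1 : rip (A (u n)) x @[n --> \oo] --> rip l (A x).
    rewrite (_ : (fun n => _) = (fun n => rip (u n) (A x))); first exact: cvg_ip.
    by apply/funext => n; rewrite rAsym.
  have h2 := cvg_ip hH (y := x) Aw.
  rewrite ripC // [RHS]ripC //.
  exact: (cvg_unique _ h1 h2).
apply: complexP; first exact: rr.
rewrite !Im_rip.
have := rr _ (domZ (- 'i) dv); rewrite AZ //.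
by rewrite /rip !ipZl !ipZr !cReM !cReN !cImN /= => h; lra.
Qed.

Definition energy s u := nm (A u) ^+ 2 + s * nm u ^+ 2.

(** The functional |A u|^2 + s |u|^2 - 2 Re <v, u> is bounded below on the domain
    of A.  By the parallelogram law a minimising sequence is Cauchy in the graph
    norm, so that a minimiser exists; its Euler equation says that A w satisfies the
    defining property of the domain of the adjoint of A. *)
Lemma resolvent_ex s v : 0 < s ->
  exists w, [/\ op_dom A w, op_dom A (A w) & A (A w) + s%:C *: w = v].
Proof.
move=> s0.
pose F u := energy s u - 2 * rip v u.
have Flb u : - (nm v ^+ 2 / s) <= F u.
  rewrite /F /energy.
  have h1 : rip v u <= nm v * nm u by exact: le_trans (ler_norm _) (rip_cs hH _ _).
  have h2 := sqr_ge0 (nm (A u)).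
  have : 0 <= (nm v - s * nm u) ^+ 2 / s by rewrite divr_ge0 ?sqr_ge0 ?ltW.
  have -> : (nm v - s * nm u) ^+ 2 / s = nm v ^+ 2 / s - 2 * (nm v * nm u) + s * nm u ^+ 2.
    by field; rewrite gt_eqF.
  by lra.
pose S := [set F u | u in op_dom A].
have Sinf : has_inf S.
  split; first by exists (F 0), 0 => //; exact: dom0.
  by exists (- (nm v ^+ 2 / s)) => _ [u _ <-].
pose m := inf S.
have Fm u : op_dom A u -> m <= F u.
  by move=> du; apply: ge_inf; [case: Sinf | exists u].
have mex n : exists u, op_dom A u /\ F u < m + n.+1%:R^-1.
  have [|_ [u du <-] h] := @inf_adherent _ S n.+1%:R^-1 _ Sinf.
    by rewrite invr_gt0.
  by exists u.
have [w hw] := choice mex.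
have dw n : op_dom A (w n) by case: (hw n).
(* the parallelogram law: the midpoint of w n and w k does not go below m *)
have par n k : energy s (w n - w k) <= 2 * (n.+1%:R^-1 + k.+1%:R^-1).
  have [_ h1] := hw n; have [_ h2] := hw k.
  have := Fm (2^-1%:C *: (w n + w k)) (domZ _ (domD (dw n) (dw k))).
  rewrite /F /energy in h1 h2 *; rewrite AB // AZ ?AD //; last exact: domD.
  rewrite !nmZ !exprMn cmR ger0_norm ?invr_ge0 //.
  rewrite !(nmB_sqr hH) !(nmD_sqr hH) ripZr // ripDr //.
  have e4 : (2^-1 : R) ^+ 2 = 4^-1 by field.
  rewrite e4; move: h1 h2; clear.
  move: (nm (A (w n))) (nm (A (w k))) (nm (w n)) (nm (w k)) (rip v (w n))
    (rip v (w k)) (n.+1%:R^-1) (k.+1%:R^-1) (rip (w n) (w k))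
    (rip (A (w n)) (A (w k))) => a1 a2 b1 b2 c1 c2 p q r1 r2 h1 h2 h3.
  have -> : s * (b1 ^+ 2 - 2 * r1 + b2 ^+ 2) =
    s * b1 ^+ 2 - 2 * (s * r1) + s * b2 ^+ 2 by ring.
  have h4 : 4 * m <= a1 ^+ 2 + 2 * r2 + a2 ^+ 2 +
    (s * b1 ^+ 2 + 2 * (s * r1) + s * b2 ^+ 2) - 4 * c1 - 4 * c2 by lra.
  by lra.
have cau : forall e : R, 0 < e -> exists N, forall n k, (N <= n)%N -> (N <= k)%N ->
    energy s (w n - w k) < e.
  move=> e e0; have e4 : 0 < e / 4 by lra.
  have [N _ /(_ N (leqnn _)) hN] := near_infty_natSinv_lt (PosNum e4).
  exists N => j k Nn Nk; apply: le_lt_trans (par j k) _.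
  have hh (i : nat) : (N <= i)%N -> i.+1%:R^-1 <= (N.+1%:R^-1 : R).
    by move=> Nj; rewrite lef_pV2 ?posrE // ler_nat.
  move: hN (hh _ Nn) (hh _ Nk) => /=.
  by move: (N.+1%:R^-1) (j.+1%:R^-1) (k.+1%:R^-1) => a b c; lra.
have [l wl] : exists l : H, w n @[n --> \oo] --> l.
  apply: cauchy_nm => e e0.
  have [|N hN] := cau (s * e ^+ 2); first by rewrite mulr_gt0 // exprn_gt0.
  exists N => n k Nn Nk; have := hN n k Nn Nk; rewrite /energy => h.
  rewrite -ltr_sqr ?nnegrE ?nm_ge0 ?ltW // -(ltr_pM2l s0).
  by apply: le_lt_trans h; rewrite lerDr sqr_ge0.
have [g wg] : exists g : H, A (w n) @[n --> \oo] --> g.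
  apply: cauchy_nm => e e0.
  have [|N hN] := cau (e ^+ 2); first by rewrite exprn_gt0.
  exists N => n k Nn Nk; have := hN n k Nn Nk; rewrite /energy => h.
  rewrite -AB // -ltr_sqr ?nnegrE ?nm_ge0 ?ltW //.
  by apply: le_lt_trans h; rewrite lerDl mulr_ge0 ?sqr_ge0 ?ltW.
have [dl Al] := A_closed dw wl wg.
have Fl : F l <= m.
  have c1 : F (w n) @[n --> \oo] --> F l.
    rewrite /F /energy Al.
    apply: cvgB; last first.
      apply: cvgMr; under eq_fun do rewrite ripC //.
      by rewrite ripC //; apply: cvg_ip.
    apply: cvgD; first by rewrite expr2; under eq_fun do rewrite expr2;
      apply: cvgM; exact: nm_cvg.
    by apply: cvgMr; rewrite expr2; under eq_fun do rewrite expr2;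
      apply: cvgM; exact: nm_cvg.
  have c2 : m + n.+1%:R^-1 @[n --> \oo] --> m + 0.
    by apply: cvgD; [exact: cvg_cst | exact: cvg_harmonic].
  rewrite -[m]addr0; apply: (ler_cvg_to c1 c2).
  by near=> n; apply: ltW; case: (hw n).
(* the first variation at the minimiser vanishes, by the discriminant *)
have ortho u : op_dom A u -> rip (A l) (A u) + s * rip l u - rip v u = 0.
  move=> du; set b := (X in X = 0).
  have : b ^+ 2 <= 0 * energy s u.
    apply: disc_le => t; rewrite add0r.
    have := Fm _ (domD dl (domZ t%:C du)); move: Fl.
    rewrite /F /energy /b AD ?AZ //; last by apply: domZ.
    rewrite !(nmD_sqr hH) ripDr // !ripZr // !nmZ cmR !exprMn real_normK ?num_real //.
    by move=> h1 h2; nra.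
  by rewrite mul0r => h; apply/eqP; rewrite -sqrf_eq0; apply/eqP/le_anti;
    rewrite h sqr_ge0.
have rr u : op_dom A u -> rip (A u) (A l) = rip u (v - s%:C *: l).
  by move=> du; have := ortho u du; rewrite ripBr // ripZr //
    (ripC _ _ (A u)) // (ripC _ l u) // (ripC _ v u) //; lra.
exists l; have [|? h] := @domP (A l) (v - s%:C *: l); last first.
  by split=> //; rewrite h subrK.
move=> u du; apply: complexP; first exact: rr.
rewrite !Im_rip.
have := rr _ (domZ (- 'i) du); rewrite AZ //.
by rewrite /rip !ipZl !ipZr !cReM !cReN !cImN /= => h; lra.
Unshelve. all: by end_near. Qed.

End selfadjoint.

(** * The operators Q(x) *)

Section Q.
Context {R : realType} {H : completeNormedModType R[i]}.
Variable ip : {dot H for Num.conj}.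
Hypothesis hH : hilbert_norm ip.
Variable A : operator H.
Hypothesis hA : self_adjoint ip A.
Hypothesis hA0 : nonneg_operator ip A.

Local Notation rip := (rip ip).
Local Notation Q := (Qop A).

Definition solves x v w :=
  [/\ op_dom A w, op_dom A (A w) & A (A w) + (x ^+ 2)%:C *: w = v].

(** Pairing the equation with its own solution is what yields uniqueness and all
    the bounds below. *)
Lemma solves_energy x v w : solves x v w ->
  rip v w = nm (A w) ^+ 2 + x ^+ 2 * nm w ^+ 2.
Proof.
move=> [d1 d2 <-]; rewrite ripDl // ripZl // !rip_nm // (rAsym hA) //.
by rewrite rip_nm.
Qed.

Lemma solves_lc x (a : R[i]) v1 v2 w1 w2 : solves x v1 w1 -> solves x v2 w2 ->
  solves x (a *: v1 + v2) (a *: w1 + w2).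
Proof.
move=> [d1 d2 <-] [e1 e2 <-]; split.
- exact: (domlc hA).
- by rewrite (Alc hA) //; exact: (domlc hA).
- rewrite !(Alc hA) // !scalerDr !scalerA (mulrC a) -!addrA; congr (_ + _).
  by rewrite [RHS]addrC -!addrA; congr (_ + _); rewrite addrC.
Qed.

Lemma x2_gt0 (x : R) : x != 0 -> 0 < x ^+ 2.
Proof. by move=> x0; rewrite lt_def sqrf_eq0 x0 sqr_ge0. Qed.

Lemma solves_ex x v : x != 0 -> exists w, solves x v w.
Proof.
by move=> x0; have [w [? ? ?]] := resolvent_ex hH hA v (x2_gt0 x0); exists w.
Qed.

Lemma solves0 x w : x != 0 -> solves x 0 w -> w = 0.
Proof.
move=> x0 h; have := solves_energy h; rewrite rip0l => /esym/eqP.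
rewrite paddr_eq0; [|exact: sqr_ge0|by apply: mulr_ge0; exact: sqr_ge0].
move=> /andP[_].
by rewrite mulf_eq0 !sqrf_eq0 (negbTE x0) /= => /eqP/nm_eq0.
Qed.

Lemma QopE x v w : x != 0 -> solves x v w -> Q x v = (pi^-1)%:C *: A w.
Proof.
move=> x0 h; apply: xget_unique => [|u [w' [d1 d2 e1 ->]]].
  by case: h => *; exists w.
have := solves_lc (-1) h (And3 d1 d2 e1).
rewrite !scaleN1r addNr => /(solves0 x0)/eqP.
by rewrite addr_eq0 eqr_opp => /eqP ->.
Qed.

Lemma Qlc x (a : R[i]) u v : x != 0 -> Q x (a *: u + v) = a *: Q x u + Q x v.
Proof.
move=> x0; have [w1 h1] := solves_ex u x0; have [w2 h2] := solves_ex v x0.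
rewrite (QopE x0 h1) (QopE x0 h2) (QopE x0 (solves_lc a h1 h2)).
have [d1 _ _] := h1; have [d2 _ _] := h2.
by rewrite (Alc hA) // scalerDr !scalerA mulrC.
Qed.

Lemma Q0 x : x != 0 -> Q x 0 = 0.
Proof.
move=> x0; have := Qlc (-1) 0 0 x0.
by rewrite scaler0 addr0 scaleN1r addNr.
Qed.
Lemma QZ x (a : R[i]) u : x != 0 -> Q x (a *: u) = a *: Q x u.
Proof. by move=> x0; rewrite -[a *: u]addr0 Qlc // Q0 // addr0. Qed.
Lemma QD x u v : x != 0 -> Q x (u + v) = Q x u + Q x v.
Proof. by move=> x0; rewrite -{1}[u]scale1r Qlc // scale1r. Qed.
Lemma QB x u v : x != 0 -> Q x (u - v) = Q x u - Q x v.
Proof. by move=> x0; rewrite -scaleN1r QD // QZ // scaleN1r. Qed.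

Lemma Q_sym x u v : x != 0 -> cip ip (Q x u) v = cip ip u (Q x v).
Proof.
move=> x0; have [w1 h1] := solves_ex u x0; have [w2 h2] := solves_ex v x0.
rewrite (QopE x0 h1) (QopE x0 h2) ipZl ipZr.
rewrite conjR; congr (_ * _); case: h1 => a1 b1 <-; case: h2 => a2 b2 <-.
by rewrite ipDl ipDr ipZl ipZr conjR -(Asym hA) // (Asym hA a1 a2).
Qed.

Lemma rQ_sym x u v : x != 0 -> rip (Q x u) v = rip u (Q x v).
Proof. by move=> x0; rewrite /rip Q_sym. Qed.

Lemma rQE x v w : x != 0 -> solves x v w ->
  rip (Q x v) v = pi^-1 * (rip (A (A w)) (A w) + x ^+ 2 * rip (A w) w).
Proof.
move=> x0 h; rewrite (QopE x0 h) ripZl //; congr (_ * _).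
by case: h => _ _ <-; rewrite ripDr // ripZr // ripC.
Qed.

Lemma rQ_ge0 x v : x != 0 -> 0 <= rip (Q x v) v.
Proof.
move=> x0; have [w h] := solves_ex v x0; rewrite (rQE x0 h).
case: h => d1 d2 _; rewrite mulr_ge0 ?invr_ge0 ?pi_ge0 // addr_ge0 //.
  exact: (rA_ge0 hA0).
by rewrite mulr_ge0 ?sqr_ge0 //; exact: (rA_ge0 hA0).
Qed.

Lemma solves_nm x v w : x != 0 -> solves x v w ->
  `|x| * nm (A w) <= nm v /\ x ^+ 2 * nm w <= nm v.
Proof.
move=> x0 h; have e := solves_energy h.
have cs : nm (A w) ^+ 2 + x ^+ 2 * nm w ^+ 2 <= nm v * nm w.
  by rewrite -e; exact: le_trans (ler_norm _) (rip_cs hH _ _).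
have xp := x2_gt0 x0; have a0 := nm_ge0 (A w).
have w0 := nm_ge0 w; have v0 := nm_ge0 v.
have h2 : x ^+ 2 * nm w <= nm v.
  have [->|wn0] := eqVneq (nm w) 0; first by rewrite mulr0.
  have wp : 0 < nm w by rewrite lt_def wn0.
  rewrite -(ler_pM2r wp) -mulrA -expr2; apply: le_trans cs.
  by rewrite lerDr sqr_ge0.
split=> //; rewrite -ler_sqr ?nnegrE ?mulr_ge0 // exprMn real_normK ?num_real //.
apply: (@le_trans _ _ (nm v * (x ^+ 2 * nm w))).
  have : x ^+ 2 * (nm (A w) ^+ 2 + x ^+ 2 * nm w ^+ 2) <= x ^+ 2 * (nm v * nm w).
    by rewrite ler_pM2l.
  have : 0 <= x ^+ 2 * (x ^+ 2 * nm w ^+ 2).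
    by apply: mulr_ge0; [|apply: mulr_ge0]; exact: sqr_ge0.
  by nra.
by rewrite expr2 ler_wpM2l.
Qed.

Lemma Q_bnd x v : x != 0 -> nm (Q x v) <= (pi * `|x|)^-1 * nm v.
Proof.
move=> x0; have [w h] := solves_ex v x0; rewrite (QopE x0 h) nmZ cmR.
rewrite ger0_norm ?invr_ge0 ?pi_ge0 // invfM -mulrA ler_pM2l ?invr_gt0 ?pi_gt0 //.
rewrite ler_pdivlMl ?normr_gt0 //.
by have [] := solves_nm x0 h.
Qed.

(** The first resolvent identity for A^2; with the bound on Q x it gives the
    continuity in x, hence the measurability. *)
Lemma Q_diff x y v w : x != 0 -> y != 0 -> solves y v w ->
  Q x v - Q y v = Q x ((y ^+ 2 - x ^+ 2)%:C *: w).
Proof.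
move=> x0 y0 h; have [w1 h1] := solves_ex v x0.
rewrite (QopE x0 h1) (QopE y0 h).
have [d1 e1 f1] := h1; have [d2 e2 f2] := h.
rewrite (@QopE x _ (w1 - w)) //.
  by rewrite (AB hA) // scalerBr.
split; first exact: (domB hA).
  by rewrite (AB hA) //; exact: (domB hA).
rewrite !(AB hA) // scalerBr addrACA f1 -opprD -f2.
by rewrite opprD addrACA subrr add0r -scalerBl -rmorphB.
Qed.

Lemma Q_cont y v z : y != 0 ->
  rip (Q x v) z @[x --> y] --> rip (Q y v) z.
Proof.
move=> y0; have [w h] := solves_ex v y0.
apply: (@cvg_sub0 _ _ _ _ _ _ (fun=> rip (Q y v) z)); last exact: cvg_cst.
apply/norm_cvg0P; apply: (@squeeze_cvgr _ _ _ _ (fun=> 0)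
   (fun x => (pi * `|x|)^-1 * (`|y ^+ 2 - x ^+ 2| * nm w) * nm z)).
- near=> x; have x0 : x != 0.
    by near: x; apply: open_neq.
  rewrite normr_ge0 /=; have := rip_cs hH (Q x v - Q y v) z.
  rewrite ripBl // => /le_trans; apply.
  rewrite ler_wpM2r ?nm_ge0 // (Q_diff x0 y0 h).
  by apply: le_trans (Q_bnd _ x0) _; rewrite nmZ cmR.
- exact: cvg_cst.
- rewrite [X in _ --> X](_ : _ = (pi * `|y|)^-1 * (`|y ^+ 2 - y ^+ 2| * nm w) * nm z); last first.
    by rewrite subrr normr0 mul0r mulr0 mul0r.
  apply: cvgMl; apply: cvgM.
    apply: cvgV; first by rewrite mulf_neq0 ?normr_eq0 // gt_eqF ?pi_gt0.
    by apply: cvgMr; apply: cvg_norm; exact: cvg_id.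
  apply: cvgMl; apply: cvg_norm; apply: cvgB; first exact: cvg_cst.
  exact: exprn_continuous.
Unshelve. all: by end_near. Qed.

Lemma measurable_Q v z : measurable_fun setT (fun x : R => rip (Q x v) z).
Proof.
have -> : [set: R] = [set x | x != 0] `|` [set 0].
  by apply/seteqP; split => x //= _; have [->|] := eqVneq x 0; [right|left].
have o0 : open [set x : R | x != 0] by exact: open_neq.
apply/measurable_funU => //; first exact: open_measurable.
split; last exact: measurable_fun_set1.
apply: open_continuous_measurable_fun => // x.
by rewrite inE => x0; exact: Q_cont.
Qed.

End Q.

(** * Spectral measures *)

Lemma sqr_cvg0 {R : realType} (u : nat -> R) : (forall n, 0 <= u n) ->
  u n ^+ 2 @[n --> \oo] --> 0 -> u n @[n --> \oo] --> 0.
Proof.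
move=> u0 h; have := cvg_comp _ _ h (@sqrt_continuous R 0).
by rewrite /comp sqrtr0; under eq_fun do rewrite sqrtr_sqr ger0_norm //.
Qed.

Section spectral.
Context {R : realType} {H : completeNormedModType R[i]}.
Variable ip : {dot H for Num.conj}.
Hypothesis hH : hilbert_norm ip.
Variable P : pvm ip.

Local Notation rip := (rip ip).
Local Notation mu := (pvm_scalar P).
Implicit Types B C : set R.

Lemma pvm0 B : measurable B -> P B 0 = 0.
Proof.
move=> mB; have := pvm_linear P mB (-1) 0 0.
by rewrite scaler0 addr0 scaleN1r addNr.
Qed.
Lemma pvmZ B (a : R[i]) v : measurable B -> P B (a *: v) = a *: P B v.
Proof.
by move=> mB; rewrite -[a *: v]addr0 (pvm_linear P) // pvm0 // addr0.
Qed.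
Lemma pvmD B u v : measurable B -> P B (u + v) = P B u + P B v.
Proof.
by move=> mB; rewrite -{1}[u]scale1r (pvm_linear P) // scale1r.
Qed.
Lemma pvmN B v : measurable B -> P B (- v) = - P B v.
Proof. by move=> mB; rewrite -scaleN1r pvmZ // scaleN1r. Qed.
Lemma pvmB B u v : measurable B -> P B (u - v) = P B u - P B v.
Proof. by move=> mB; rewrite pvmD // pvmN. Qed.

Lemma pvmI B C v : measurable B -> measurable C ->
  P B (P C v) = P (B `&` C) v.
Proof. by move=> mB mC; rewrite (pvm_setI P). Qed.
Lemma pvm_idem B v : measurable B -> P B (P B v) = P B v.
Proof. by move=> mB; rewrite pvmI // setIid. Qed.
Lemma rpvm_sym B u v : measurable B -> rip (P B u) v = rip u (P B v).
Proof. by move=> mB; rewrite /rip /cip (pvm_sym P). Qed.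
Lemma rpvm B v : measurable B -> rip (P B v) v = nm (P B v) ^+ 2.
Proof. by move=> mB; rewrite -{1}pvm_idem // rpvm_sym // rip_nm. Qed.

Lemma muE v B : mu v B = (nm (P B v) ^+ 2)%:E.
Proof. by rewrite /mu -(rip_nm hH). Qed.

Lemma pvm_setC B v : measurable B -> P (~` B) v = v - P B v.
Proof.
move=> mB; have mC : measurable (~` B) by exact: measurableC.
have o : rip (P B v) (P (~` B) v) = 0.
  by rewrite rpvm_sym // pvmI // setICr pvm_set0 rip0r.
have s : nm v ^+ 2 = nm (P B v) ^+ 2 + nm (P (~` B) v) ^+ 2.
  have : mu v (B `|` ~` B) = (mu v B + mu v (~` B))%E.
    by apply: measureU => //; rewrite setICr.
  by rewrite setUv !muE pvm_setT => -[].
apply/eqP; rewrite -subr_eq0 opprB addrA; apply/eqP/nm_eq0/eqP.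
rewrite -sqrf_eq0 (nmB_sqr hH) (nmD_sqr hH) ripDl.
rewrite (ripC ip (P (~` B) v) v) [rip v _](ripC ip).
rewrite [X in X + _ + _](_ : _ = nm (P B v) ^+ 2 + nm (P (~` B) v) ^+ 2).
  by rewrite !rpvm // s; apply/eqP; ring.
by rewrite [rip (P (~` B) v) _](ripC ip) o; ring.
Qed.

Lemma pvm_pyth B v : measurable B ->
  nm v ^+ 2 = nm (P B v) ^+ 2 + nm (v - P B v) ^+ 2.
Proof.
by move=> mB; rewrite (nmB_sqr hH) (ripC ip v) rpvm //; ring.
Qed.

Lemma pvm_le B v : measurable B -> nm (P B v) <= nm v.
Proof.
move=> mB; rewrite -ler_sqr ?nnegrE ?nm_ge0 // (pvm_pyth v mB) lerDl.
exact: sqr_ge0.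
Qed.

Lemma pvm_cvg B (u : nat -> H) (l : H) : measurable B ->
  u n @[n --> \oo] --> l -> P B (u n) @[n --> \oo] --> P B l.
Proof.
move=> mB /cvg_nm ul; apply/cvg_nm.
apply: (@squeeze_cvgr _ _ _ _ (fun=> 0) (fun n => nm (u n - l))) => //.
  by near=> n; rewrite nm_ge0 -pvmB //= pvm_le.
exact: cvg_cst.
Unshelve. all: by end_near. Qed.

(** The scalar measure of P B v is the one of v restricted to B, as P is
    multiplicative on intersections. *)
Lemma mu_restr v B f : measurable B ->
  measurable_fun setT f ->
  (\int[mu (P B v)]_x f x = \int[mu v]_(x in B) f x)%E.
Proof.
move=> mB mf; have mC : measurable (~` B) by exact: measurableC.
rewrite -(setUv B) integral_setU //; last 2 first.
- by rewrite setUv.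
- by apply/disj_set2P; rewrite setICr.
rewrite (eq_measure_integral (mu v)); last first.
  by move=> C mC' CB; rewrite /= !muE pvmI // setIidl.
rewrite [X in (_ + X = _)%E](eq_measure_integral (@mzero _ _ R)); last first.
  move=> C mC' CB; rewrite /= muE pvmI //.
  rewrite (_ : C `&` B = set0) ?pvm_set0 ?nm0 ?expr0n //.
  by apply/seteqP; split => x // [/CB].
by rewrite integral_measure_zero adde0.
Qed.

Variable A : operator H.
Hypothesis hA : self_adjoint ip A.
Hypothesis hA0 : nonneg_operator ip A.
Hypothesis hP : is_spectral_measure A P.

Lemma domE v : op_dom A v <-> (\int[mu v]_x (x ^+ 2)%:E < +oo)%E.
Proof. by case: hP => -> _. Qed.

Lemma msqr : measurable_fun setT (fun x : R => (x ^+ 2)%:E).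
Proof. by apply/measurable_EFinP; exact: exprn_measurable. Qed.

Lemma pvm_dom B v : measurable B -> op_dom A v -> op_dom A (P B v).
Proof.
move=> mB /domE h; apply/domE; apply: le_lt_trans h.
rewrite mu_restr //; last exact: msqr.
apply: ge0_subset_integral => //; first exact: msqr.
by move=> x _; rewrite lee_fin sqr_ge0.
Qed.

Lemma dom_bnd B v (b : R) : measurable B -> B `<=` `[-b, b]%classic ->
  op_dom A (P B v).
Proof.
move=> mB Bb; apply/domE; rewrite mu_restr //; last exact: msqr.
apply: (@le_lt_trans _ _ (\int[mu v]_(x in B) (b ^+ 2)%:E)%E).
  apply: ge0_le_integral => //.
  - by move=> x _; rewrite lee_fin sqr_ge0.
  - exact: measurable_funTS msqr.
  - move=> x /Bb /=; rewrite in_itv /= => /andP[h1 h2].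
    by rewrite lee_fin; nra.
by rewrite integral_cst //= muE -EFinM ltry.
Qed.

Lemma rA_int v : op_dom A v -> rip (A v) v = \int[mu v]_x x.
Proof. by case: hP => _ h /h; rewrite /rip /cip => ->. Qed.

Lemma mu_setT v : mu v setT = (nm v ^+ 2)%:E.
Proof. by rewrite muE pvm_setT. Qed.

Lemma id_integrable v : op_dom A v -> (mu v).-integrable setT (EFin \o id).
Proof.
move=> /domE h.
have hh (x : R) : `|x| <= `|1 + x ^+ 2|.
  rewrite [leRHS]ger0_norm ?addr_ge0 ?sqr_ge0 //.
  rewrite -(@real_normK _ x) ?num_real //; have := sqr_ge0 (`|x| - 1); nra.
apply: (le_integrable (D := setT) (mu := mu v) measurableT
  (f := EFin \o id) (g := fun x : R => (1 + x ^+ 2)%:E)).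
- exact/measurable_EFinP.
- by move=> x _; rewrite lee_fin hh.
apply/integrableP; split.
  by apply/measurable_EFinP/measurable_funD => //; exact: exprn_measurable.
under eq_integral => x _ do rewrite gee0_abs ?lee_fin ?addr_ge0 ?sqr_ge0 // EFinD.
rewrite ge0_integralD //.
- by rewrite integral_cst //= mul1e mu_setT lte_add_pinfty // ltry.
- by move=> x _; rewrite lee_fin sqr_ge0.
- exact: msqr.
Qed.

Lemma rA_pvm B v : measurable B -> op_dom A v ->
  rip (A (P B v)) (P B v) = \int[mu v]_(x in B) x.
Proof.
move=> mB dv; rewrite rA_int; last exact: pvm_dom.
rewrite /Rintegral mu_restr //.
Qed.

(** Integrals over B and over its complement add up; by polarisation this
    diagonal identity contains the commutation of A with P B. *)
Lemma rA_split B v : measurable B -> op_dom A v ->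
  rip (A v) v = rip (A (P B v)) (P B v) + rip (A (v - P B v)) (v - P B v).
Proof.
move=> mB dv; rewrite -pvm_setC // !rA_pvm //; last exact: measurableC.
rewrite rA_int // -{1}(setUv B) Rintegral_setU ?setUv //.
- exact: measurableC.
- exact: id_integrable.
- by apply/disj_set2P; rewrite setICr.
Qed.

Lemma rA_cross B u v : measurable B -> op_dom A u -> op_dom A v ->
  rip (A (P B u)) (v - P B v) = 0.
Proof.
move=> mB du dv.
have du' := pvm_dom mB du; have dv' := pvm_dom mB dv.
have dw : op_dom A (v - P B v) by exact: (domB hA).
have := rA_split mB (domD hA du' dw).
rewrite pvmD // pvmB // !pvm_idem // subrr addr0 [P B u + _]addrC addrK.
move: (v - P B v) dw => w dw.
rewrite (AD hA dw du') ripDl !ripDr (rAsym hA dw du') (ripC ip _ (A (P B u))).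
lra.
Qed.

(** Both P B (A (1 - P B) v) and (1 - P B) A (P B v) are orthogonal to the
    dense domain, by rA_cross. *)
Lemma A_pvm B v : measurable B -> op_dom A v -> A (P B v) = P B (A v).
Proof.
move=> mB dv; have dv' := pvm_dom mB dv.
have dw : op_dom A (v - P B v) by exact: (domB hA).
have e1 : A (P B v) - P B (A (P B v)) = 0.
  apply: (perp_dom hH hA) => u du.
  by rewrite ripBl rpvm_sym // -ripBr rA_cross.
have e2 : P B (A (v - P B v)) = 0.
  apply: (perp_dom hH hA) => u du.
  rewrite rpvm_sym // (rAsym hA) //; last exact: pvm_dom.
  by rewrite (ripC ip) rA_cross.
move: e2; rewrite (AB hA) // pvmB // => /eqP; rewrite subr_eq0 => /eqP ->.
by apply/eqP; rewrite -subr_eq0 e1.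
Qed.

Lemma rA_bnd B v (a b : R) : measurable B -> B `<=` `[a, b]%classic ->
  P B v = v -> op_dom A v ->
  a * nm v ^+ 2 <= rip (A v) v <= b * nm v ^+ 2.
Proof.
move=> mB Bab Bv dv.
have mvB : nm v ^+ 2 = fine (mu v B) by rewrite muE Bv.
have -> : rip (A v) v = \int[mu v]_(x in B) x by rewrite -rA_pvm // Bv.
have ix : (mu v).-integrable B (EFin \o id).
  by apply: (integrableS _ _ _ (id_integrable dv)).
have ic k : (mu v).-integrable B (EFin \o cst k).
  apply/integrableP; split; first exact/measurable_EFinP.
  rewrite [ltLHS](_ : _ = \int[mu v]_(x in B) (cst `|k|%:E x))%E //.
  by rewrite integral_cst //= muE -EFinM ltry.
rewrite mvB -!Rintegral_cst //; apply/andP; split; apply: le_Rintegral => //.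
- exact: ic.
- by move=> x /Bab /=; rewrite in_itv /= => /andP[].
- exact: ic.
- by move=> x /Bab /=; rewrite in_itv /= => /andP[].
Qed.

Hypothesis hker : ker_operator A = [set 0].

(** A vector concentrated at the point 0 of the spectrum is killed by A. *)
Lemma pvm_ker v : P [set 0] v = 0.
Proof.
have m0 : measurable [set 0 : R] by [].
have d w : op_dom A (P [set 0] w).
  by apply: (@dom_bnd _ _ 0) => // x -> /=; rewrite in_itv /= oppr0 lexx.
have q w : rip (A (P [set 0] w)) (P [set 0] w) = 0.
  have s0 : [set 0 : R] `<=` `[0, 0]%classic by move=> x -> /=; rewrite in_itv /= lexx.
  have := rA_bnd m0 s0 (pvm_idem _ m0) (d w).
  by rewrite !mul0r => /le_anti.
set u := P [set 0] v.
have qq w : rip (A u) (P [set 0] w) = 0.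
  have := q (v + w); rewrite pvmD // (AD hA) // ripDl !ripDr // -/u.
  rewrite q -[rip (A u) u]/(rip (A (P [set 0] v)) (P [set 0] v)) q.
  by rewrite (rAsym hA (d w) (d v)) (ripC ip _ (A _)); lra.
have Au : A u = 0.
  apply: (rip_ext hH) => w; rewrite -(qq w) -rpvm_sym // -A_pvm //; last exact: d.
  by rewrite pvm_idem.
have : ker_operator A u by split=> //; exact: d.
by rewrite hker.
Qed.

(** On a window inside ]-oo, 0[ the form of A would be negative. *)
Lemma pvm_neg v (a b : R) : b < 0 -> P `[a, b]%classic v = 0.
Proof.
move=> b0; have mB : measurable `[a, b]%classic by [].
set u := P _ v.
have du : op_dom A u.
  apply: (@dom_bnd _ _ (`|a| + `|b|)) => // x /=; rewrite !in_itv /= => /andP[h1 h2].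
  have := ler_norm b; have := ler_norm (-a); have := normr_ge0 a.
  by rewrite normrN; have := normr_ge0 b; move=> ? ? ? ?; apply/andP; split; lra.
have /andP[_ h] := rA_bnd mB (@subset_refl _ _) (pvm_idem v mB) du.
have h2 := rA_ge0 hA0 du.
have h3 : nm u ^+ 2 <= 0.
  rewrite -(ler_nM2l b0) mulr0; exact: le_trans h2 h.
by apply: nm_eq0; apply/eqP; rewrite -sqrf_eq0; apply/eqP/le_anti; rewrite h3 sqr_ge0.
Qed.

Definition Iab (n : nat) : set R := `[n.+1%:R^-1, n.+2%:R]%classic.

Lemma archi_between (y : R) : 0 < y -> exists N, forall n, (N <= n)%N ->
  n.+1%:R^-1 <= y /\ y <= n.+1%:R.
Proof.
move=> y0; exists (maxn (Num.bound y) (Num.bound y^-1)) => n.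
rewrite geq_max => /andP[h1 h2].
have b1 := archi_boundP (ltW y0).
have yi : 0 < y^-1 by rewrite invr_gt0.
have b2 := archi_boundP (ltW yi).
have l (m : nat) : (m <= n)%N -> m%:R <= (n.+1%:R : R).
  by move=> mn; rewrite ler_nat leqW.
split; last by apply: le_trans (ltW b1) (l _ h1).
rewrite -[y]invrK lef_pV2 ?posrE //.
by apply: le_trans (ltW b2) (l _ h2).
Qed.

Lemma mu_neg v : mu v `]-oo, 0%R]%classic = 0%E.
Proof.
pose F n : set R := if n is n'.+1 then `[- n'.+1%:R, - n'.+1%:R^-1]%classic else [set 0].
have -> : `]-oo, 0%R]%classic = \bigcup_n F n.
  apply/seteqP; split => [x /=|x [n _]]; rewrite ?in_itv /=.
    move=> xle; have [->|x0] := eqVneq x 0; first by exists 0%N.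
    have xn : 0 < - x by rewrite oppr_gt0 lt_neqAle x0.
    have [N /(_ N (leqnn _))[h1 h2]] := archi_between xn.
    by exists N.+1 => //=; rewrite in_itv /= lerNl h2 lerNr h1.
  case: n => [/= ->|n]; first by rewrite in_itv /= lexx.
  by rewrite /= in_itv /= => /andP[_ /le_trans]; apply; rewrite oppr_le0 invr_ge0.
have mF n : measurable (F n).
  by case: n => [|n] /=; [exact: measurable_set1 | exact: measurable_itv].
apply/eqP; rewrite eq_le measure_ge0 andbT.
have : (mu v).-negligible (\bigcup_n F n).
  apply: negligible_bigcup => n; exists (F n); split => //.
  rewrite /= muE; case: n => [|n] /=; first by rewrite pvm_ker nm0 expr0n.
  by rewrite pvm_neg ?nm0 ?expr0n // oppr_lt0 invr_gt0.
by move=> /negligibleP -> //; exact: bigcupT_measurable.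
Qed.

(** The windows exhaust ]0, +oo[, and the scalar measure of v gives no mass to the
    rest of the line: A is nonnegative and has no kernel. *)
Lemma pvm_approx v : P (Iab n) v @[n --> \oo] --> v.
Proof.
have mI n : measurable (Iab n) by exact: measurable_itv.
have UI : \bigcup_n Iab n = `]0, +oo[%classic.
  apply/seteqP; split => [x [n _]|x]; rewrite /Iab /= !in_itv /= ?andbT.
    by move=> /andP[h _]; apply: lt_le_trans h; rewrite invr_gt0.
  move=> x0; have [N /(_ N (leqnn _))[h1 h2]] := archi_between x0.
  by exists N => //; rewrite /Iab /= in_itv /= h1 (le_trans h2) // ler_nat.
have c : (mu v \o Iab) n @[n --> \oo] --> mu v (\bigcup_n Iab n).
  apply: nondecreasing_cvg_mu => //; first by rewrite UI.
  move=> n m nm; apply/subsetPset => x; rewrite /Iab /= !in_itv /= => /andP[h1 h2].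
  apply/andP; split; [apply: le_trans h1|apply: (le_trans h2)].
    by rewrite lef_pV2 ?posrE // ler_nat ltnS.
  by rewrite ler_nat !ltnS.
have e : mu v (\bigcup_n Iab n) = (nm v ^+ 2)%:E.
  have : (mu v (`]-oo, 0%R]%classic `|` ~` `]-oo, 0%R]%classic) =
    mu v `]-oo, 0%R]%classic + mu v (~` `]-oo, 0%R]%classic))%E.
    apply: measureU => //; first exact: measurableC.
    by rewrite setICr.
  by rewrite UI mu_neg add0e setUv mu_setT setCitvl.
rewrite e in c; have c1 := fine_cvg c.
have c2 : nm v ^+ 2 - nm (P (Iab n) v) ^+ 2 @[n --> \oo] --> 0.
  rewrite -(subrr (nm v ^+ 2)); apply: cvgB; first exact: cvg_cst.
  by under eq_fun do rewrite -[_ ^+ 2]/(fine _%:E) -muE; exact: c1.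
apply/cvg_nm; apply: sqr_cvg0 => [n|]; first exact: nm_ge0.
rewrite (_ : (fun n => _) = (fun n => nm v ^+ 2 - nm (P (Iab n) v) ^+ 2)) //.
by apply/funext => n; rewrite nmB (pvm_pyth v (mI n)); ring.
Qed.

End spectral.

(** * The size of Q(x) *)

Section cauchy_density.
Context {R : realType}.
Local Notation mu := (@lebesgue_measure R).

Lemma int_cauchy (a : R) : 0 < a ->
  (\int[mu]_x (a ^+ 2 + x ^+ 2)^-1%:E = (pi / a)%:E)%E.
Proof.
move=> a0.
have p (x : R) : 0 < a ^+ 2 + x ^+ 2 by rewrite ltr_pwDl ?exprn_gt0 ?sqr_ge0.
have c : continuous (fun x : R => (a ^+ 2 + x ^+ 2)^-1).
  move=> x; apply: cvgV; first by rewrite gt_eqF.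
  by apply: cvgD; [exact: cvg_cst | exact: exprn_continuous].
rewrite (ge0_symfun_integralT (f := fun x => (a ^+ 2 + x ^+ 2)^-1)) //; last 2 first.
- by move=> x; rewrite invr_ge0 ltW.
- by move=> x /=; rewrite sqrrN.
have -> : [set x : R | 0 <= x] = `[0, +oo[%classic.
  by apply/seteqP; split => x /=; rewrite in_itv /= andbT.
pose F (x : R) := a^-1 * atan (x / a).
have dF (x : R) : is_derive x 1 F ((a ^+ 2 + x ^+ 2)^-1).
  have -> : F = a^-1 *: (atan \o (a^-1 *: id)).
    by apply/funext => y; rewrite /F [y / a]mulrC.
  apply: is_derive_eq.
  rewrite /GRing.scale /= -[a^-1 *: x]/(a^-1 * x).
  by field; rewrite !gt_eqF.
rewrite (@ge0_continuous_FTC2y _ _ F 0 (a^-1 * (pi / 2))).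
- rewrite /F mul0r atan0 mulr0 sube0 -EFinM; congr EFin; field.
  by rewrite gt_eqF.
- by move=> x _; rewrite invr_ge0 ltW.
- exact: continuous_subspaceT.
- apply: cvgMr; apply: (@cvg_comp _ _ _ (fun x : R => x / a) (@atan R) _ _ _ _ (@cvgy_atan R)).
  by apply: gt0_cvgMly; [rewrite invr_gt0 | exact: cvg_id].
- by move=> x _; case: (dF x).
- apply: cvg_at_right_filter; apply: differentiable_continuous.
  by apply/derivable1_diffP; case: (dF 0).
- by move=> x _; rewrite derive1E; case: (dF x).
Qed.

End cauchy_density.

Section Qspec.
Context {R : realType} {H : completeNormedModType R[i]}.
Variable ip : {dot H for Num.conj}.
Hypothesis hH : hilbert_norm ip.
Variable P : pvm ip.
Variable A : operator H.
Hypothesis hA : self_adjoint ip A.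
Hypothesis hA0 : nonneg_operator ip A.
Hypothesis hker : ker_operator A = [set 0].
Hypothesis hP : is_spectral_measure A P.

Local Notation rip := (rip ip).
Local Notation Q := (Qop A).
Implicit Types B C : set R.
Local Notation mu := (@lebesgue_measure R).

Lemma solves_pvm x B v w : measurable B -> solves A x v w ->
  solves A x (P B v) (P B w).
Proof.
move=> mB [d1 d2 <-]; split.
- exact: (pvm_dom hH hP).
- by rewrite (A_pvm hH hA hP) //; exact: (pvm_dom hH hP).
- by rewrite !(A_pvm hH hA hP) // pvmD // pvmZ.
Qed.

Lemma Q_pvm x B v : x != 0 -> measurable B -> Q x (P B v) = P B (Q x v).
Proof.
move=> x0 mB; have [w h] := solves_ex hH hA v x0.
rewrite (QopE hH hA x0 h) (QopE hH hA x0 (solves_pvm mB h)).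
by case: h => d1 _ _; rewrite (A_pvm hH hA hP) // pvmZ.
Qed.

Lemma rQ_split x B v : x != 0 -> measurable B ->
  rip (Q x v) v = rip (Q x (P B v)) (P B v) + rip (Q x (v - P B v)) (v - P B v).
Proof.
move=> x0 mB.
rewrite (QB hH hA) // Q_pvm // ripBl !ripBr !rpvm_sym // !pvm_idem //.
ring.
Qed.

Lemma rQ_pvm_le x B v : x != 0 -> measurable B ->
  rip (Q x (P B v)) (P B v) <= rip (Q x v) v.
Proof. by move=> x0 mB; rewrite (rQ_split v x0 mB) lerDl (rQ_ge0 hH hA hA0). Qed.

Lemma dom_window B v (a b : R) : measurable B -> B `<=` `[a, b]%classic ->
  0 < a -> P B v = v -> op_dom A v.
Proof.
move=> mB Bab a0 <-; apply: (dom_bnd hH hP (b := b) _ mB) => x /Bab /=.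
by rewrite !in_itv /= => /andP[h1 h2]; rewrite h2 andbT; lra.
Qed.

Lemma nmA_bnd B w (a b : R) : measurable B -> B `<=` `[a, b]%classic ->
  0 < a -> P B w = w -> a * nm w <= nm (A w) <= b * nm w.
Proof.
move=> mB Bab a0 Bw; have d1 := dom_window mB Bab a0 Bw.
have BAw : P B (A w) = A w by rewrite -(A_pvm hH hA hP) // Bw.
have d2 := dom_window mB Bab a0 BAw.
have /andP[l1 u1] := rA_bnd hH hP mB Bab Bw d1.
have /andP[l2 u2] := rA_bnd hH hP mB Bab BAw d2.
have w0' := nm_ge0 w; have a0' := nm_ge0 (A w).
have [w00|wn] := eqVneq (nm w) 0.
  by rewrite (nm_eq0 w00) (A0 hA) nm0 !mulr0 lexx.
have wp : 0 < nm w by rewrite lt_def wn.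
have cs : rip (A w) w <= nm (A w) * nm w.
  exact: le_trans (ler_norm _) (rip_cs hH _ _).
have low : a * nm w <= nm (A w).
  by rewrite -(ler_pM2r wp) -mulrA -expr2; exact: le_trans l1 cs.
rewrite low /=.
have [A00|An] := eqVneq (nm (A w)) 0.
  by exfalso; have := mulr_gt0 a0 wp; rewrite ltNge -A00 low.
have Ap : 0 < nm (A w) by rewrite lt_def An.
have ab : a <= b.
  by rewrite -(ler_pM2r (mulr_gt0 wp wp)) -expr2; exact: le_trans l1 u1.
(* Cauchy-Schwarz for the form of A, at w and A w *)
have psd : nm (A w) ^+ 2 ^+ 2 <= rip (A w) w * rip (A (A w)) (A w).
  apply: disc_le => t.
  have := rA_ge0 hA0 (domD hA d1 (domZ hA t%:C d2)).
  rewrite (AD hA) //; last exact: domZ hA _ _ _.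
  rewrite (AZ hA) // ripDl !ripDr // !ripZl !ripZr // (rip_nm hH) (rAsym hA d2 d1).
  by rewrite (rip_nm hH) expr2; congr (_ <= _); ring.
have : nm (A w) ^+ 2 ^+ 2 <= (b * nm w ^+ 2) * (b * nm (A w) ^+ 2).
  apply: le_trans psd _; apply: ler_pM => //; exact: (rA_ge0 hA0).
move=> hh; have b0 : 0 <= b by apply: le_trans ab; exact: ltW.
suff : nm (A w) ^+ 2 <= (b * nm w) ^+ 2 by rewrite ler_sqr ?nnegrE ?mulr_ge0.
have A2 : 0 < nm (A w) ^+ 2 by rewrite exprn_gt0.
rewrite -(ler_pM2r A2) -expr2; apply: le_trans hh _.
by rewrite le_eqVlt; apply/orP; left; apply/eqP; ring.
Qed.

(** With v in a window the solution stays in it, and there the form of A lies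
    between the multiples a and b of the squared norm; apply this to w and to A w. *)
Lemma solves_bnd x B v (a b : R) : x != 0 -> measurable B ->
  B `<=` `[a, b]%classic -> 0 < a -> P B v = v ->
  exists w, [/\ solves A x v w,
   (a / pi) * rip v w <= rip (Q x v) v <= (b / pi) * rip v w,
    P B w = w &
    rip v w = nm (A w) ^+ 2 + x ^+ 2 * nm w ^+ 2].
Proof.
move=> x0 mB Bab a0 Bv.
have [w0 /(solves_pvm mB)] := solves_ex hH hA v x0.
rewrite Bv; set w := P B w0 => h.
have Bw : P B w = w by rewrite pvm_idem.
have [d1 d2 e] := h.
have BAw : P B (A w) = A w by rewrite -(A_pvm hH hA hP) // Bw.
have /andP[l1 u1] := rA_bnd hH hP mB Bab Bw d1.
have /andP[l2 u2] := rA_bnd hH hP mB Bab BAw d2.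
have en := solves_energy hH hA h.
have x2 := sqr_ge0 x; have pi0 := pi_gt0 R.
exists w; split => //.
have pm k t : k / pi * t = pi^-1 * (k * t) :> R by rewrite mulrAC mulrC.
rewrite (rQE hH hA x0 h) en !pm !ler_pM2l ?invr_gt0 // !mulrDr.
by apply/andP; split; apply: lerD => //; rewrite mulrCA ler_wpM2l.
Qed.

Lemma rQ_upper x B v (a b : R) : x != 0 -> measurable B ->
  B `<=` `[a, b]%classic -> 0 < a -> P B v = v ->
  rip (Q x v) v <= (b / pi) * (a ^+ 2 + x ^+ 2)^-1 * nm v ^+ 2.
Proof.
move=> x0 mB Bab a0 Bv.
have [w [h /andP[_ u] Bw en]] := solves_bnd x0 mB Bab a0 Bv.
have /andP[l3 u3] := nmA_bnd mB Bab a0 Bw.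
have [->|vn] := eqVneq v 0.
  by rewrite (Q0 hH hA) // rip0l nm0 expr0n mulr0.
have vp : 0 < nm v by rewrite lt_def nm_ge0 andbT; apply: contraNneq vn => /nm_eq0 ->.
have b0 : 0 <= b.
  have [w0|wn] := eqVneq (nm w) 0.
    move: h; rewrite (nm_eq0 w0) => -[_ _].
    by rewrite (A0 hA) (A0 hA) scaler0 addr0 => v0; rewrite v0 eqxx in vn.
  have wp : 0 < nm w by rewrite lt_def wn nm_ge0.
  have : 0 <= b * nm w by apply: le_trans u3; exact: nm_ge0.
  by rewrite pmulr_lge0.
have q : 0 < a ^+ 2 + x ^+ 2 by rewrite ltr_pwDl ?exprn_gt0 ?sqr_ge0.
apply: le_trans u _; rewrite -[leRHS]mulrA ler_wpM2l ?divr_ge0 ?pi_ge0 //.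
have low : (a ^+ 2 + x ^+ 2) * nm w ^+ 2 <= rip v w.
  rewrite en mulrDl lerD2r -exprMn ler_sqr ?nnegrE ?nm_ge0 //.
  by rewrite mulr_ge0 ?nm_ge0 // ltW.
have cs : rip v w <= nm v * nm w.
  exact: le_trans (ler_norm _) (rip_cs hH _ _).
have w0 := nm_ge0 w.
rewrite -(ler_pM2l q) mulrA divff ?gt_eqF // mul1r.
apply: (@le_trans _ _ ((a ^+ 2 + x ^+ 2) * (nm v * nm w))).
  by rewrite ler_pM2l.
have : (a ^+ 2 + x ^+ 2) * nm w <= nm v.
  have [->|wn] := eqVneq (nm w) 0; first by rewrite mulr0 ltW.
  have wp : 0 < nm w by rewrite lt_def wn.
  by rewrite -(ler_pM2r wp) -mulrA -expr2; exact: le_trans cs.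
by move=> hh; rewrite mulrCA expr2 ler_pM2l.
Qed.

Lemma rQ_lower x B v (a b : R) : x != 0 -> measurable B ->
  B `<=` `[a, b]%classic -> 0 < a -> P B v = v ->
  (a / pi) * ((a ^+ 2 + x ^+ 2) / (b ^+ 2 + x ^+ 2) ^+ 2) * nm v ^+ 2 <=
  rip (Q x v) v.
Proof.
move=> x0 mB Bab a0 Bv; have [->|vn] := eqVneq v 0.
  by rewrite (Q0 hH hA) // rip0l nm0 expr0n mulr0.
have [w [h /andP[l _] Bw en]] := solves_bnd x0 mB Bab a0 Bv.
have /andP[l3 u3] := nmA_bnd mB Bab a0 Bw.
apply: le_trans l; rewrite -[leLHS]mulrA ler_wpM2l ?divr_ge0 ?pi_ge0 ?(ltW a0) //.
have x2 := x2_gt0 x0.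
have q : 0 < b ^+ 2 + x ^+ 2 by rewrite ltr_wpDl ?sqr_ge0.
have low : (a ^+ 2 + x ^+ 2) * nm w ^+ 2 <= rip v w.
  rewrite en mulrDl lerD2r -exprMn ler_sqr ?nnegrE ?nm_ge0 //.
  by rewrite mulr_ge0 ?nm_ge0 // ltW.
apply: (le_trans _ low); rewrite -mulrA ler_wpM2l ?addr_ge0 ?sqr_ge0 //.
rewrite mulrC ler_pdivrMr ?exprn_gt0 // mulrC -exprMn.
rewrite ler_sqr ?nnegrE ?nm_ge0 ?mulr_ge0 ?nm_ge0 ?(ltW q) //.
have [d1 d2 e] := h.
have BAw : P B (A w) = A w by rewrite -(A_pvm hH hA hP) // Bw.
have /andP[l4 u4] := nmA_bnd mB Bab a0 BAw.
have b0 : 0 <= b.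
  have [w0|wn] := eqVneq (nm w) 0.
    move: h; rewrite (nm_eq0 w0) => -[_ _].
    by rewrite (A0 hA) (A0 hA) scaler0 addr0 => v0; rewrite v0 eqxx in vn.
  have wp : 0 < nm w by rewrite lt_def wn nm_ge0.
  have : 0 <= b * nm w by apply: le_trans u3; exact: nm_ge0.
  by rewrite pmulr_lge0.
have b2 : nm (A (A w)) <= b ^+ 2 * nm w.
  by apply: le_trans u4 _; rewrite expr2 -mulrA ler_wpM2l.
rewrite -e; apply: le_trans (nmD _ _) _; rewrite mulrDl nmZ cmR.
by rewrite ger0_norm ?sqr_ge0 // lerD2r.
Qed.

Definition wt (x : R) : R := (1 + x ^+ 2)^-1.

Lemma wt_gt0 x : 0 < wt x.
Proof. by rewrite invr_gt0 ltr_pwDl ?sqr_ge0. Qed.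

(** By rQ_upper and rQ_lower, Q x lies between two rational functions of x,
    each comparable with (1 + x^2)^-1. *)
Lemma rQ_wt (a b : R) : 0 < a -> a < b -> exists c C : R, [/\ 0 < c, 0 < C &
  forall x v, x != 0 -> P `[a, b]%classic v = v ->
  c * wt x * nm v ^+ 2 <= rip (Q x v) v <= C * wt x * nm v ^+ 2].
Proof.
move=> a0 ab; pose m : R := Num.min (a ^+ 2) 1; pose M : R := Num.max (b ^+ 2) 1.
have m0 : 0 < m by rewrite lt_min exprn_gt0 //=.
have M0 : 0 < M by rewrite lt_max ltr01 orbT.
have b0 : 0 < b by exact: lt_trans ab.
have p0 := pi_gt0 R.
have mab : measurable `[a, b]%classic by exact: measurable_itv.
exists (a / pi * (m / M ^+ 2)), (b / pi * m^-1).
split => [||x v x0 Pv]; rewrite ?mulr_gt0 ?invr_gt0 ?exprn_gt0 //.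
have n0 := sqr_ge0 (nm v); have x2 := sqr_ge0 x.
have y0 : 0 < 1 + x ^+ 2 by rewrite ltr_pwDl ?sqr_ge0.
have l1 : m * (1 + x ^+ 2) <= a ^+ 2 + x ^+ 2.
  rewrite mulrDr mulr1; apply: lerD; first by rewrite ge_min lexx.
  by rewrite ler_piMl // ge_min lexx orbT.
have l2 : b ^+ 2 + x ^+ 2 <= M * (1 + x ^+ 2).
  rewrite mulrDr mulr1; apply: lerD; first by rewrite le_max lexx.
  by rewrite ler_peMl // le_max lexx orbT.
have q1 : 0 < a ^+ 2 + x ^+ 2 by apply: lt_le_trans l1; rewrite mulr_gt0.
have q2 : 0 < b ^+ 2 + x ^+ 2 by rewrite ltr_pwDl ?exprn_gt0.
apply/andP; split.
  apply: le_trans (rQ_lower x0 mab (@subset_refl _ _) a0 Pv).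
  rewrite ler_wpM2r // -[leLHS]mulrA ler_wpM2l ?divr_ge0 ?(ltW a0) ?(ltW p0) //.
  have -> : m / M ^+ 2 * wt x = m * (1 + x ^+ 2) / (M * (1 + x ^+ 2)) ^+ 2.
    by rewrite /wt; field; rewrite !gt_eqF.
  apply: ler_pM => //; first by rewrite mulr_ge0 ?ltW.
    by rewrite invr_ge0 sqr_ge0.
  rewrite lef_pV2 ?posrE ?exprn_gt0 ?mulr_gt0 //.
  by rewrite ler_sqr ?nnegrE ?mulr_ge0 // ltW.
apply: le_trans (rQ_upper x0 mab (@subset_refl _ _) a0 Pv) _.
rewrite ler_wpM2r // -[leRHS]mulrA ler_wpM2l ?divr_ge0 ?(ltW b0) ?(ltW p0) //.
by rewrite /wt -invfM lef_pV2 ?posrE // mulr_gt0.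
Qed.

Lemma rQ_ge0T x v : 0 <= rip (Q x v) v.
Proof.
have [->|x0] := eqVneq x 0; last exact: (rQ_ge0 hH hA hA0).
rewrite /Qop; case: xgetP => [u _ [w [d1 d2 <- ->]]|_]; last by rewrite rip0l.
rewrite expr0n scale0r addr0 ripZl mulr_ge0 ?invr_ge0 ?pi_ge0 //.
by rewrite -(rAsym hA d2 d2) (rA_ge0 hA0).
Qed.

Lemma mQ v : measurable_fun setT (fun x => (rip (Q x v) v)%:E).
Proof. by apply/measurable_EFinP; exact: measurable_Q. Qed.

(** Q 0 need not be the operator 1 / (pi A), so that pointwise information is
    available only away from 0, a null set. *)
Lemma ge0_le_integral0 (f g : R -> \bar R) : 
  measurable_fun setT f -> measurable_fun setT g ->
  (forall x, 0 <= f x)%E -> (forall x, 0 <= g x)%E ->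
  (forall x : R, x != 0%R -> f x <= g x)%E -> (\int[mu]_x f x <= \int[mu]_x g x)%E.
Proof.
move=> mf mg f0 g0 fg; apply: ae_ge0_le_integral => //.
exists [set 0]; split => //; first exact: lebesgue_measure_set1.
move=> x /= /not_implyP[_ h]; apply/eqP; rewrite -[_ == _]negbK; apply/negP => x0.
by apply: h; exact: fg.
Qed.

Lemma fatou_le0 (f_ : nat -> R -> \bar R) (f : R -> \bar R) (K : \bar R) :
  (forall n, measurable_fun setT (f_ n)) -> measurable_fun setT f ->
  (forall n x, 0 <= f_ n x)%E -> (forall x, 0 <= f x)%E ->
  (forall x : R, x != 0%R -> f_ n x @[n --> \oo] --> f x) ->
  (forall n, \int[mu]_x f_ n x <= K)%E -> (\int[mu]_x f x <= K)%E.
Proof.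
move=> mf_ mf f_0 f0 ff fK.
pose D := [set: R] `\` [set 0].
have m0 : measurable [set 0 : R] by exact: measurable_set1.
have mD : measurable D by exact: measurableD.
rewrite (@ge0_negligible_integral _ _ _ mu setT [set 0]) //; last exact: lebesgue_measure_set1.
have -> : (\int[mu]_(x in [set: R] `\` [set 0%R]) f x =
    \int[mu]_(x in D) limn_einf (f_ ^~ x))%E.
  apply: eq_integral => x; rewrite inE => -[_ /= x0].
  by have [->] := cvg_limn_einf_sup (ff x (introN eqP x0)).
have mf_D n : measurable_fun D (f_ n) by exact: measurable_funTS.
have hf := @fatou _ _ _ mu D mD f_ mf_D (fun n x _ => f_0 n x).
apply: (le_trans hf).
rewrite limn_einf_lim; apply: lime_le; first exact: is_cvg_einfs.
near=> n; apply: (@le_trans _ _ (\int[mu]_(x in D) f_ n x)%E).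
  by apply: ereal_inf_lbound; exists n => //=.
apply: (le_trans _ (fK n)); by apply: ge0_subset_integral => //; exact: mf_.
Unshelve. all: by end_near. Qed.

Definition Qint v := (\int[mu]_x (rip (Q x v) v)%:E)%E.

(** When b <= 2 a the upper bound (b / pi) / (a^2 + x^2) integrates to
    b / a <= 2. *)
Lemma Qint_dyadic v (a b : R) : 0 < a -> a <= b -> b <= 2 * a ->
  (Qint (P `]a, b]%classic v) <= (2 * (nm (P `]a, b]%classic v) ^+ 2))%:E)%E.
Proof.
move=> a0 ab ba; set u := P _ v.
have mB : measurable `]a, b]%classic by exact: measurable_itv.
have p0 := pi_gt0 R; have b0 : 0 < b by exact: lt_le_trans ab.
have c0 : 0 <= b / pi * nm u ^+ 2 by rewrite mulr_ge0 ?sqr_ge0 ?divr_ge0 ?ltW.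
have q x : 0 < a ^+ 2 + x ^+ 2 by rewrite ltr_pwDl ?exprn_gt0 ?sqr_ge0.
have mc : measurable_fun setT (fun x : R => (a ^+ 2 + x ^+ 2)^-1%:E).
  apply/measurable_EFinP; apply: continuous_measurable_fun => x.
  apply: cvgV; first by rewrite gt_eqF.
  by apply: cvgD; [exact: cvg_cst | exact: exprn_continuous].
apply: (@le_trans _ _ (\int[mu]_x ((b / pi * nm u ^+ 2)%:E * (a ^+ 2 + x ^+ 2)^-1%:E))%E).
  apply: ge0_le_integral0.
  - exact: mQ.
  - by apply: emeasurable_funM.
  - by move=> x; rewrite lee_fin rQ_ge0T.
  - by move=> x; rewrite -EFinM lee_fin mulr_ge0 // invr_ge0 ltW.
  - move=> x x0; rewrite -EFinM lee_fin.
    have sB : `]a, b]%classic `<=` `[a, b]%classic.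
      by move=> y /=; rewrite !in_itv /= => /andP[/ltW -> ->].
    have := rQ_upper x0 mB sB a0 (pvm_idem P v mB); rewrite -/u.
    by rewrite mulrAC.
rewrite ge0_integralZl_EFin //; last first.
  by move=> x _; rewrite lee_fin invr_ge0 ltW.
rewrite int_cauchy // -EFinM lee_fin.
have -> : b / pi * nm u ^+ 2 * (pi / a) = (b / a) * nm u ^+ 2.
  by move: p0 a0; clear; move: (@pi R) => p p0 a0; field; rewrite !gt_eqF.
by rewrite ler_wpM2r ?sqr_ge0 // ler_pdivrMr.
Qed.

Lemma Qint_add v B : measurable B ->
  Qint v = (Qint (P B v) + Qint (v - P B v)%R)%E.
Proof.
move=> mB; rewrite /Qint -ge0_integralD //; last 4 first.
- by move=> x _; rewrite lee_fin rQ_ge0T.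
- exact: mQ.
- by move=> x _; rewrite lee_fin rQ_ge0T.
- exact: mQ.
have ms : measurable_fun setT (fun x => ((rip (Q x (P B v)) (P B v))%:E +
    (rip (Q x (v - P B v)%R) (v - P B v)%R)%:E)%E).
  by apply: emeasurable_funD; exact: mQ.
apply/eqP; rewrite eq_le; apply/andP; split; apply: ge0_le_integral0 => //;
  try exact: mQ; try (by move=> x; rewrite ?adde_ge0 ?lee_fin ?rQ_ge0T);
  by move=> x x0; rewrite -EFinD lee_fin (rQ_split v x0 mB).
Qed.

(** Windows that double at each end, so that they split into dyadic pieces. *)
Definition Jpow (n : nat) : set R := `]2 ^- n, 2 ^+ n]%classic.

(** Q x commutes with the spectral projections, so that the bounds on
    disjoint dyadic windows add up without changing the constant 2. *)
Lemma Qint_pow v n :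
  (Qint (P (Jpow n) v) <= (2 * nm (P (Jpow n) v) ^+ 2)%:E)%E.
Proof.
rewrite /Jpow.
have glue (a b c : R) : a <= b -> b <= c ->
   (Qint (P `]a, b]%classic v) <= (2 * nm (P `]a, b]%classic v) ^+ 2)%:E)%E ->
   (Qint (P `]b, c]%classic v) <= (2 * nm (P `]b, c]%classic v) ^+ 2)%:E)%E ->
   (Qint (P `]a, c]%classic v) <= (2 * nm (P `]a, c]%classic v) ^+ 2)%:E)%E.
  move=> ab bc h1 h2.
  have m1 : measurable `]a, b]%classic by exact: measurable_itv.
  have m2 : measurable `]b, c]%classic by exact: measurable_itv.
  have m3 : measurable `]a, c]%classic by exact: measurable_itv.
  have e1 : P `]a, b]%classic (P `]a, c]%classic v) = P `]a, b]%classic v.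
    rewrite pvmI // setIidl // => x /=; rewrite !in_itv /= => /andP[-> xb] /=.
    exact: le_trans bc.
  have e2 : P `]a, c]%classic v - P `]a, b]%classic (P `]a, c]%classic v) =
     P `]b, c]%classic v.
    rewrite -pvm_setC // pvmI //; last exact: measurableC.
    congr (P _ v); apply/seteqP; split => x /=; rewrite !in_itv /=.
      by move=> [/negP h /andP[ax xc]]; rewrite xc andbT ltNge; apply: contraPN h => xb; rewrite ax xb.
    move=> /andP[bx ->]; rewrite (le_lt_trans ab bx); split => //; apply/negP.
    by rewrite leNgt bx.
  rewrite (Qint_add _ m1) e2 (pvm_pyth hH P (P `]a, c]%classic v) m1) e2 e1 mulrDr EFinD.
  exact: leeD.
have dy (a b : R) : 0 < a -> a <= b -> b <= 2 * a ->
   (Qint (P `]a, b]%classic v) <= (2 * nm (P `]a, b]%classic v) ^+ 2)%:E)%E.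
  exact: Qint_dyadic.
elim: n => [|n IH].
  by apply: dy; rewrite expr0 ?invr1 //; lra.
have t0 : 0 < (2 : R) ^+ n by rewrite exprn_gt0.
have t1 : 1 <= (2 : R) ^+ n by rewrite exprn_ege1 //; lra.
have i1 : (2 : R) ^- n <= 1 by rewrite invf_le1.
have i0 : 0 < (2 : R) ^- n by rewrite invr_gt0.
have s : (2 : R) ^- n.+1 = 2^-1 * 2 ^- n by rewrite exprS invfM.
apply: (glue _ (2 ^- n) _); first by rewrite s; lra.
- by rewrite exprS; lra.
- by apply: dy; rewrite s; lra.
apply: (glue _ (2 ^+ n) _) => //; [lra|rewrite exprS; lra|].
by apply: dy; rewrite ?exprS; lra.
Qed.

Lemma Qint_ge0 v : (0 <= Qint v)%E.
Proof. by apply: integral_ge0 => x _; rewrite lee_fin rQ_ge0T. Qed.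

(** The bound of Qint_pow is uniform in the window; Fatou's lemma removes it. *)
Lemma Qint_le v : (Qint v <= (2 * nm v ^+ 2)%:E)%E.
Proof.
pose u n := P (Iab n) v.
have mI n : measurable (Iab n : set R) by exact: measurable_itv.
have b n : (Qint (u n) <= (2 * nm v ^+ 2)%:E)%E.
  have mJ : measurable (Jpow n.+2) by exact: measurable_itv.
  have -> : u n = P (Iab n) (P (Jpow n.+2) v).
    rewrite pvmI // setIidl // => x; rewrite /Iab /Jpow /= !in_itv /= => /andP[h1 h2].
    have le2 : n.+2%:R <= (2 : R) ^+ n.+2.
      by rewrite -natrX ler_nat ltnW // ltn_expl.
    rewrite (le_trans h2 le2) andbT; apply: lt_le_trans h1.
    rewrite ltf_pV2 ?posrE ?exprn_gt0 //; apply: lt_le_trans le2.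
    by rewrite ltr_nat.
  apply: (@le_trans _ _ (Qint (P (Jpow n.+2) v))).
    by rewrite [leRHS](Qint_add _ (mI n)) leeDl // Qint_ge0.
  apply: le_trans (Qint_pow _ _) _; rewrite lee_fin ler_pM2l //.
  by rewrite ler_sqr ?nnegrE ?nm_ge0 // (pvm_le hH).
apply: (@fatou_le0 (fun n x => (rip (Q x (u n)) (u n))%:E)) => //.
- by move=> n; exact: mQ.
- exact: mQ.
- by move=> n x; rewrite lee_fin rQ_ge0T.
- by move=> x; rewrite lee_fin rQ_ge0T.
move=> x x0; apply: cvg_EFin; first by near=> n.
under eq_fun => n do rewrite /= /u (Q_pvm _ x0 (mI n)) rpvm_sym // pvm_idem //
   -rpvm_sym //.
by apply: (cvg_ip hH); exact: (pvm_approx hH hA hA0 hP hker).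
Unshelve. all: by end_near. Qed.

Lemma Qint_fin v : (Qint v < +oo)%E.
Proof. by apply: le_lt_trans (Qint_le v) _; exact: ltry. Qed.

End Qspec.

(** * Strongly measurable functions *)

Import HBSimple.

Section simple.
Context {R : realType}.

(** Simple functions with values in any type, so that one combination lemma
    covers scalars, vectors, booleans and pairs of them. *)
Definition tsimple (T : Type) (s : R -> T) : Prop :=
  finite_set (range s) /\ forall v, measurable (s @^-1` [set v]).

Lemma tsimple_pre T (s : R -> T) (S : T -> set R) : tsimple s ->
  (forall v, measurable (S v)) -> measurable [set x | S (s x) x].
Proof.
move=> [fs ms] mS.
have -> : [set x | S (s x) x] = \bigcup_(v in range s) ((s @^-1` [set v]) `&` S v).
  apply/seteqP; split => x /=; first by move=> h; exists (s x) => //; exists x.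
  by move=> [v _ /= [<- ]].
by apply: fin_bigcup_measurable => // v _; apply: measurableI.
Qed.

Lemma tsimple_comp2 T1 T2 T3 (F : T1 -> T2 -> T3) (s1 : R -> T1) (s2 : R -> T2) :
  tsimple s1 -> tsimple s2 -> tsimple (fun x => F (s1 x) (s2 x)).
Proof.
move=> h1 h2; split.
  apply: (@sub_finite_set _ _ ((fun p => F p.1 p.2) @` (range s1 `*` range s2))).
    by move=> _ [x _ <-]; exists (s1 x, s2 x) => //=; split; exists x.
  apply: finite_image; apply: finite_setX; [exact: h1.1 | exact: h2.1].
move=> v; apply: (tsimple_pre (S := fun a => [set x | F a (s2 x) = v]) h1) => a.
apply: (tsimple_pre (S := fun b => [set x | F a b = v]) h2) => b.
have [e|e] := pselect (F a b = v).
  by rewrite (_ : [set _ | _] = setT) //; apply/seteqP; split.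
by rewrite (_ : [set _ | _] = set0) //; apply/seteqP; split.
Qed.

Lemma tsimple_cst T (c : T) : tsimple (fun _ : R => c).
Proof.
split.
  by apply: (@sub_finite_set _ _ [set c]) => // _ [x _ <-].
move=> v; have [e|e] := pselect (c = v).
  by rewrite (_ : _ @^-1` _ = setT) //; apply/seteqP; split.
by rewrite (_ : _ @^-1` _ = set0) //; apply/seteqP; split.
Qed.

Lemma tsimple_comp T1 T2 (F : T1 -> T2) (s1 : R -> T1) :
  tsimple s1 -> tsimple (fun x => F (s1 x)).
Proof. by move=> h; exact: (tsimple_comp2 (fun a _ => F a) h h). Qed.

Lemma tsimple_bool (p : R -> bool) : measurable [set x | p x] -> tsimple p.
Proof.
move=> mp; split; first exact: (sub_finite_set (@subsetT _ _)).
have e b : p @^-1` [set b] = if b then [set x | p x] else ~` [set x | p x].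
  by case: b; apply/seteqP; split => x /=; case: (p x).
by move=> b; rewrite e; case: b => //; exact: measurableC.
Qed.

Lemma tsimple_if T (p : R -> bool) (s1 s2 : R -> T) :
  measurable [set x | p x] -> tsimple s1 -> tsimple s2 ->
  tsimple (fun x => if p x then s1 x else s2 x).
Proof.
move=> /tsimple_bool hp h1 h2.
have h := tsimple_comp2 (fun a b => (a, b)) h1 h2.
exact: (tsimple_comp2 (fun b (q : T * T) => if b then q.1 else q.2) hp h).
Qed.

Lemma tsimple_fun T (s : R -> T) (Phi : R -> T -> R) : tsimple s ->
  (forall v, measurable_fun setT (Phi ^~ v)) ->
  measurable_fun setT (fun x => Phi x (s x)).
Proof.
move=> hs mPhi _ Y mY; rewrite setTI.
apply: (tsimple_pre (S := fun v => [set x | Y (Phi x v)]) hs) => v.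
by have := mPhi v measurableT Y mY; rewrite setTI.
Qed.

Definition cmeas (g : R -> R[i]) :=
  measurable_fun setT (fun x => complex.Re (g x)) /\
  measurable_fun setT (fun x => complex.Im (g x)).

Lemma cvg_dist0 (u : nat -> R) (l : R) : u n @[n --> \oo] --> l ->
  `|u n - l| @[n --> \oo] --> 0.
Proof.
move=> h; rewrite [X in _ --> X](_ : _ = `|l - l|); last by rewrite subrr normr0.
by apply: cvg_norm; apply: cvgB => //; exact: cvg_cst.
Qed.

Lemma rmeas_approx (g : R -> R) : measurable_fun setT g ->
  exists s : nat -> R -> R, (forall n, tsimple (s n)) /\
    forall x, s n x @[n --> \oo] --> g x.
Proof.
move=> /measurable_EFinP mg; have [s hs] := approximation_sfun measurableT mg.
exists (fun n (x : R) => s n x); split => [n|x].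
  split; first exact: fimfunP.
  by move=> v; have := @measurable_funPTI _ _ _ _ (s n) [set v] (measurable_set1 v).
have := hs x I; exact: fine_cvg.
Qed.

Lemma cmeas_approx (g : R -> R[i]) : cmeas g ->
  exists s : nat -> R -> R[i], (forall n, tsimple (s n)) /\
    forall x, cm (s n x - g x) @[n --> \oo] --> 0.
Proof.
move=> [/rmeas_approx[s1 [h1 c1]] /rmeas_approx[s2 [h2 c2]]].
exists (fun n x => s1 n x +i* s2 n x); split => [n|x].
  exact: tsimple_comp2.
apply: (@squeeze_cvgr _ _ _ _ (fun=> 0) (fun n => `|s1 n x - complex.Re (g x)| +
   `|s2 n x - complex.Im (g x)|)).
- near=> n; rewrite cm_ge0 /=; apply: le_trans (cm_le _) _.
  by rewrite cReD cReN cImD cImN.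
- exact: cvg_cst.
- by rewrite -[0]addr0; apply: cvgD; exact: cvg_dist0.
Unshelve. all: by end_near. Qed.

End simple.

Section dct.
Context {R : realType}.
Local Notation mu := (@lebesgue_measure R).

(** The hypothesis skips the point 0, where Q x carries no information. *)
Lemma dct0 (u : nat -> R -> R) (G : R -> R) :
  (forall n, measurable_fun setT (u n)) -> measurable_fun setT G ->
  (forall n x, 0 <= u n x <= G x) -> (\int[mu]_x (G x)%:E < +oo)%E ->
  (forall x : R, x != 0 -> u n x @[n --> \oo] --> 0) ->
  (\int[mu]_x (u n x)%:E)%E @[n --> \oo] --> 0%E.
Proof.
move=> mun mG uG iG u0.
have G0 x : 0 <= G x by have /andP[h1 h2] := uG 0%N x; exact: le_trans h2.
have iG' : mu.-integrable setT (EFin \o G).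
  apply/integrableP; split; first exact/measurable_EFinP.
  by under eq_integral => x _ do rewrite /= ger0_norm //.
have [||_ _] := @dominated_convergence _ _ _ mu setT measurableT
  (fun n x => (u n x)%:E) (cst 0%E) (EFin \o G) 
  (fun n => (measurable_EFinP _ _).2 (mun n)) (measurable_cst _) _ iG' _.
- exists [set 0]; split => //; first exact: lebesgue_measure_set1.
  move=> x /= /not_implyP[_ h]; apply/eqP; rewrite -[_ == _]negbK.
  by apply/negP => x0; apply: h; apply: cvg_EFin; [near=> n | exact: u0].
- apply: aeW => x n _ /=; have /andP[h1 h2] := uG n x.
  by rewrite lee_fin ger0_norm.
by rewrite integral0.
Unshelve. all: by end_near. Qed.

End dct.

Section strong.
Context {R : realType} {H : completeNormedModType R[i]}.
Variable ip : {dot H for Num.conj}.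
Hypothesis hH : hilbert_norm ip.
Implicit Types f g : R -> H.
Local Notation sm := (@strongly_measurable R H).
Local Notation mu := (@lebesgue_measure R).

(** For simple f the function is measurable piece by piece; continuity in the
    second variable passes this to the limit.  The exception at x = 0 is there for
    the junk value of Q 0. *)
Lemma caratheodory f (Phi : R -> H -> R) : sm f ->
  (forall v, measurable_fun setT (Phi ^~ v)) ->
  (forall (x : R) (u : nat -> H) v, x != 0 -> u n @[n --> \oo] --> v ->
     Phi x (u n) @[n --> \oo] --> Phi x v) ->
  measurable_fun setT (fun x => Phi x (f x)).
Proof.
move=> [s [hs sf]] mPhi cPhi.
have m0 : measurable [set 0 : R] by exact: measurable_set1.
have mD : measurable (~` [set 0 : R]) by exact: measurableC.
rewrite -(setUv [set (0 : R)]); apply/measurable_funU => //.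
split; first exact: measurable_fun_set1.
apply: (@measurable_fun_cvg _ _ _ _ (fun n x => Phi x (s n x))).
  by move=> n; apply: measurable_funTS; exact: (tsimple_fun (hs n)).
by move=> x /eqP x0; exact: cPhi.
Qed.

Lemma sm_nm f : sm f -> measurable_fun setT (fun x => nm (f x)).
Proof.
move=> sf; apply: (caratheodory (Phi := fun _ v => nm v)) => // x u v _.
exact: nm_cvg.
Qed.

Lemma sm_rip f w : sm f -> measurable_fun setT (fun x => rip ip (f x) w).
Proof.
move=> sf; apply: (caratheodory (Phi := fun _ v => rip ip v w)) => // x u v _ uv.
exact: cvg_ip.
Qed.

Lemma sm_cip f w : sm f -> cmeas (fun x => cip ip (f x) w).
Proof.
move=> sf; split; first exact: sm_rip.
under eq_fun do rewrite Im_rip; exact: sm_rip.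
Qed.

Lemma sm_lim (s : nat -> R -> H) f : (forall n, tsimple (s n)) ->
  (forall x, s n x @[n --> \oo] --> f x) -> sm f.
Proof. by move=> h1 h2; exists s. Qed.

Lemma sm_simple (s : R -> H) : tsimple s -> sm s.
Proof. by move=> h; exists (fun=> s); split=> // x; exact: cvg_cst. Qed.

Lemma sm_cst (v : H) : sm (fun=> v).
Proof. by apply: sm_simple; exact: tsimple_cst. Qed.

Lemma sm_lc (a : R[i]) f g : sm f -> sm g -> sm (fun x => a *: f x + g x).
Proof.
move=> [s [hs sf]] [t [ht tg]]; exists (fun n x => a *: s n x + t n x).
split => [n|x]; first exact: (tsimple_comp2 (fun u v => a *: u + v) (hs n) (ht n)).
by apply: cvgD => //; exact: cvgZl_tmp.
Qed.

Lemma sm_comp (T : H -> H) f : (forall (u : nat -> H) v,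
  u n @[n --> \oo] --> v -> T (u n) @[n --> \oo] --> T v) -> sm f ->
  sm (fun x => T (f x)).
Proof.
move=> cT [s [hs sf]]; exists (fun n x => T (s n x)); split => [n|x].
  exact: (tsimple_comp T (hs n)).
exact: cT.
Qed.

Lemma sm_scale (g : R -> R[i]) f : cmeas g -> sm f -> sm (fun x => g x *: f x).
Proof.
move=> /cmeas_approx[t [ht tg]] [s [hs sf]].
exists (fun n x => t n x *: s n x); split => [n|x].
  exact: (tsimple_comp2 (fun a v => a *: v) (ht n) (hs n)).
apply/cvg_nm.
have h1 := tg x; have h2 := (cvg_nm _ _).1 (sf x).
have h3 := nm_cvg (sf x).
apply: (@squeeze_cvgr _ _ _ _ (fun=> 0) (fun n => cm (t n x - g x) * nm (s n x) +
   cm (g x) * nm (s n x - f x))).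
- near=> n; rewrite nm_ge0 /= -!nmZ; apply: le_trans (nmD _ _).
  by rewrite scalerBl scalerBr addrA subrK.
- exact: cvg_cst.
- rewrite [X in _ --> X](_ : _ = 0 * nm (f x) + cm (g x) * 0); last by rewrite mul0r mulr0 addr0.
  by apply: cvgD; [apply: cvgM | apply: cvgMr].
Unshelve. all: by end_near. Qed.

Lemma sm_oppx f : sm f -> sm (fun x => f (- x)).
Proof.
move=> [s [hs sf]]; exists (fun n x => s n (- x)); split => [n|x]; last exact: sf.
have [fs ms] := hs n; split.
  by apply: sub_finite_set fs => _ [x _ <-]; exists (- x).
move=> v; have := @oppr_measurable R setT measurableT _ (ms v).
by rewrite setTI.
Qed.

(** Replacing s_n (x) by 0 where it exceeds twice the norm of f (x) does not change
    the limit and provides a dominating function. *)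
Lemma sm_trunc f : sm f -> exists s : nat -> R -> H,
  [/\ forall n, tsimple (s n), forall x, s n x @[n --> \oo] --> f x &
      forall n x, nm (s n x) <= 2 * nm (f x)].
Proof.
move=> sf; have [s [hs sfx]] := sf.
exists (fun n x => if nm (s n x) <= 2 * nm (f x) then s n x else 0).
split => [n|x|n x].
- apply: tsimple_if; [|exact: hs|exact: tsimple_cst].
  have mb : measurable_fun setT (fun x => nm (s n x) <= 2 * nm (f x)).
    apply: measurable_fun_ler; first exact: (sm_nm (sm_simple (hs n))).
    by apply: measurable_funM => //; exact: sm_nm.
  by have := mb measurableT [set true] I; rewrite setTI.
- have [f0|f0] := eqVneq (nm (f x)) 0.
    rewrite (nm_eq0 f0) (_ : (fun n => _) = (fun=> 0)); first exact: cvg_cst.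
    apply/funext => n; case: ifP => //; rewrite nm0 mulr0 => h.
    by apply: nm_eq0; apply/eqP; rewrite eq_le h nm_ge0.
  have fp : 0 < nm (f x) by rewrite lt_def f0 nm_ge0.
  apply: cvg_trans (sfx x); apply: near_eq_cvg.
  have /cvgrPdist_lt/(_ _ fp) h := (cvg_nm _ _).1 (sfx x).
  near=> n; have : `|0 - nm (s n x - f x)| < nm (f x) by near: n; exact: h.
  rewrite sub0r normrN ger0_norm ?nm_ge0 // => h1.
  have -> // : nm (s n x) <= 2 * nm (f x).
  have := nmD (s n x - f x) (f x); rewrite subrK; lra.
- by case: ifP => // _; rewrite nm0 mulr_ge0 ?nm_ge0.
Unshelve. all: by end_near. Qed.

(** Two applications of the same principle, one for each of the two slots; the
    symmetry of Q x moves it off the varying vector. *)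
Lemma sm_qform f g (Q : R -> H -> H) : sm f -> sm g ->
  (forall v w, measurable_fun setT (fun x => rip ip (Q x v) w)) ->
  (forall (x : R) u v, x != 0 -> rip ip (Q x u) v = rip ip u (Q x v)) ->
  measurable_fun setT (fun x => rip ip (Q x (f x)) (g x)).
Proof.
move=> sf sg mQ sQ.
apply: (caratheodory (Phi := fun x v => rip ip (Q x v) (g x))) => // [v|x u v x0 uv].
  apply: (caratheodory (Phi := fun x w => rip ip (Q x v) w)) => // x u w _ uw.
  under eq_fun do rewrite ripC; rewrite ripC; exact: cvg_ip.
under eq_fun do rewrite sQ //; rewrite sQ //; exact: cvg_ip.
Qed.

End strong.

(** * Integrals of complex functions *)

Section cint.
Context {R : realType}.
Local Notation mu := (@lebesgue_measure R).
Implicit Types F G : R -> R[i].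

Lemma cmeas_cst (a : R[i]) : cmeas (fun _ : R => a).
Proof. by split; exact: measurable_cst. Qed.

Lemma cmeasD F G : cmeas F -> cmeas G -> cmeas (fun x => F x + G x).
Proof.
move=> [f1 f2] [g1 g2]; split.
  by under eq_fun do rewrite cReD; exact: measurable_funD.
by under eq_fun do rewrite cImD; exact: measurable_funD.
Qed.

Lemma cmeasM F G : cmeas F -> cmeas G -> cmeas (fun x => F x * G x).
Proof.
move=> [f1 f2] [g1 g2]; split.
  by under eq_fun do rewrite cReM; apply: measurable_funB; exact: measurable_funM.
by under eq_fun do rewrite cImM; apply: measurable_funD; exact: measurable_funM.
Qed.

Lemma cmeasN F : cmeas F -> cmeas (fun x => - F x).
Proof.
move=> h; have := cmeasM (cmeas_cst (-1)) h.
by under eq_fun do rewrite mulN1r.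
Qed.

Lemma cmeasB F G : cmeas F -> cmeas G -> cmeas (fun x => F x - G x).
Proof. by move=> h1 h2; apply: cmeasD => //; exact: cmeasN. Qed.

Lemma cmeas_conj F : cmeas F -> cmeas (fun x => Num.conj (F x)).
Proof.
move=> [f1 f2]; split; first by under eq_fun do rewrite cReC.
by under eq_fun do rewrite cImC; exact: measurable_funN.
Qed.

Lemma cmeas_R (g : R -> R) : measurable_fun setT g -> cmeas (fun x => (g x)%:C).
Proof. by move=> h; split => //=; exact: measurable_cst. Qed.

Lemma cmeas_cm F : cmeas F -> measurable_fun setT (fun x => cm (F x)).
Proof.
move=> [f1 f2].
rewrite (_ : (fun x => _) = Num.sqrt \o
    (fun x => complex.Re (F x) ^+ 2 + complex.Im (F x) ^+ 2)).
  apply: measurableT_comp; first exact: (continuous_measurable_fun (@sqrt_continuous R)).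
  by apply: measurable_funD; exact: measurable_funX.
by apply/funext => x /=; rewrite -cm_sqr sqrtr_sqr ger0_norm // cm_ge0.
Qed.

Definition cint F := cmeas F /\ (\int[mu]_x (cm (F x))%:E < +oo)%E.

Lemma cint_Re F : cint F -> mu.-integrable setT (EFin \o (fun x => complex.Re (F x))).
Proof.
move=> [mF iF]; have mc := cmeas_cm mF; case: mF => m1 m2.
apply/integrableP; split; first exact/measurable_EFinP.
apply: le_lt_trans iF; apply: ge0_le_integral => //.
- by apply: measurableT_comp => //; exact/measurable_EFinP.
- exact/measurable_EFinP.
- by move=> x _; rewrite /= lee_fin cm_Re.
Qed.

Lemma cint_Im F : cint F -> mu.-integrable setT (EFin \o (fun x => complex.Im (F x))).
Proof.
move=> [mF iF]; have mc := cmeas_cm mF; case: mF => m1 m2.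
apply/integrableP; split; first exact/measurable_EFinP.
apply: le_lt_trans iF; apply: ge0_le_integral => //.
- by apply: measurableT_comp => //; exact/measurable_EFinP.
- exact/measurable_EFinP.
- by move=> x _; rewrite /= lee_fin cm_Im.
Qed.

Lemma cint_le F (g : R -> R) : cmeas F -> measurable_fun setT g ->
  (forall x, cm (F x) <= g x) -> (\int[mu]_x (g x)%:E < +oo)%E -> cint F.
Proof.
move=> mF mg Fg ig; split => //; apply: le_lt_trans ig.
apply: ge0_le_integral => //.
- by move=> x _; rewrite lee_fin cm_ge0.
- by apply/measurable_EFinP; exact: cmeas_cm.
- exact/measurable_EFinP.
- by move=> x _; rewrite lee_fin.
Qed.

Lemma cintZ (a : R[i]) F : cint F -> cint (fun x => a * F x).
Proof.
move=> [mF iF]; split; first exact: cmeasM (cmeas_cst a) mF.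
under eq_integral => x _ do rewrite cmM EFinM.
rewrite ge0_integralZl_EFin //.
- by rewrite lte_mul_pinfty // ?lee_fin ?cm_ge0.
- by move=> x _; rewrite lee_fin cm_ge0.
- by apply/measurable_EFinP; exact: cmeas_cm.
- exact: cm_ge0.
Qed.

Lemma cintD F G : cint F -> cint G -> cint (fun x => F x + G x).
Proof.
move=> [mF iF] [mG iG]; have m1 := cmeas_cm mF; have m2 := cmeas_cm mG.
apply: (@cint_le _ (fun x => cm (F x) + cm (G x))).
- exact: cmeasD.
- exact: measurable_funD.
- by move=> x; exact: cmD.
under eq_integral => x _ do rewrite EFinD.
rewrite ge0_integralD //.
- exact: lte_add_pinfty.
- by move=> x _; rewrite lee_fin cm_ge0.
- exact/measurable_EFinP.
- by move=> x _; rewrite lee_fin cm_ge0.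
- exact/measurable_EFinP.
Qed.

Lemma cintB F G : cint F -> cint G -> cint (fun x => F x - G x).
Proof.
move=> h1 h2; apply: cintD => //; have := cintZ (-1) h2.
by under eq_fun do rewrite mulN1r.
Qed.

Lemma cintegralD F G : cint F -> cint G ->
  cintegral (fun x => F x + G x) = cintegral F + cintegral G.
Proof.
move=> hF hG; apply: complexP; rewrite ?cReD ?cImD /=.
  under eq_Rintegral do rewrite cReD.
  by rewrite RintegralD //; exact: cint_Re.
under eq_Rintegral do rewrite cImD.
by rewrite RintegralD //; exact: cint_Im.
Qed.

Lemma cintegralZ (a : R[i]) F : cint F ->
  cintegral (fun x => a * F x) = a * cintegral F.
Proof.
move=> hF; have h1 := cint_Re hF; have h2 := cint_Im hF.
have i1 k : mu.-integrable setT (EFin \o (fun x => k * complex.Re (F x))).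
  by have := integrableZl (D := setT) measurableT k h1.
have i2 k : mu.-integrable setT (EFin \o (fun x => k * complex.Im (F x))).
  by have := integrableZl (D := setT) measurableT k h2.
apply: complexP; rewrite ?cReM ?cImM /=.
  under eq_Rintegral do rewrite cReM.
  by rewrite RintegralB // !RintegralZl.
under eq_Rintegral do rewrite cImM.
by rewrite RintegralD // !RintegralZl.
Qed.

Lemma cintegralB F G : cint F -> cint G ->
  cintegral (fun x => F x - G x) = cintegral F - cintegral G.
Proof.
move=> hF hG; rewrite -[in RHS]mulN1r -cintegralZ // -cintegralD //; last exact: cintZ.
by congr cintegral; apply/funext => x; rewrite mulN1r.
Qed.

Lemma cintegral_conj F : cint F ->
  cintegral (fun x => Num.conj (F x)) = Num.conj (cintegral F).
Proof.
move=> hF; apply: complexP; rewrite ?cReC ?cImC /=.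
  by under eq_Rintegral do rewrite cReC.
under eq_Rintegral do rewrite cImC -mulN1r.
by rewrite RintegralZl ?mulN1r //; exact: cint_Im.
Qed.

Lemma cintegral_bnd F : cint F ->
  ((cm (cintegral F))%:E <= 2%:E * \int[mu]_x (cm (F x))%:E)%E.
Proof.
move=> hF; have h1 := cint_Re hF; have h2 := cint_Im hF.
have [mF iF] := hF; have mc := cmeas_cm mF.
have f0 : (0 <= \int[mu]_x (cm (F x))%:E)%E.
  by apply: integral_ge0 => x _; rewrite lee_fin cm_ge0.
have ff : (\int[mu]_x (cm (F x))%:E)%E \is a fin_num by rewrite ge0_fin_numE.
have ic : mu.-integrable setT (EFin \o (fun x => cm (F x))).
  apply/integrableP; split; first exact/measurable_EFinP.
  by under eq_integral => x _ do rewrite /= ger0_norm ?cm_ge0 //.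
have b1 : `|\int[mu]_x complex.Re (F x)| <= fine (\int[mu]_x (cm (F x))%:E)%E.
  apply: le_trans (le_normr_Rintegral measurableT h1) _.
  apply: le_Rintegral => //; first exact: (integrable_norm h1).
  by move=> x _; exact: cm_Re.
have b2 : `|\int[mu]_x complex.Im (F x)| <= fine (\int[mu]_x (cm (F x))%:E)%E.
  apply: le_trans (le_normr_Rintegral measurableT h2) _.
  apply: le_Rintegral => //; first exact: (integrable_norm h2).
  by move=> x _; exact: cm_Im.
rewrite -(fineK ff) -EFinM lee_fin; apply: le_trans (cm_le _) _ => /=.
by rewrite mulr_natl mulr2n lerD.
Qed.

Lemma cintegral_cvg (F_ : nat -> R -> R[i]) F : (forall n, cint (F_ n)) ->
  cint F -> (\int[mu]_x (cm (F_ n x - F x))%:E)%E @[n --> \oo] --> 0%E ->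
  cm (cintegral (F_ n) - cintegral F) @[n --> \oo] --> 0.
Proof.
move=> iF_ iF h.
have h1 := fine_cvg h.
have h2 : 2 * fine (\int[mu]_x (cm (F_ n x - F x))%:E)%E @[n --> \oo] --> (0 : R).
  have -> : (0 : R) = 2 * 0 by rewrite mulr0.
  by apply: cvgM; [exact: cvg_cst | exact: h1].
apply: (@squeeze_cvgr _ _ _ _ (fun=> 0)
  (fun n => 2 * fine (\int[mu]_x (cm (F_ n x - F x))%:E)%E)).
- near=> n; rewrite cm_ge0 /= -cintegralB // -lee_fin EFinM fineK.
    exact: (cintegral_bnd (cintB (iF_ n) iF)).
  have [_ hfin] := cintB (iF_ n) iF; rewrite ge0_fin_numE //.
  by apply: integral_ge0 => x _; rewrite lee_fin cm_ge0.
- exact: cvg_cst.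
- exact: h2.
Unshelve. all: by end_near. Qed.

Lemma cintegral_dct (F_ : nat -> R -> R[i]) F (G : R -> R) :
  (forall n, cmeas (F_ n)) -> cmeas F -> measurable_fun setT G ->
  (\int[mu]_x (G x)%:E < +oo)%E -> (forall n x, cm (F_ n x) <= G x) ->
  (forall x, cm (F_ n x - F x) @[n --> \oo] --> 0) ->
  [/\ forall n, cint (F_ n), cint F &
      cm (cintegral (F_ n) - cintegral F) @[n --> \oo] --> 0].
Proof.
move=> mF_ mF mG iG FG cF.
have i1 n : cint (F_ n) by exact: cint_le iG.
have FG' x : cm (F x) <= G x.
  have c : cm (F_ n x - F x) + G x @[n --> \oo] --> 0 + G x.
    by apply: cvgD => //; exact: cvg_cst.
  rewrite -[G x]add0r; apply: (cvgr_to_ge c); near=> n.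
  apply: (@le_trans _ _ (cm (F_ n x - F x) + cm (F_ n x))); last by rewrite lerD2l.
  by have := cmD (- (F_ n x - F x)) (F_ n x); rewrite cmN opprB subrK.
have i2 : cint F by exact: cint_le iG.
split => //; apply: cintegral_cvg => //.
apply: (@dct0 _ _ (fun x => 2 * G x)).
- by move=> n; apply: cmeas_cm; exact: cmeasB.
- exact: measurable_funM.
- move=> n x; rewrite cm_ge0 /=; apply: le_trans (cmD _ _) _.
  by rewrite cmN mulr_natl mulr2n; apply: lerD.
- under eq_integral => x _ do rewrite EFinM.
  rewrite ge0_integralZl_EFin //.
  + by rewrite lte_mul_pinfty.
  + by move=> x _; rewrite lee_fin; apply: le_trans (FG' x); exact: cm_ge0.
  + exact/measurable_EFinP.
- by move=> x _; exact: cF.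
Unshelve. all: by end_near. Qed.

End cint.

(** * The weighted space L^2(dx / (1 + x^2); H) *)

Lemma ev0P {R : realType} (u : nat -> \bar R) : (forall n, 0 <= u n)%E ->
  u n @[n --> \oo] --> 0%E <->
  (forall e : R, 0 < e -> exists N, forall n, (N <= n)%N -> (u n < e%:E)%E).
Proof.
move=> u0; split.
  move=> /fine_cvgP[fin /cvgrPdist_lt h] e e0.
  have [N _ hN] : \forall n \near \oo, (u n < e%:E)%E.
    near=> n; have fn : u n \is a fin_num by near: n; exact: fin.
    have : `|0 - (fine \o u) n| < e by near: n; exact: h.
    by rewrite sub0r normrN /= ger0_norm ?fine_ge0 // -lte_fin fineK.
  by exists N => n /hN.
move=> h; apply/fine_cvgP.
have fin n e : (u n < e%:E)%E -> u n \is a fin_num.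
  by move=> hu; rewrite ge0_fin_numE //; apply: lt_trans hu (ltry _).
split.
  have [N hN] := h 1 ltr01; exists N => // n /= /hN; exact: fin.
apply/cvgrPdist_lt => e e0; have [N hN] := h e e0; exists N => // n /= /hN hn.
rewrite sub0r normrN /= ger0_norm ?fine_ge0 // -lte_fin fineK //.
exact: fin hn.
Unshelve. all: by end_near. Qed.

Section weighted.
Context {R : realType} {H : completeNormedModType R[i]}.
Variable ip : {dot H for Num.conj}.
Hypothesis hH : hilbert_norm ip.
Implicit Types f g : R -> H.
Local Notation sm := (@strongly_measurable R H).
Local Notation mu := (@lebesgue_measure R).
Local Notation wt := (@wt R).

Lemma wt_ge0 x : 0 <= wt x. Proof. by rewrite ltW // wt_gt0. Qed.

Lemma wt_cont : continuous wt.
Proof.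
move=> x; apply: cvgV; first by rewrite gt_eqF // ltr_pwDl ?sqr_ge0.
by apply: cvgD; [exact: cvg_cst | exact: exprn_continuous].
Qed.

Lemma wt_meas : measurable_fun setT wt.
Proof. exact: continuous_measurable_fun wt_cont. Qed.

Lemma wt_int : (\int[mu]_x (wt x)%:E = pi%:E)%E.
Proof.
have := @int_cauchy R 1 ltr01; rewrite divr1 => <-.
by apply: eq_integral => x _; rewrite /wt expr1n.
Qed.

Definition N2 f : \bar R := (\int[mu]_x (nm (f x) ^+ 2 * wt x)%:E)%E.

Definition L2 f := sm f /\ (N2 f < +oo)%E.

Lemma N2_meas f : sm f -> measurable_fun setT (fun x => nm (f x) ^+ 2 * wt x).
Proof.
move=> sf; apply: measurable_funM; last exact: wt_meas.
by apply: measurable_funX; exact: sm_nm.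
Qed.

Lemma N2_emeas f : sm f -> measurable_fun setT (fun x => (nm (f x) ^+ 2 * wt x)%:E).
Proof. by move=> sf; apply/measurable_EFinP; exact: N2_meas. Qed.

Lemma N2_nn f x : 0 <= nm (f x) ^+ 2 * wt x.
Proof. by rewrite mulr_ge0 ?sqr_ge0 // ltW // wt_gt0. Qed.

Lemma N2_enn f x : (0 <= (nm (f x) ^+ 2 * wt x)%:E)%E.
Proof. by rewrite lee_fin N2_nn. Qed.

Lemma N2_ge0 f : (0 <= N2 f)%E.
Proof. by apply: integral_ge0 => x _; exact: N2_enn. Qed.

Lemma N2_le f g (k : R) : sm f -> sm g -> 0 <= k ->
  (forall x, nm (f x) ^+ 2 <= k * nm (g x) ^+ 2) -> (N2 f <= k%:E * N2 g)%E.
Proof.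
move=> sf sg k0 fg.
rewrite /N2 -ge0_integralZl_EFin //; last 2 first.
- by move=> x _; exact: N2_enn.
- exact: N2_emeas.
apply: ge0_le_integral => //.
- by move=> x _; exact: N2_enn.
- exact: N2_emeas.
- by apply: measurable_funeM => //; exact: N2_emeas.
move=> x _; rewrite -EFinM lee_fin mulrA ler_wpM2r ?wt_ge0 //; exact: fg.
Qed.

Lemma N2_lc (a : R[i]) f g : sm f -> sm g ->
  (N2 (fun x => a *: f x + g x)%R <= (2 * cm a ^+ 2)%:E * N2 f + 2%:E * N2 g)%E.
Proof.
move=> sf sg; have sa := sm_lc a sf sg.
have mf := N2_emeas sf; have mg := N2_emeas sg.
have a0 : 0 <= 2 * cm a ^+ 2 by rewrite mulr_ge0 ?sqr_ge0.
rewrite /N2 -!ge0_integralZl_EFin //; try by move=> x _; exact: N2_enn.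
rewrite -ge0_integralD //; last 4 first.
- by move=> x _; rewrite -EFinM lee_fin mulr_ge0 // N2_nn.
- by apply: measurable_funeM.
- by move=> x _; rewrite -EFinM lee_fin mulr_ge0 // N2_nn.
- by apply: measurable_funeM.
apply: ge0_le_integral => //.
- by move=> x _; exact: (N2_enn (fun x => a *: f x + g x) x).
- exact: (N2_emeas sa).
- by apply: emeasurable_funD; apply: measurable_funeM.
move=> x _; rewrite -!EFinM -EFinD lee_fin !mulrA -mulrDl ler_wpM2r ?wt_ge0 //.
have h := nmD (a *: f x) (g x); rewrite nmZ in h.
have n1 := nm_ge0 (a *: f x + g x); have n2 := cm_ge0 a.
have n3 := nm_ge0 (f x); have n4 := nm_ge0 (g x).
have h2 : nm (a *: f x + g x) ^+ 2 <= (cm a * nm (f x) + nm (g x)) ^+ 2.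
  by rewrite ler_sqr ?nnegrE // addr_ge0 // mulr_ge0.
apply: le_trans h2 _; have := sqr_ge0 (cm a * nm (f x) - nm (g x)); nra.
Qed.

Lemma L2_lc (a : R[i]) f g : L2 f -> L2 g -> L2 (fun x => a *: f x + g x).
Proof.
move=> [sf hf] [sg hg]; split; first exact: sm_lc.
apply: le_lt_trans (N2_lc a sf sg) _; apply: lte_add_pinfty.
  by rewrite lte_mul_pinfty // lee_fin mulr_ge0 // sqr_ge0.
by rewrite lte_mul_pinfty // lee_fin.
Qed.

Lemma L2B f g : L2 f -> L2 g -> L2 (fun x => f x - g x).
Proof.
move=> h1 h2; have := L2_lc (-1) h2 h1.
by under eq_fun do rewrite scaleN1r addrC.
Qed.

Lemma L2_bounded f (K : R) : sm f -> (forall x, nm (f x) <= K) -> L2 f.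
Proof.
move=> sf fK; split => //.
apply: (@le_lt_trans _ _ (\int[mu]_x ((K ^+ 2)%:E * (wt x)%:E))%E).
  apply: ge0_le_integral => //.
  - by move=> x _; exact: N2_enn.
  - exact: N2_emeas.
  - by apply: measurable_funeM => //; apply/measurable_EFinP; exact: wt_meas.
  - move=> x _; rewrite -EFinM lee_fin ler_wpM2r ?wt_ge0 //.
    by rewrite ler_sqr ?nnegrE ?nm_ge0 //; apply: le_trans (fK x); exact: nm_ge0.
rewrite ge0_integralZl_EFin ?sqr_ge0 //; last 2 first.
- by move=> x _; rewrite lee_fin ltW // wt_gt0.
- by apply/measurable_EFinP; exact: wt_meas.
by rewrite wt_int -EFinM ltry.
Qed.

Lemma N2_dct (f_ : nat -> R -> H) f g : (forall n, sm (f_ n)) -> sm f -> L2 g ->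
  (forall n x, nm (f_ n x - f x) <= nm (g x)) ->
  (forall x : R, x != 0 -> f_ n x @[n --> \oo] --> f x) ->
  N2 (fun x => f_ n x - f x) @[n --> \oo] --> 0%E.
Proof.
move=> sf_ sf [sg hg] dom cv.
apply: (@dct0 _ _ (fun x => nm (g x) ^+ 2 * wt x)) => //.
- move=> n; have := N2_meas (sm_lc (-1) sf (sf_ n)).
  by under eq_fun do rewrite scaleN1r addrC.
- exact: N2_meas.
- move=> n x; rewrite (N2_nn (fun x => f_ n x - f x)) /= ler_wpM2r ?wt_ge0 //.
  by rewrite ler_sqr ?nnegrE ?nm_ge0.
move=> x x0; have /cvg_nm h := cv x x0.
have -> : (0 : R) = 0 ^+ 2 * wt x by rewrite expr0n mul0r.
apply: cvgM; last exact: cvg_cst.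
by under eq_fun do rewrite expr2; rewrite expr2; apply: cvgM.
Qed.

Lemma N2_simple f : L2 f -> exists s : nat -> R -> H,
  (forall n, tsimple (s n) /\ L2 (s n)) /\
  N2 (fun x => s n x - f x) @[n --> \oo] --> 0%E.
Proof.
move=> [sf hf]; have [s [hs sfx b]] := sm_trunc sf.
have b2 n : L2 (s n).
  split; first exact: sm_simple.
  apply: le_lt_trans (N2_le (k := 4) (sm_simple (hs n)) sf _ _) _ => //.
    move=> x; have := b n x; have := nm_ge0 (s n x); have := nm_ge0 (f x); nra.
  by rewrite lte_mul_pinfty.
exists s; split => [n|]; first by split.
have hz : L2 (fun=> 0) by apply: (@L2_bounded _ 0); [exact: sm_cst|move=> x; rewrite nm0].
apply: (@N2_dct _ _ (fun x => 3%:C *: f x + 0 )) => //.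
- by move=> n; exact: sm_simple.
- exact: (L2_lc 3%:C (conj sf hf) hz).
- move=> n x; rewrite addr0 nmZ cmR ger0_norm //.
  apply: le_trans (nmD _ _) _; rewrite nmN.
  by have := b n x; lra.
Qed.

Definition N1 f : \bar R := (\int[mu]_x (nm (f x) * wt x)%:E)%E.

Lemma N1_ge0 f : (0 <= N1 f)%E.
Proof.
by apply: integral_ge0 => x _; rewrite lee_fin mulr_ge0 ?nm_ge0 // ltW // wt_gt0.
Qed.

(** From t <= d + t^2 / d; the free parameter d turns N2-convergence into
    N1-convergence. *)
Lemma N1_N2 f (d : R) : sm f -> 0 < d ->
  (N1 f <= (d * pi)%:E + (d^-1)%:E * N2 f)%E.
Proof.
move=> sf d0; have mf := N2_emeas sf.
have mw : measurable_fun setT (fun x => (wt x)%:E).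
  by apply/measurable_EFinP; exact: wt_meas.
have w0 x : (0 <= (wt x)%:E)%E by rewrite lee_fin ltW // wt_gt0.
have di : 0 <= d^-1 by rewrite invr_ge0 ltW.
rewrite EFinM -wt_int -!ge0_integralZl_EFin //; last 2 first.
- by move=> x _; exact: N2_enn.
- exact: ltW.
rewrite -ge0_integralD //; last 4 first.
- by move=> x _; rewrite mule_ge0 // lee_fin ltW.
- exact: measurable_funeM.
- by move=> x _; rewrite mule_ge0 // N2_enn.
- exact: measurable_funeM.
apply: ge0_le_integral => //.
- by move=> x _; rewrite lee_fin mulr_ge0 ?nm_ge0 // ltW // wt_gt0.
- apply/measurable_EFinP; apply: measurable_funM; last exact: wt_meas.
  exact: sm_nm.
- by apply: emeasurable_funD; exact: measurable_funeM.
move=> x _; rewrite -!EFinM -EFinD lee_fin mulrA -mulrDl ler_wpM2r ?wt_ge0 //.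
rewrite -(ler_pM2l d0) mulrDr mulrA divff ?gt_eqF // mul1r.
by have := sqr_ge0 (d - nm (f x)); have := sqr_ge0 (nm (f x)); nra.
Qed.

Lemma N1_fin f : L2 f -> (N1 f < +oo)%E.
Proof.
move=> [sf hf]; apply: le_lt_trans (N1_N2 sf ltr01) _.
by rewrite invr1 mul1e lte_add_pinfty // ltry.
Qed.

Lemma N1_cvg (f_ : nat -> R -> H) : (forall n, sm (f_ n)) ->
  N2 (f_ n) @[n --> \oo] --> 0%E -> N1 (f_ n) @[n --> \oo] --> 0%E.
Proof.
move=> sf h; have [h1 _] := ev0P (fun n => N2_ge0 (f_ n)); have {h1}h := h1 h.
apply/ev0P; first by move=> n; exact: N1_ge0.
move=> e e0; pose d := e / (4 * pi).
have p0 := pi_gt0 R.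
have d0 : 0 < d by rewrite divr_gt0 // mulr_gt0.
have [|N hN] := h (d * (e / 2)); first by rewrite mulr_gt0 // divr_gt0.
exists N => n /hN hn; apply: le_lt_trans (N1_N2 (sf n) d0) _.
have fn : N2 (f_ n) \is a fin_num.
  by rewrite ge0_fin_numE ?N2_ge0 //; apply: lt_trans hn (ltry _).
rewrite -(fineK fn) -EFinM -EFinD lte_fin; move: hn; rewrite -{1}(fineK fn) lte_fin.
move: (fine _) => t ht.
have -> : d * pi = e / 4.
  by rewrite /d; move: p0; clear; move: (@pi R) => p p0; field; rewrite gt_eqF.
have : d^-1 * t < e / 2 by rewrite ltr_pdivrMl.
by lra.
Qed.

(** Kernels dominated by the weight w pair with all of L^2(w dx); Fourier
    transforms of test functions are of this kind. *)
Definition kern (k : R -> R[i]) :=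
  cmeas k /\ exists2 K : R, 0 <= K & forall x, cm (k x) <= K * wt x.

Definition pairing (k : R -> R[i]) f w := cintegral (fun x => k x * cip ip (f x) w).

Lemma pairing_bnd k f w (K : R) : cmeas k -> 0 <= K ->
  (forall x, cm (k x) <= K * wt x) -> sm f ->
  (\int[mu]_x (cm (k x * cip ip (f x) w))%:E <= (K * nm w)%:E * N1 f)%E.
Proof.
move=> mk K0 kK sf.
have m1 : measurable_fun setT (fun x => (nm (f x) * wt x)%:E).
  apply/measurable_EFinP; apply: measurable_funM; last exact: wt_meas.
  exact: sm_nm.
have n1 x : (0 <= (nm (f x) * wt x)%:E)%E.
  by rewrite lee_fin mulr_ge0 ?nm_ge0 // ltW // wt_gt0.
rewrite /N1 -ge0_integralZl_EFin // ?mulr_ge0 ?nm_ge0 //.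
apply: ge0_le_integral => //.
- by move=> x _; rewrite lee_fin cm_ge0.
- apply/measurable_EFinP; apply: cmeas_cm; apply: cmeasM => //.
  exact: (sm_cip hH).
- exact: measurable_funeM.
move=> x _; rewrite -EFinM lee_fin cmM.
apply: (@le_trans _ _ (K * wt x * (nm (f x) * nm w))).
  by apply: ler_pM; rewrite ?cm_ge0 // ip_cs.
by rewrite le_eqVlt; apply/orP; left; apply/eqP; ring.
Qed.

Lemma pairing_cint k f w : kern k -> L2 f -> cint (fun x => k x * cip ip (f x) w).
Proof.
move=> hk hf; split.
  by apply: cmeasM; [exact: hk.1 | exact: (sm_cip hH _ hf.1)].
have [mk [K K0 kK]] := hk; apply: le_lt_trans (pairing_bnd w mk K0 kK hf.1) _.
by rewrite lte_mul_pinfty ?N1_fin // lee_fin mulr_ge0 // nm_ge0.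
Qed.

Lemma pairing_lc k (a : R[i]) f g w : kern k -> L2 f -> L2 g ->
  pairing k (fun x => a *: f x + g x) w = a * pairing k f w + pairing k g w.
Proof.
move=> hk hf hg; have i1 := pairing_cint w hk hf; have i2 := pairing_cint w hk hg.
rewrite /pairing -cintegralZ // -cintegralD //; last exact: cintZ.
by congr cintegral; apply/funext => x; rewrite ipDl ipZl; ring.
Qed.

Lemma pairing_cvg k (f_ : nat -> R -> H) f w : kern k -> (forall n, L2 (f_ n)) ->
  L2 f -> N2 (fun x => f_ n x - f x) @[n --> \oo] --> 0%E ->
  cm (pairing k (f_ n) w - pairing k f w) @[n --> \oo] --> 0.
Proof.
move=> hk hf_ hf cv; apply: cintegral_cvg.
- by move=> n; exact: pairing_cint.
- exact: pairing_cint.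
have hd n : L2 (fun x => f_ n x - f x) by exact: L2B.
have h1 := N1_cvg (fun n => (hd n).1) cv.
have [mk [K K0 kK]] := hk.
have c0 : 0 <= K * nm w by rewrite mulr_ge0 // nm_ge0.
have c1 : 0 < K * nm w + 1 by rewrite ltr_wpDl.
apply/ev0P.
  by move=> n; apply: integral_ge0 => x _; rewrite lee_fin cm_ge0.
move=> e e0.
have [h2 _] := ev0P (fun n => N1_ge0 (fun x => f_ n x - f x)).
have [|N hN] := h2 h1 (e / (K * nm w + 1)); first by rewrite divr_gt0.
exists N => n /hN hn.
under eq_integral => x _ do rewrite -mulrBr -ipBl.
apply: le_lt_trans (pairing_bnd w mk K0 kK (hd n).1) _.
have fn : N1 (fun x => f_ n x - f x) \is a fin_num.
  by rewrite ge0_fin_numE ?N1_ge0 //; apply: lt_trans hn (ltry _).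
move: hn; rewrite -(fineK fn) -EFinM !lte_fin ltr_pdivlMr //.
apply: le_lt_trans; rewrite mulrC ler_wpM2l ?lerDl // fine_ge0 // N1_ge0 //.
Qed.

(** A simple function with values in V is a finite sum of indicators times
    elements of V. *)
Lemma simple_ind (V : set H) (Pr : (R -> H) -> Prop) :
  Pr (fun=> 0) ->
  (forall B v g, measurable B -> V v -> Pr g ->
    Pr (fun x => (\1_B x)%:C *: v + g x)) ->
  forall s, tsimple s -> (forall x, V (s x)) -> Pr s.
Proof.
move=> P0 PS s [fs ms] Vs.
have [r rs] := (finite_seqP _).1 fs.
pose r' := undup r.
have Vr v : v \in r' -> V v.
  rewrite mem_undup => vr; have : range s v by rewrite rs.
  by move=> [x _ <-].
have -> : s = fun x => \sum_(v <- r') (\1_(s @^-1` [set v]) x)%:C *: v.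
  apply/funext => x.
  have sx : s x \in r'.
    by rewrite mem_undup; have : range s (s x) by []; rewrite rs.
  rewrite (bigD1_seq (s x)) ?undup_uniq //= indicE mem_set // scale1r big1 ?addr0 //.
  move=> v vs; rewrite indicE memNset ?scale0r //=.
  by move=> /= e; rewrite e eqxx in vs.
elim: r' Vr => [|v r' IH] Vr.
  by rewrite (_ : (fun _ => _) = (fun=> 0)) //; apply/funext => x; rewrite big_nil.
rewrite (_ : (fun _ => _) = (fun x => (\1_(s @^-1` [set v]) x)%:C *: v +
  \sum_(v <- r') (\1_(s @^-1` [set v]) x)%:C *: v)); last first.
  by apply/funext => x; rewrite big_cons.
apply: PS; first exact: ms.
  by apply: Vr; rewrite inE eqxx.
by apply: IH => u ur; apply: Vr; rewrite inE ur orbT.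
Qed.

Lemma L2_indic B v : measurable B -> L2 (fun x => (\1_B x)%:C *: v).
Proof.
move=> mB; apply: (@L2_bounded _ (nm v)).
  by apply: sm_scale; [apply: cmeas_R; exact: measurable_indic | exact: sm_cst].
move=> x; rewrite nmZ cmR indicE; case: (x \in B); rewrite ?normr1 ?normr0.
  by rewrite mul1r.
by rewrite mul0r nm_ge0.
Qed.

Lemma L2_0 : L2 (fun=> 0).
Proof. by apply: (@L2_bounded _ 0); [exact: sm_cst|move=> x; rewrite nm0]. Qed.

Lemma wt_efin : (\int[mu]_x (wt x)%:E < +oo)%E.
Proof. by rewrite wt_int ltry. Qed.

Lemma kern_cint k : kern k -> cint k.
Proof.
move=> [mk [K K0 kK]]; apply: (@cint_le _ _ (fun x => K * wt x)) => //.
  by apply: measurable_funM => //; exact: wt_meas.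
under eq_integral => x _ do rewrite EFinM.
rewrite ge0_integralZl_EFin //; last 2 first.
- by move=> x _; rewrite lee_fin wt_ge0.
- by apply/measurable_EFinP; exact: wt_meas.
by rewrite lte_mul_pinfty // wt_efin.
Qed.

Lemma kernM k (g : R -> R[i]) (M : R) : kern k -> cmeas g ->
  (forall x, cm (g x) <= M) -> kern (fun x => k x * g x).
Proof.
move=> [mk [K K0 kK]] mg gM; split; first exact: cmeasM.
have M0 : 0 <= M by apply: le_trans (gM 0); exact: cm_ge0.
exists (K * M); first exact: mulr_ge0.
move=> x; rewrite cmM mulrAC; apply: ler_pM; rewrite ?cm_ge0 //.
Qed.

Lemma pairing_le k f w (K : R) : kern k -> 0 <= K ->
  (forall x, cm (k x) <= K * wt x) -> L2 f ->
  cm (pairing k f w) <= 2 * (K * nm w) * fine (N1 f).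
Proof.
move=> hk K0 kK Lf.
have fn : N1 f \is a fin_num by rewrite ge0_fin_numE ?N1_ge0 // N1_fin.
rewrite -lee_fin EFinM fineK // EFinM -muleA.
apply: le_trans (cintegral_bnd (pairing_cint w hk Lf)) _.
by rewrite lee_pmul2l //; apply: pairing_bnd => //; [exact: hk.1 | exact: Lf.1].
Qed.

Lemma pairingB k f g w : kern k -> L2 f -> L2 g ->
  pairing k (fun x => f x - g x) w = pairing k f w - pairing k g w.
Proof.
move=> hk hf hg; rewrite addrC -mulN1r -pairing_lc //; congr pairing.
by apply/funext => x; rewrite scaleN1r addrC.
Qed.

(** Explicit for simple functions; in general the vectors representing the
    approximations form a Cauchy sequence. *)
Lemma pairing_rep k f : kern k -> L2 f ->
  exists v, forall w, cip ip v w = pairing k f w.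
Proof.
move=> hk hf.
have simp s : tsimple s -> L2 s /\ exists v, forall w, cip ip v w = pairing k s w.
  move=> hs; apply: (@simple_ind setT (fun s => L2 s /\ exists v, forall w, cip ip v w = pairing k s w)) hs _ => //.
    split; first exact: L2_0.
    exists 0 => w; rewrite ip0l /pairing.
    rewrite (_ : (fun _ => _) = (fun x => 0 * k x)).
      by rewrite cintegralZ ?mul0r //; exact: kern_cint.
    by apply/funext => x; rewrite ip0l mulr0 mul0r.
  move=> B v g mB _ [Lg [u hu]]; have LB := L2_indic v mB.
  split; first by have := L2_lc 1 LB Lg; under eq_fun do rewrite scale1r.
  exists (cintegral (fun x => k x * (\1_B x)%:C) *: v + u) => w.
  have kB : kern (fun x => k x * (\1_B x)%:C).
    apply: (@kernM _ _ 1) => //; first by apply: cmeas_R; exact: measurable_indic.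
    by move=> x; rewrite cmR indicE; case: (x \in B); rewrite ?normr1 ?normr0.
  have := pairing_lc 1 w hk LB Lg; rewrite mul1r => h.
  rewrite ipDl ipZl hu.
  have <- : pairing k (fun x => 1 *: ((\1_B x)%:C *: v) + g x) w =
    pairing k (fun x => (\1_B x)%:C *: v + g x) w.
    by congr pairing; apply/funext => x; rewrite scale1r.
  rewrite h; congr (_ + _); rewrite mulrC -cintegralZ; last exact: kern_cint.
  by congr cintegral; apply/funext => x; rewrite ipZl; ring.
have [s [hs cv]] := N2_simple hf.
have hsv n : exists v, forall w, cip ip v w = pairing k (s n) w.
  by have [] := simp _ (hs n).1.
have [v hv] := choice hsv.
have [mk [K K0 kK]] := hk.
have hd n : L2 (fun x => s n x - f x) by apply: L2B => //; exact: (hs n).2.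
pose a n := fine (N1 (fun x => s n x - f x)).
have a0 : a n @[n --> \oo] --> 0.
  by apply: fine_cvg; apply: N1_cvg cv => n; exact: (hd n).1.
have vc n m : nm (v n - v m) <= 2 * K * (a n + a m).
  have [v0|v0] := eqVneq (nm (v n - v m)) 0.
    rewrite v0 !mulr_ge0 // addr_ge0 // fine_ge0 // N1_ge0 //.
  have vp : 0 < nm (v n - v m) by rewrite lt_def v0 nm_ge0.
  rewrite -(ler_pM2r vp) -expr2 -(rip_nm hH).
  set w := v n - v m.
  apply: le_trans (ler_norm _) _; apply: le_trans (cm_Re _) _.
  rewrite /w {1}ipBl !hv -/w.
  have -> : pairing k (s n) w - pairing k (s m) w =
    pairing k (fun x => s n x - f x) w - pairing k (fun x => s m x - f x) w.
    by rewrite !pairingB //; [ring | exact: (hs m).2 | exact: (hs n).2].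
  apply: le_trans (cmD _ _) _; rewrite cmN.
  apply: le_trans (lerD (pairing_le w hk K0 kK (hd n)) (pairing_le w hk K0 kK (hd m))) _.
  by rewrite le_eqVlt; apply/orP; left; apply/eqP; rewrite /a; ring.
have [l vl] : exists l : H, v n @[n --> \oo] --> l.
  apply: cauchy_nm => e e0.
  have K1 : 0 < 4 * K + 1 by rewrite ltr_wpDl // mulr_ge0.
  have d0 : 0 < e / (4 * K + 1) by rewrite divr_gt0.
  have /cvgrPdist_lt/(_ _ d0)[N _ hN] := a0.
  exists N => n m Nn Nm; apply: le_lt_trans (vc n m) _.
  have := hN n Nn; have := hN m Nm; rewrite /= !sub0r !normrN.
  have an j : 0 <= a j by rewrite fine_ge0 // N1_ge0.
  rewrite !ger0_norm //; move: (an n) (an m); move: (a n) (a m) => p q p0 q0 hp hq.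
  have e1 : e = (e / (4 * K + 1)) * (4 * K + 1) by rewrite divfK // gt_eqF.
  move: hp hq d0 e1; move: (e / (4 * K + 1)) => d hp hq d0 ->.
  nra.
exists l => w.
have c1 := pairing_cvg w hk (fun n => (hs n).2) hf cv.
apply/eqP; rewrite -subr_eq0; apply/eqP/cm_eq0/eqP; rewrite eq_le cm_ge0 andbT.
have c2 : nm (v n - l) * nm w + cm (pairing k (s n) w - pairing k f w) @[n --> \oo] --> (0 * nm w + 0 : R).
  by apply: cvgD => //; apply: cvgM; [exact/cvg_nm | exact: cvg_cst].
rewrite mul0r addr0 in c2; apply: (cvgr_to_ge c2); near=> n.
rewrite -hv; apply: (@le_trans _ _ (cm (cip ip (l - v n) w) + cm (cip ip (v n) w - pairing k f w))).
  by apply: le_trans (cmD _ _); rewrite ipBl addrA subrK.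
by rewrite lerD2r nmB; exact: ip_cs.
Unshelve. all: by end_near. Qed.

End weighted.

(** * Completeness of the weighted space *)

Section rf.
Context {R : realType} {H : completeNormedModType R[i]}.
Implicit Types f g : R -> H.
Local Notation sm := (@strongly_measurable R H).
Local Notation mu := (@lebesgue_measure R).
Local Notation wt := (@wt R).

Lemma N2_ae f g (N : set R) : measurable N -> mu N = 0%E -> sm f -> sm g ->
  (forall x, ~ N x -> f x = g x) -> N2 f = N2 g.
Proof.
move=> mN N0 sf sg fg.
have le u v : sm u -> sm v -> (forall x, ~ N x -> u x = v x) -> (N2 u <= N2 v)%E.
  move=> su sv uv; apply: ae_ge0_le_integral => //.
  - by move=> x _; exact: N2_enn.
  - exact: N2_emeas.
  - by move=> x _; exact: N2_enn.
  - exact: N2_emeas.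
  - exists N; split => // x /= h; rewrite -[N x]notK => Nx; apply: h => _.
    by rewrite uv.
by apply/eqP; rewrite eq_le !le // => x /fg.
Qed.

Lemma geo_cauchy (u : nat -> H) (C : R) : 0 <= C ->
  (forall j, nm (u j.+1 - u j) <= C * 2^-1 ^+ j) ->
  exists l : H, u n @[n --> \oo] --> l.
Proof.
move=> C0 hu.
have st n k : nm (u (n + k)%N - u n) <= 2 * C * (2^-1 ^+ n - 2^-1 ^+ (n + k)).
  elim: k => [|k IH]; first by rewrite addn0 !subrr nm0 mulr0.
  apply: le_trans (nm_tri (u (n + k)%N) _ _) _; rewrite addnS.
  apply: le_trans (lerD (hu _) IH) _; rewrite exprS.
  by move: (2^-1 ^+ _) (2^-1 ^+ _) => a b; rewrite le_eqVlt; apply/orP; left; apply/eqP; field.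
apply: cauchy_nm => e e0.
have d0 : 0 < e / (2 * (2 * C + 1)) by rewrite divr_gt0 // mulr_gt0 // ltr_wpDl // mulr_ge0.
have /cvgrPdist_lt/(_ _ d0)[N _ /(_ N (leqnn _)) hN] : (2^-1 : R) ^+ n @[n --> \oo] --> (0 : R).
  by apply: cvg_expr; rewrite ger0_norm // invf_lt1 // ltr1n.
exists N; have b n : (N <= n)%N -> nm (u n - u N) < e / 2.
  move=> Nn; rewrite -(subnKC Nn); apply: le_lt_trans (st _ _) _.
  have h0 k : 0 <= (2^-1 : R) ^+ k by rewrite exprn_ge0 // invr_ge0.
  move: hN; rewrite sub0r normrN ger0_norm // ltr_pdivlMr; last by lra.
  move: (h0 (N + (n - N))%N) (h0 N); move: (2^-1 ^+ _) (2^-1 ^+ _) => a b a0 b0 hb.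
  have := mulr_ge0 C0 a0; have := mulr_ge0 C0 b0; nra.
move=> n m Nn Nm; apply: le_lt_trans (nm_tri (u N) _ _) _.
by have := b n Nn; have := b m Nm; rewrite (nmB (u N)); lra.
Qed.

(** Along a subsequence whose increments decrease like 8^-j, the sum of the squared
    increments weighted by 4^j is integrable, so that the values converge off a null
    set; there the functions are redefined to be 0, which keeps them in V. *)
Lemma riesz_fischer (V : set H) (s : nat -> R -> H) : V 0 -> closed V ->
  (forall n, tsimple (s n)) -> (forall n x, V (s n x)) -> (forall n, L2 (s n)) ->
  (forall e : R, 0 < e -> exists N, forall n m, (N <= n)%N -> (N <= m)%N ->
    (N2 (fun x => s n x - s m x)%R < e%:E)%E) ->
  exists f, [/\ L2 f, forall x, V (f x) &
     N2 (fun x => s n x - f x) @[n --> \oo] --> 0%E].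
Proof.
move=> V0 cV ts Vs Ls cau.
(* 8 = 4 * 2: the factor 4^j below leaves a summable 2^-j *)
pose ep j : R := 2^-1 / (8 ^+ j).
have ep0 j : 0 < ep j by rewrite divr_gt0 ?invr_gt0 ?exprn_gt0.
have [N hN] := choice (fun j => cau (ep j) (ep0 j)).
pose phi j := (\max_(i < j.+1) N i + j)%N.
have phiN i j : (i <= j)%N -> (N i <= phi j)%N.
  move=> ij; apply: leq_trans (leq_addr _ _).
  by rewrite -ltnS in ij; exact: (leq_bigmax (Ordinal ij)).
pose t j := s (phi j).
pose D j x := t j.+1 x - t j x.
have LD j : L2 (D j) by exact: (L2B (Ls (phi j.+1)) (Ls (phi j))).
have N2D j : (N2 (D j) < (ep j)%:E)%E by apply: hN; exact: phiN.
pose g j x := (4 ^+ j * (nm (D j x) ^+ 2 * wt x))%:E.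
have g0 j x : (0 <= g j x)%E by rewrite lee_fin mulr_ge0 ?N2_nn // exprn_ge0.
have mg j : measurable_fun setT (g j).
  by apply/measurable_EFinP; apply: measurable_funM => //; apply: N2_meas; exact: (LD j).1.
pose G x := (\sum_(j <oo) g j x)%E.
have Gint : (\int[mu]_x G x < +oo)%E.
  rewrite integral_nneseries //.
  apply: (@le_lt_trans _ _ 1%:E); last exact: ltry.
  apply: le_trans (epsilon_trick0 xpredT (ler01 : (0 : R) <= 1)).
  apply: lee_nneseries => [j _ _|j _]; first by apply: integral_ge0 => x _; exact: g0.
  rewrite /g; under eq_integral => x _ do rewrite EFinM.
  rewrite ge0_integralZl_EFin //; last 2 first.
  - by move=> x _; exact: N2_enn.
  - by apply: N2_emeas; exact: (LD j).1.
  apply: (@le_trans _ _ ((4 ^+ j)%:E * (ep j)%:E)%E).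
    by rewrite lee_pmul2l ?lte_fin ?exprn_gt0 //; exact: ltW (N2D j).
  rewrite -EFinM lee_fin /ep natrX exprS.
  have -> : (8 : R) = 4 * 2 by rewrite -natrM.
  rewrite exprMn le_eqVlt; apply/orP; left; apply/eqP; field.
  by rewrite !expf_neq0 ?pnatr_eq0.
have mG : measurable_fun setT G by apply: ge0_emeasurable_sum.
have iG : mu.-integrable setT G.
  apply/integrableP; split => //.
  under eq_integral => x _ do rewrite gee0_abs ?nneseries_ge0 //.
  exact: Gint.
have [Z [mZ Z0 hZ]] := integrable_ae measurableT iG.
have finG x : ~ Z x -> G x \is a fin_num.
  by move=> nZ; have := contra_not (hZ x) nZ; move=> /contrapT/(_ I).
have cvt x : ~ Z x -> exists l : H, t n x @[n --> \oo] --> l.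
  move=> /finG Gx; pose C := Num.sqrt (fine (G x) / wt x).
  apply: (@geo_cauchy _ C); first exact: sqrtr_ge0.
  move=> j.
  have G0 : 0 <= fine (G x) by apply/fine_ge0/nneseries_ge0 => k _ _; exact: g0.
  have : (g j x <= G x)%E.
    apply: le_trans (nneseries_lim_ge (P := xpredT) (m := 0) j.+1 _) => [|k _ _]; last exact: g0.
    by rewrite big_nat_recr //= leeDr // sume_ge0.
  rewrite -(fineK Gx) lee_fin => h.
  have w0 := wt_gt0 x.
  rewrite -ler_sqr ?nnegrE ?nm_ge0 ?mulr_ge0 ?sqrtr_ge0 ?exprn_ge0 //.
  rewrite exprMn sqr_sqrtr; last by rewrite divr_ge0 // ltW.
  have -> : (2^-1 ^+ j) ^+ 2 = (4 ^+ j)^-1 :> R.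
    have q : (2^-1 : R) ^+ 2 = 4^-1 by field.
    by rewrite -exprM mulnC exprM q exprVn.
  rewrite mulrAC ler_pdivlMr // ler_pdivlMr ?exprn_gt0 //.
  by apply: le_trans h; rewrite le_eqVlt mulrC eqxx.
pose tt j x := if x \in Z then 0 else t j x.
have mp : measurable [set x | x \in Z].
  by rewrite (_ : [set _ | _] = Z) //; apply/seteqP; split => x /=; rewrite inE.
have tst j : tsimple (tt j).
  by apply: tsimple_if => //; [exact: tsimple_cst | exact: ts].
have ctt x : exists l : H, tt n x @[n --> \oo] --> l.
  have [Zx|nZx] := pselect (Z x).
    by exists 0; rewrite /tt (mem_set Zx); exact: cvg_cst.
  by rewrite /tt (memNset nZx); exact: cvt.
have [f hf] := choice ctt.
have sf : sm f by exact: sm_lim tst hf.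
have Vf x : V (f x).
  apply: (closed_seq V).1 (hf x) => // n.
  by rewrite /tt; case: ifP => // _; exact: Vs.
have key e : 0 < e -> exists M, forall n, (M <= n)%N -> (N2 (fun x => s n x - f x)%R <= e%:E)%E.
  move=> e0; have [M hM] := cau e e0; exists M => n Mn.
  have smB (u v : R -> H) : sm u -> sm v -> sm (fun x => u x - v x).
    move=> su sv; have := sm_lc (-1) sv su.
    by under eq_fun do rewrite scaleN1r addrC.
  have st j : sm (tt j) := sm_simple (tst j).
  have ss j : sm (s j) := sm_simple (ts j).
  apply: (@fatou_le0 _ (fun j x => (nm (s n x - tt (j + M)%N x) ^+ 2 * wt x)%:E)).
  - by move=> j; apply: (N2_emeas (f := fun x => s n x - tt (j + M)%N x)); exact: (smB _ _ (ss n) (st _)).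
  - by apply: (N2_emeas (f := fun x => s n x - f x)); exact: (smB _ _ (ss n) sf).
  - by move=> j x; exact: (N2_enn (fun x => s n x - tt (j + M)%N x)).
  - by move=> x; exact: (N2_enn (fun x => s n x - f x)).
  - move=> x _; apply: cvg_EFin; first by near=> j.
    have h1 : s n x - tt (j + M)%N x @[j --> \oo] --> s n x - f x.
      apply: cvgB; first exact: cvg_cst.
      by have := hf x; rewrite -(cvg_shiftn M).
    have h2 := nm_cvg h1.
    apply: cvgM; last exact: cvg_cst.
    by under eq_fun do rewrite expr2; rewrite expr2; apply: cvgM.
  - move=> j; rewrite -/(N2 (fun x => s n x - tt (j + M)%N x)%R).
    rewrite (@N2_ae _ (fun x => s n x - t (j + M)%N x) Z) //; try exact: (smB _ _ (ss n) (st _)); try exact: (smB _ _ (ss n) (ss _)).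
      apply: ltW; apply: hM => //; rewrite /phi.
      exact: leq_trans (leq_addl j M) (leq_addl _ _).
    by move=> x nZx; rewrite /tt memNset.
have Lf : L2 f.
  split => //.
  have [M /(_ M (leqnn _)) hM] := key 1 ltr01.
  have sB : sm (fun x => s M x - f x).
    have := sm_lc (-1) sf (sm_simple (ts M)).
    by under eq_fun do rewrite scaleN1r addrC.
  have : L2 (fun x => s M x - (s M x - f x)).
    by apply: L2B => //; split => //; apply: le_lt_trans hM (ltry _).
  by under eq_fun do rewrite subKr; move=> -[].
exists f; split => //.
apply/ev0P; first by move=> n; exact: N2_ge0.
move=> e e0; have [|M hM] := key (e / 2); first by rewrite divr_gt0.
exists M => n /hM h; apply: le_lt_trans h _; rewrite lte_fin; lra.
Unshelve. all: by end_near. Qed.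

End rf.

(** * Classes closed under bounded pointwise limits *)

Section bclass.
Context {R : realType}.
Implicit Types g h : R -> R[i].

Definition bm g := cmeas g /\ exists M : R, forall x, cm (g x) <= M.

(** The closure properties that determine the class of bounded Baire functions;
    conditions such as the vanishing of an integral define classes of this kind. *)
Definition bclass (L : (R -> R[i]) -> Prop) :=
  (forall (a : R[i]) g h, L g -> L h -> L (fun x => a * g x + h x)) /\
  (forall (g_ : nat -> R -> R[i]) g (M : R), (forall n, L (g_ n)) ->
     (forall n x, cm (g_ n x) <= M) ->
     (forall x, cm (g_ n x - g x) @[n --> \oo] --> 0) -> L g).

Definition gen (S : (R -> R[i]) -> Prop) g :=
  forall L, bclass L -> (forall h, S h -> L h) -> L g.

Lemma gen_sub S g : S g -> gen S g. Proof. by move=> h L _; apply. Qed.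

Lemma gen_bclass S : bclass (gen S).
Proof.
split => [a g h hg hh L bL SL|g_ g M hg_ b c L bL SL].
  by apply: bL.1; [exact: hg | exact: hh].
by apply: (bL.2 g_ g M) => // n; exact: hg_.
Qed.

Lemma cm_lim (u : nat -> R[i]) (l : R[i]) (M : R) : (forall n, cm (u n) <= M) ->
  cm (u n - l) @[n --> \oo] --> 0 -> cm l <= M.
Proof.
move=> b c; have c2 : cm (u n - l) + M @[n --> \oo] --> 0 + M.
  by apply: cvgD => //; exact: cvg_cst.
rewrite -[M]add0r; apply: (cvgr_to_ge c2); near=> n.
apply: (@le_trans _ _ (cm (u n - l) + cm (u n))); last by rewrite lerD2l.
by have := cmD (- (u n - l)) (u n); rewrite cmN opprB subrK.
Unshelve. all: by end_near. Qed.

Lemma cm_cvg_Re (u : nat -> R[i]) (l : R[i]) : cm (u n - l) @[n --> \oo] --> 0 ->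
  complex.Re (u n) @[n --> \oo] --> complex.Re l.
Proof.
move=> h; apply: (@cvg_sub0 _ _ _ _ _ _ (fun=> complex.Re l)); last exact: cvg_cst.
apply/norm_cvg0P; apply: squeeze_cvgr h; last exact: cvg_cst.
by near=> n; rewrite normr_ge0 /=; have := cm_Re (u n - l); rewrite cReD cReN.
Unshelve. all: by end_near. Qed.

Lemma cm_cvg_Im (u : nat -> R[i]) (l : R[i]) : cm (u n - l) @[n --> \oo] --> 0 ->
  complex.Im (u n) @[n --> \oo] --> complex.Im l.
Proof.
move=> h; apply: (@cvg_sub0 _ _ _ _ _ _ (fun=> complex.Im l)); last exact: cvg_cst.
apply/norm_cvg0P; apply: squeeze_cvgr h; last exact: cvg_cst.
by near=> n; rewrite normr_ge0 /=; have := cm_Im (u n - l); rewrite cImD cImN.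
Unshelve. all: by end_near. Qed.

Lemma cm_cvgP (u : nat -> R[i]) (l : R[i]) :
  complex.Re (u n) @[n --> \oo] --> complex.Re l ->
  complex.Im (u n) @[n --> \oo] --> complex.Im l ->
  cm (u n - l) @[n --> \oo] --> 0.
Proof.
move=> h1 h2; apply: (@squeeze_cvgr _ _ _ _ (fun=> 0)
  (fun n => `|complex.Re (u n) - complex.Re l| + `|complex.Im (u n) - complex.Im l|)).
- near=> n; rewrite cm_ge0 /=; apply: le_trans (cm_le _) _.
  by rewrite cReD cReN cImD cImN.
- exact: cvg_cst.
- by rewrite -[0]addr0; apply: cvgD; exact: cvg_dist0.
Unshelve. all: by end_near. Qed.

Lemma cmeas_lim (g_ : nat -> R -> R[i]) g : (forall n, cmeas (g_ n)) ->
  (forall x, cm (g_ n x - g x) @[n --> \oo] --> 0) -> cmeas g.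
Proof.
move=> mg c; split.
  apply: (@measurable_fun_cvg _ _ _ _ (fun n x => complex.Re (g_ n x))) => [n|x _].
    exact: (mg n).1.
  exact: cm_cvg_Re.
apply: (@measurable_fun_cvg _ _ _ _ (fun n x => complex.Im (g_ n x))) => [n|x _].
  exact: (mg n).2.
exact: cm_cvg_Im.
Qed.

Lemma bm_bclass : bclass bm.
Proof.
split => [a g h [mg [M1 b1]] [mh [M2 b2]]|g_ g M hg_ b c].
  split; first by apply: cmeasD => //; apply: cmeasM => //; exact: cmeas_cst.
  exists (cm a * M1 + M2) => x; apply: le_trans (cmD _ _) _.
  by rewrite cmM; apply: lerD => //; apply: ler_wpM2l => //; exact: cm_ge0.
split; first by apply: cmeas_lim c => n; exact: (hg_ n).1.
by exists M => x; apply: cm_lim (c x) => n.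
Qed.

Lemma gen_bm S g : (forall h, S h -> bm h) -> gen S g -> bm g.
Proof. by move=> Sb; apply; [exact: bm_bclass | exact: Sb]. Qed.

(** Fixing one factor of a product again gives such a class: the usual
    monotone-class step behind gen_mul. *)
Lemma bclass_mul L g : bclass L -> bm g -> bclass (fun h => L (fun x => g x * h x)).
Proof.
move=> bL [mg [M1 b1]]; split => [a h1 h2 l1 l2|h_ h M l b c].
  have := bL.1 a _ _ l1 l2.
  by under eq_fun do rewrite mulrCA -mulrDr.
apply: (bL.2 (fun n x => g x * h_ n x) _ (M1 * M)) => // [n x|x].
  by rewrite cmM; apply: ler_pM; rewrite ?cm_ge0.
rewrite (_ : (fun n => _) = (fun n => cm (g x) * cm (h_ n x - h x))); last first.
  by apply/funext => n; rewrite -cmM mulrBr.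
rewrite -(mulr0 (cm (g x))); apply: cvgM; [exact: cvg_cst | exact: c].
Qed.

Lemma gen_mul S g h : (forall u, S u -> bm u) ->
  (forall u v, S u -> S v -> gen S (fun x => u x * v x)) ->
  gen S g -> gen S h -> gen S (fun x => g x * h x).
Proof.
move=> Sb SS gg gh.
have st u : S u -> gen S (fun x => u x * h x).
  move=> Su; apply: (gh (fun h => gen S (fun x => u x * h x))).
    by apply: bclass_mul; [exact: gen_bclass | exact: Sb].
  by move=> v Sv; exact: SS.
under eq_fun do rewrite mulrC.
apply: (gg (fun g => gen S (fun x => h x * g x))).
  by apply: bclass_mul; [exact: gen_bclass | exact: gen_bm gh].
by move=> u /st; under eq_fun do rewrite mulrC.
Qed.

Lemma genD S g h : gen S g -> gen S h -> gen S (fun x => g x + h x).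
Proof.
move=> h1 h2; have := (gen_bclass S).1 1 _ _ h1 h2.
by under eq_fun do rewrite mul1r.
Qed.
Lemma gen0 S g : gen S g -> gen S (fun=> 0).
Proof.
move=> h1; have := (gen_bclass S).1 (-1) _ _ h1 h1.
by under eq_fun do rewrite mulN1r addNr.
Qed.
Lemma genZ S (a : R[i]) g : gen S g -> gen S (fun x => a * g x).
Proof.
move=> h1; have := (gen_bclass S).1 a _ _ h1 (gen0 h1).
by under eq_fun do rewrite addr0.
Qed.

End bclass.

(** * Exponentials of positive frequency *)

Section expi.
Context {R : realType}.
Implicit Types g h : R -> R[i].

Lemma expi0 : expi 0 = 1 :> R[i].
Proof. by rewrite /expi cos0 sin0. Qed.

Lemma expiD (s t : R) : expi (s + t) = expi s * expi t.
Proof. by apply: complexP; rewrite ?cReM ?cImM /= ?cosD ?sinD //; ring. Qed.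

Lemma cm_expi (t : R) : cm (expi t) = 1.
Proof.
apply/eqP; rewrite -(@eqrXn2 _ 2) ?cm_ge0 // expr1n cm_sqr /=.
by rewrite cos2Dsin2.
Qed.

Lemma conj_expi (t : R) : Num.conj (expi t) = expi (- t).
Proof. by apply: complexP; rewrite ?cReC ?cImC /= ?cosN ?sinN. Qed.

Lemma expiN (t : R) : expi t * expi (- t) = 1.
Proof. by rewrite -expiD subrr expi0. Qed.

Lemma cvg_expi (u : nat -> R) (l : R) : u n @[n --> \oo] --> l ->
  cm (expi (u n) - expi l) @[n --> \oo] --> 0.
Proof.
move=> ul; apply: cm_cvgP => /=.
  by apply: cvg_comp ul _; exact: continuous_cos.
by apply: cvg_comp ul _; exact: continuous_sin.
Qed.

Lemma bm_expi (p : R -> R) : continuous p -> bm (fun x => expi (p x)).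
Proof.
move=> cp; split; last by exists 1 => x; rewrite cm_expi.
split; apply: continuous_measurable_fun => x /=.
  by apply: continuous_comp; [exact: cp | exact: continuous_cos].
by apply: continuous_comp; [exact: cp | exact: continuous_sin].
Qed.

(** The exponentials of U_s for s > 0; the generators of E_+ are the products of
    these with constants. *)
Definition eS g := exists2 s : R, 0 < s & g = fun x => expi (- (s * x)).

Lemma eS_bm g : eS g -> bm g.
Proof.
move=> [s _ ->]; apply: bm_expi => x; apply: cvgN.
by apply: cvgM; [exact: cvg_cst | exact: cvg_id].
Qed.

Lemma eS_mul u v : eS u -> eS v -> gen eS (fun x => u x * v x).
Proof.
move=> [s s0 ->] [t t0 ->]; apply: gen_sub; exists (s + t); first exact: addr_gt0.
by apply/funext => x; rewrite -expiD mulrDl opprD.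
Qed.

Lemma geS_mul g h : gen eS g -> gen eS h -> gen eS (fun x => g x * h x).
Proof. apply: gen_mul; [exact: eS_bm | exact: eS_mul]. Qed.

Lemma geS_e (s : R) : 0 <= s -> gen eS (fun x => expi (- (s * x))).
Proof.
move=> s0.
apply: ((gen_bclass eS).2 (fun n x => expi (- ((s + n.+1%:R^-1) * x))) _ 1).
- move=> n; apply: gen_sub; exists (s + n.+1%:R^-1) => //.
  by rewrite ltr_wpDl // invr_gt0.
- by move=> n x; rewrite cm_expi.
move=> x; apply: cvg_expi; apply: cvgN.
apply: cvgM; last exact: cvg_cst.
rewrite -[X in _ --> X]addr0; apply: cvgD; [exact: cvg_cst | exact: cvg_harmonic].
Qed.

Lemma geS1 : gen eS (fun=> 1).
Proof.
have := geS_e (lexx 0).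
by under eq_fun do rewrite mul0r oppr0 expi0.
Qed.

(** The ratio of the geometric series given by the Riemann sums, of mesh d, of the
    integral of exp(-t (1 + i x)) over t > 0. *)
Definition qh (d x : R) : R[i] := (expR (- d))%:C * expi (- (d * x)).
Definition ah (d x : R) : R[i] := qh d x / (1 - qh d x).

Lemma cm_qh d x : cm (qh d x) = expR (- d).
Proof. by rewrite /qh cmM cm_expi mulr1 cmR ger0_norm // expR_ge0. Qed.

Lemma cm1Bqh d x : 1 - expR (- d) <= cm (1 - qh d x).
Proof.
have := cmD (1 - qh d x) (qh d x); rewrite subrK cm1 cm_qh; lra.
Qed.

Lemma qh1_neq0 d x : 0 < d -> 1 - qh d x != 0.
Proof.
move=> d0; apply: contraTneq isT => e; have := cm1Bqh d x.
have : expR (- d) < 1 by rewrite expR_lt1 oppr_lt0.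
by rewrite e cm0; lra.
Qed.

Lemma cmV (a : R[i]) : cm a^-1 = (cm a)^-1.
Proof.
have [->|a0] := eqVneq a 0; first by rewrite invr0 cm0 invr0.
have ca : cm a != 0 by apply: contraNneq a0 => /cm_eq0 ->.
by apply: (mulfI ca); rewrite -cmM !divff // cm1.
Qed.

Lemma ah_bnd d x : 0 < d -> d * cm (ah d x) <= 1.
Proof.
move=> d0; rewrite /ah cmM cmV cm_qh.
have e1 : expR (- d) < 1 by rewrite expR_lt1 oppr_lt0.
have h := cm1Bqh d x.
have p : 0 < cm (1 - qh d x) by lra.
rewrite mulrA ler_pdivrMr // mul1r; apply: le_trans h.
have := expR_ge1Dx d; have := expR_gt0 (- d).
have : expR (- d) * expR d = 1 by rewrite -expRD addNr expR0.
by move: (expR (- d)) (expR d) => a b; nra.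
Qed.

(** Partial sums of a geometric series of ratio qh d x, of modulus
    exp(-d) < 1. *)
Lemma geS_ah d : 0 < d -> gen eS (ah d).
Proof.
move=> d0.
have gq : gen eS (qh d) by apply: genZ; apply: gen_sub; exists d.
pose a := fix a n x : R[i] := if n is n'.+1 then qh d x * (1 + a n' x) else 0.
have ga n : gen eS (a n).
  elim: n => [|n IH] /=; first exact: gen0 geS1.
  by apply: geS_mul => //; apply: genD => //; exact: geS1.
have rec x : ah d x = qh d x * (1 + ah d x).
  by rewrite /ah; field; exact: qh1_neq0.
have diff n x : a n x - ah d x = - (qh d x ^+ n * ah d x).
  elim: n => [|n IH] /=; first by rewrite sub0r expr0 mul1r.
  by rewrite {1}rec -mulrBr opprD addrACA subrr add0r IH exprS; ring.
have cd n x : cm (a n x - ah d x) = expR (- d) ^+ n * cm (ah d x).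
  rewrite diff cmN cmM; congr (_ * _); rewrite -(cm_qh d x).
  by elim: n => [|n IH]; rewrite ?expr0 ?cm1 // !exprS cmM IH.
have e1 : expR (- d) < 1 by rewrite expR_lt1 oppr_lt0.
have bd x : cm (ah d x) <= d^-1.
  by rewrite -(ler_pM2l d0) divff ?gt_eqF // ah_bnd.
apply: ((gen_bclass eS).2 a _ (2 * d^-1)) => // [n x|x].
  have := cmD (a n x - ah d x) (ah d x); rewrite subrK cd => h.
  apply: le_trans h _; have := bd x; have := cm_ge0 (ah d x).
  have : expR (- d) ^+ n <= 1 by rewrite exprn_ile1 ?expR_ge0 // ltW.
  have := exprn_ge0 n (expR_ge0 (- d)).
  by move: (_ ^+ n) (cm _) => p q; nra.
under eq_fun do rewrite cd.
rewrite -(mul0r (cm (ah d x))); apply: cvgM; last exact: cvg_cst.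
by apply: cvg_expr; rewrite ger0_norm ?expR_ge0.
Qed.

Lemma deriv_seq (f : R -> R) (l : R) : is_derive (0 : R) 1 f l ->
  (n.+1%:R^-1)^-1 * (f n.+1%:R^-1 - f 0) @[n --> \oo] --> l.
Proof.
move=> [df <-].
have /cvgr_dnbhsP/(_ (fun n => n.+1%:R^-1)) h : h^-1 *: ((f \o shift 0) (h *: 1) - f 0) @[h --> (0 : R)^'] --> 'D_1 f 0.
  exact: df.
have {}h := h (conj (fun n => _) (@cvg_harmonic R)).
rewrite (_ : (fun n => _) = (fun n : nat => (n.+1%:R^-1)^-1 *: 
  ((f \o shift 0) ((n.+1%:R^-1 : R) *: 1) - f 0))).
  by apply: h => n; rewrite invr_eq0.
by apply/funext => n /=; rewrite addr0 -[_%:A]/(_ * 1) mulr1.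
Qed.

(** The function 1 / (1 + i x). *)
Definition rr (x : R) : R[i] := wt x +i* (- (x * wt x)).

Lemma rrE x : rr x * (1 +i* x) = 1.
Proof.
have p : 1 + x ^+ 2 != 0 by rewrite gt_eqF // ltr_pwDl ?sqr_ge0.
apply: complexP; rewrite ?cReM ?cImM /= /wt; last by ring.
by field.
Qed.

(** 1 / (1 + i x) is the integral of exp(-t (1 + i x)) over t > 0, hence the limit of
    the Riemann sums d * ah d, bounded by 1. *)
Lemma geS_rr : gen eS rr.
Proof.
pose d n : R := n.+1%:R^-1.
have d0 n : 0 < d n by rewrite invr_gt0.
apply: ((gen_bclass eS).2 (fun n x => (d n)%:C * ah (d n) x) _ 1).
- by move=> n; apply: genZ; exact: geS_ah.
- by move=> n x; rewrite cmM cmR ger0_norm ?ah_bnd // ltW.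
move=> x.
pose D n : R[i] := (d n)^-1%:C * ((expR (d n))%:C * expi (d n * x) - 1).
have DE n : D n * ((d n)%:C * ah (d n) x) = 1.
  have h := qh1_neq0 x (d0 n).
  have e : ((expR (d n))%:C * expi (d n * x)) * qh (d n) x = 1.
    rewrite /qh mulrACA expiN mulr1 -rmorphM -expRD subrr expR0 //.
  have dd : (d n)^-1%:C * (d n)%:C = 1 :> R[i].
    by rewrite -rmorphM mulVf ?gt_eqF.
  rewrite /D mulrACA dd mul1r /ah mulrA mulrBl e mul1r divff //.
have Dc : cm (D n - (1 +i* x)) @[n --> \oo] --> 0.
  have d1 : is_derive (0 : R) 1 (fun t => expR t * cos (t * x)) 1.
    rewrite (_ : (fun t => _) = expR * (cos \o ( x *: id))); last first.
      by apply/funext => t /=; rewrite [t * x]mulrC.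
    apply: is_derive_eq => /=.
    rewrite -[(x *: id) 0]/(x * 0) mulr0 cos0 sin0 expR0.
    by rewrite !scale1r oppr0 mul0r add0r.
  have d2 : is_derive (0 : R) 1 (fun t => expR t * sin (t * x)) x.
    rewrite (_ : (fun t => _) = expR * (sin \o ( x *: id))); last first.
      by apply/funext => t /=; rewrite [t * x]mulrC.
    apply: is_derive_eq => /=.
    rewrite -[(x *: id) 0]/(x * 0) mulr0 cos0 sin0 expR0.
    by rewrite scale1r mul1r scale0r addr0 -[_%:A]/(_ * 1) mulr1.
  apply: cm_cvgP.
    have := deriv_seq d1; rewrite expR0 mul0r cos0 mul1r.
    rewrite (_ : (fun n => complex.Re (D n)) = (fun n : nat => (n.+1%:R^-1)^-1 *
      (expR n.+1%:R^-1 * cos (n.+1%:R^-1 * x) - 1))) //.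
    by apply/funext => n; rewrite /D cReM cReD cReM /=; ring.
  have := deriv_seq d2; rewrite expR0 mul0r sin0 mul1r.
  rewrite (_ : (fun n => complex.Im (D n)) = (fun n : nat => (n.+1%:R^-1)^-1 *
    (expR n.+1%:R^-1 * sin (n.+1%:R^-1 * x) - 0))) //.
  by apply/funext => n; rewrite /D cImM cImD cImM /=; ring.
apply: (@squeeze_cvgr _ _ _ _ (fun=> 0) (fun n => cm (D n - (1 +i* x)))).
- near=> n; rewrite cm_ge0 /=.
  have -> : (d n)%:C * ah (d n) x - rr x =
    - (((d n)%:C * ah (d n) x) * rr x * (D n - (1 +i* x))).
    have e1 : (d n)%:C * ah (d n) x * rr x * D n = rr x.
      by rewrite mulrAC [X in X * _]mulrC DE mul1r.
    by rewrite mulrBr e1 -[_ * _ * (1 +i* x)]mulrA rrE mulr1 opprB.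
  rewrite cmN cmM -[leRHS]mul1r ler_wpM2r ?cm_ge0 // cmM.
  have b1 : cm ((d n)%:C * ah (d n) x) <= 1.
    by rewrite cmM cmR ger0_norm ?ah_bnd // ltW.
  have b2 : cm (rr x) <= 1.
    have := congr1 cm (rrE x); rewrite cmM cm1 => e.
    have c1 : 1 <= cm (1 +i* x) by have := cm_Re (1 +i* x); rewrite /= normr1.
    by have := cm_ge0 (rr x); nra.
  have := cm_ge0 (rr x); have := cm_ge0 ((d n)%:C * ah (d n) x); nra.
- exact: cvg_cst.
- exact: Dc.
Unshelve. all: by end_near. Qed.

End expi.

(** * Powers of the Cayley transform *)

Section cayley.
Context {R : realType}.
Implicit Types g h : R -> R[i].

(** The n-th power of z = (1 - i x) / (1 + i x) = exp(-2 i atan x). *)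
Definition cayley (n : int) (x : R) : R[i] := expi (- (2 * n%:~R * atan x)).

Lemma cayley0 x : cayley 0 x = 1.
Proof. by rewrite /cayley mulr0 mul0r oppr0 expi0. Qed.

Lemma cayleyD m n x : cayley (m + n) x = cayley m x * cayley n x.
Proof. by rewrite /cayley -expiD intrD; congr expi; ring. Qed.

Lemma conj_cayley n x : Num.conj (cayley n x) = cayley (- n) x.
Proof. by rewrite /cayley conj_expi intrN; congr expi; ring. Qed.

Lemma cm_cayley n x : cm (cayley n x) = 1. Proof. exact: cm_expi. Qed.

Lemma bm_cayley n : bm (cayley n).
Proof.
apply: bm_expi => x; apply: cvgN; apply: cvgM; first exact: cvg_cst.
exact: continuous_atan.
Qed.

Lemma cos2_atan (x : R) : cos (atan x) ^+ 2 = wt x.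
Proof.
have p : 0 < 1 + x ^+ 2 by rewrite ltr_pwDl ?sqr_ge0.
by rewrite cos_atan exprVn sqr_sqrtr // ltW.
Qed.

Lemma cos_atan_gt0 (x : R) : 0 < cos (atan x).
Proof.
have p : 0 < 1 + x ^+ 2 by rewrite ltr_pwDl ?sqr_ge0.
by rewrite cos_atan invr_gt0 sqrtr_gt0.
Qed.

Lemma sin_atan (x : R) : sin (atan x) = x * cos (atan x).
Proof.
have := atanK x; rewrite /tan => e; rewrite -{2}e divfK //.
by rewrite gt_eqF // cos_atan_gt0.
Qed.

Lemma cayley1 x : cayley 1 x = 2%:C * rr x - 1.
Proof.
have e : 2 * 1 * atan x = atan x *+ 2 by rewrite mulr1 mulr_natl.
apply: complexP; rewrite ?cReD ?cReN ?cReM ?cImD ?cImN ?cImM /= e.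
  by rewrite cosN cos_mulr2n cos2_atan mulr2n; ring.
rewrite sinN sin_mulr2n sin_atan mulrCA -expr2 cos2_atan mulr2n; ring.
Qed.

Lemma cayley1_wt x : cayley 1 x * (wt x)%:C = rr x * rr x.
Proof.
have p : 1 + x ^+ 2 != 0 by rewrite gt_eqF // ltr_pwDl ?sqr_ge0.
rewrite cayley1; apply: complexP;
  rewrite ?cReM ?cReD ?cReN ?cReM ?cImM ?cImD ?cImN ?cImM /=; rewrite /wt; by field.
Qed.

(** z = 2 / (1 + i x) - 1. *)
Lemma geS_cayley (n : nat) : gen eS (cayley n%:Z).
Proof.
elim: n => [|n IH].
  rewrite (_ : cayley _ = fun=> 1); first exact: geS1.
  by apply/funext => x; rewrite cayley0.
rewrite (_ : cayley _ = fun x => cayley 1 x * cayley n%:Z x); last first.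
  by apply/funext => x; rewrite -cayleyD -intS.
apply: geS_mul => //.
rewrite (_ : cayley 1 = fun x => 2%:C * rr x + (-1) * 1); last first.
  by apply/funext => x; rewrite cayley1 mulN1r.
by apply: genD; apply: genZ; [exact: geS_rr | exact: geS1].
Qed.

(** z / (1 + x^2) = (1 + i x)^-2, a product of two elements of the class. *)
Lemma geS_kernel (n : nat) : gen eS (fun x => cayley n.+1%:Z x * (wt x)%:C).
Proof.
rewrite (_ : (fun x => _) = fun x => cayley n%:Z x * (rr x * rr x)).
  by apply: geS_mul; [exact: geS_cayley | apply: geS_mul; exact: geS_rr].
by apply/funext => x; rewrite -cayley1_wt mulrA -cayleyD addrC -intS.
Qed.

Definition zS g := exists n, g = cayley n.

Lemma zS_mul g h : gen zS g -> gen zS h -> gen zS (fun x => g x * h x).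
Proof.
apply: gen_mul; first by move=> u [n ->]; exact: bm_cayley.
move=> u v [m ->] [n ->]; apply: gen_sub; exists (m + n).
by apply/funext => x; rewrite cayleyD.
Qed.

(** Real functions in the bounded pointwise closure of the trigonometric
    polynomials in z. *)
Definition gz (u : R -> R) := gen zS (fun x => (u x)%:C).

Lemma gzM u v : gz u -> gz v -> gz (fun x => u x * v x).
Proof.
move=> h1 h2; have := zS_mul h1 h2.
by rewrite /gz; under [in X in _ -> X]eq_fun do rewrite rmorphM.
Qed.
Lemma gzD u v : gz u -> gz v -> gz (fun x => u x + v x).
Proof.
move=> h1 h2; have := genD h1 h2.
by rewrite /gz; under [in X in _ -> X]eq_fun do rewrite rmorphD.
Qed.
Lemma gzZ (a : R) u : gz u -> gz (fun x => a * u x).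
Proof.
move=> h1; have := genZ a%:C h1.
by rewrite /gz; under [in X in _ -> X]eq_fun do rewrite rmorphM.
Qed.
Lemma gz1 : gz (fun=> 1).
Proof.
apply: gen_sub; exists 0; apply/funext => x; by rewrite cayley0.
Qed.
Lemma gz_lim (u_ : nat -> R -> R) u (M : R) : (forall n, gz (u_ n)) ->
  (forall n x, `|u_ n x| <= M) -> (forall x, u_ n x @[n --> \oo] --> u x) -> gz u.
Proof.
move=> gu b c; apply: ((gen_bclass zS).2 (fun n x => (u_ n x)%:C) _ M) => //.
  by move=> n x; rewrite cmR.
move=> x; apply: cm_cvgP => /=; first exact: c.
exact: cvg_cst.
Qed.

Lemma gz_ext u v : (forall x, u x = v x) -> gz u -> gz v.
Proof. by move=> /funext ->. Qed.

Lemma gz_wt : gz wt.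
Proof.
have h : gen zS (fun x => 2^-1%:C * 1 + 4^-1%:C * (cayley 1 x + cayley (-1) x)).
  apply: genD; apply: genZ; first exact: gz1.
  by apply: genD; apply: gen_sub; [exists 1 | exists (-1)].
rewrite /gz (_ : (fun x => _) = (fun x => 2^-1%:C * 1 + 4^-1%:C * (cayley 1 x + cayley (-1) x))) //.
apply/funext => x; rewrite -conj_cayley cayley1.
apply: complexP;
  rewrite ?cReD ?cReM ?cReD ?cReC ?cReD ?cReN ?cReM ?cImD ?cImM ?cImD ?cImC ?cImD ?cImN ?cImM /=.
  by field.
by ring.
Qed.

Lemma gz_xwt : gz (fun x => x * wt x).
Proof.
have h : gen zS (fun x => (0 +i* 4^-1) * (cayley 1 x + (-1) * cayley (-1) x)).
  apply: genZ; apply: genD; first by apply: gen_sub; exists 1.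
  by apply: genZ; apply: gen_sub; exists (-1).
rewrite /gz (_ : (fun x => _) = (fun x => (0 +i* 4^-1) * (cayley 1 x + (-1) * cayley (-1) x))) //.
apply/funext => x; rewrite -conj_cayley cayley1 mulN1r.
apply: complexP;
  rewrite ?cReM ?cReD ?cReN ?cReC ?cReD ?cReN ?cReM ?cImM ?cImD ?cImN ?cImC ?cImD ?cImN ?cImM /=.
  by field.
by ring.
Qed.

(** Newton's iteration for the sign: a polynomial map with fixed points -1, 0, 1
    of which 1 attracts ]0, 1]. *)
Definition pstep (u : R) : R := (3 * u - u ^+ 3) / 2.

Lemma pstep_bnd u : `|u| <= 1 -> `|pstep u| <= 1.
Proof.
rewrite !ler_norml /pstep => /andP[h1 h2]; apply/andP; split.
  have := mulr_ge0 (sqr_ge0 (u + 1)) (_ : 0 <= 2 - u); rewrite subr_ge0.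
  move=> /(_ (le_trans h2 _)) h; have := h _; nra.
have := mulr_ge0 (sqr_ge0 (1 - u)) (_ : 0 <= 2 + u).
nra.
Qed.

Lemma pstepN u : pstep (- u) = - pstep u.
Proof. by rewrite /pstep; field. Qed.

Lemma iter_pstepN n u : iter n pstep (- u) = - iter n pstep u.
Proof. by elim: n => //= n ->; rewrite pstepN. Qed.

Lemma iter_pstep0 n : iter n pstep 0 = 0.
Proof. by elim: n => //= n ->; rewrite /pstep mulr0 expr0n subrr mul0r. Qed.

Lemma pstep_cvg_pos u : 0 < u -> u <= 1 -> iter n pstep u @[n --> \oo] --> (1 : R).
Proof.
move=> u0 u1; pose q := (1 - u) * (2 + u) / 2.
have q0 : 0 <= q by rewrite /q; nra.
have q1 : q < 1 by rewrite /q; nra.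
have st n : u <= iter n pstep u <= 1 /\ 1 - iter n pstep u <= q ^+ n.
  elim: n => [|n [/andP[l1 l2] IH]]; first by rewrite /= lexx u1 expr0; split => //; lra.
  rewrite iterS; move: (iter n pstep u) l1 l2 IH => a l1 l2 IH.
  have e : 1 - pstep a = (1 - a) * ((1 - a) * (2 + a) / 2) by rewrite /pstep; field.
  have b : (1 - a) * (2 + a) / 2 <= q by rewrite /q; nra.
  have b0 : 0 <= (1 - a) * (2 + a) / 2 by nra.
  split.
    apply/andP; split; last by have : 0 <= 1 - pstep a; [rewrite e; nra|lra].
    have : 1 - pstep a <= 1 - a; last by lra.
    rewrite e; nra.
  rewrite e exprSr; apply: ler_pM => //; lra.
apply: (@cvg_sub0 _ _ _ _ _ _ (fun=> (1 : R))); last exact: cvg_cst.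
apply/norm_cvg0P; apply: (@squeeze_cvgr _ _ _ _ (fun=> 0) (fun n => q ^+ n)).
- near=> n; rewrite normr_ge0 /= distrC; have [/andP[_ h1] h2] := st n.
  by rewrite ger0_norm // subr_ge0.
- exact: cvg_cst.
- by apply: cvg_expr; rewrite ger0_norm.
Unshelve. all: by end_near. Qed.

(** (x - a) / (1 + x^2) is, up to a positive factor, bounded by 1 and has the sign of x - a;
    iterate pstep on it. *)
Lemma gz_sg (a : R) : gz (fun x => Num.sg (x - a)).
Proof.
pose c := (1 + `|a|)^-1.
have a0 : 0 < 1 + `|a| by rewrite ltr_pwDl.
have c0 : 0 < c by rewrite invr_gt0.
pose u x := c * (x * wt x + (- a) * wt x).
have gu : gz u by apply: gzZ; apply: gzD; [exact: gz_xwt | apply: gzZ; exact: gz_wt].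
have ub x : `|u x| <= 1.
  rewrite /u normrM (ger0_norm (ltW c0)) /c ler_pdivrMl // mulr1.
  apply: le_trans (ler_normD _ _) _; apply: lerD; last first.
    have wt_le1 : wt x <= 1 by rewrite invf_le1 ?lerDl ?sqr_ge0 // ltr_pwDl ?sqr_ge0.
    by rewrite normrM normrN (ger0_norm (wt_ge0 x)) ler_piMr.
  have p : 0 < 1 + x ^+ 2 by rewrite ltr_pwDl ?sqr_ge0.
  rewrite normrM (ger0_norm (wt_ge0 x)) ler_pdivrMr // mul1r.
  by rewrite -(@real_normK _ x) ?num_real //; have := sqr_ge0 (`|x| - 1); nra.
apply: (@gz_lim (fun n x => iter n pstep (u x)) _ 1).
- elim => [|n IH] //=.
  apply: (@gz_ext (fun x => 2^-1 * (3 * iter n pstep (u x) + (-1) *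
    (iter n pstep (u x) * (iter n pstep (u x) * iter n pstep (u x)))))).
    by move=> x; rewrite /pstep; field.
  by apply: gzZ; apply: gzD; apply: gzZ => //; apply: gzM => //; exact: gzM.
- by elim => [|n IH] x //=; apply: pstep_bnd.
move=> x; have uE : u x = c * wt x * (x - a) by rewrite /u; ring.
have cw : 0 < c * wt x by rewrite mulr_gt0 // wt_gt0.
have [xa|xa|xa] := ltrgtP (x - a) 0.
- rewrite ltr0_sg //; have un : 0 < - u x by rewrite oppr_gt0 uE pmulr_rlt0.
  have := @pstep_cvg_pos (- u x) un _; move=> /(_ _) h.
  under eq_fun do rewrite -[u x]opprK iter_pstepN.
  apply: cvgN; apply: h; apply: le_trans (ub x); rewrite -normrN; exact: ler_norm.
- rewrite gtr0_sg //; apply: pstep_cvg_pos; first by rewrite uE mulr_gt0.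
  exact: le_trans (ler_norm _) (ub x).
- rewrite xa sgr0 uE xa mulr0; under eq_fun do rewrite iter_pstep0.
  exact: cvg_cst.
Qed.

(** The sets whose indicator is in the class form a sigma-algebra, which contains
    the open half-lines by gz_sg. *)
Lemma gz_Borel (B : set R) : measurable B -> gz (\1_B).
Proof.
move=> mB.
have gC B' : gz (\1_B') -> gz (\1_(~` B')).
  move=> h; apply: (@gz_ext (fun x => 1 + (-1) * \1_B' x)).
    move=> x; rewrite !indicE in_setC; case: (x \in B') => /=; ring.
  by apply: gzD; [exact: gz1 | exact: gzZ].
have gU (F : nat -> set R) : (forall n, gz (\1_(F n))) -> gz (\1_(\bigcup_n F n)).
  move=> gF.
  pose G n x : R := \prod_(i < n) (1 + (-1) * \1_(F i) x).
  have gG n : gz (G n).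
    elim: n => [|n IH].
      by apply: (gz_ext _ gz1) => x; rewrite /G big_ord0.
    apply: (@gz_ext (fun x => G n x * (1 + (-1) * \1_(F n) x))).
      by move=> x; rewrite /G big_ord_recr.
    by apply: gzM => //; apply: gzD; [exact: gz1 | exact: gzZ].
  have f01 i x : 1 + (-1) * \1_(F i) x = (x \notin F i)%:R :> R.
    by rewrite indicE; case: (x \in F i) => /=; ring.
  have Gc x : 1 + (-1) * G n x @[n --> \oo] --> (\1_(\bigcup_n F n) x : R).
    rewrite indicE; have [xF|xF] := pselect ((\bigcup_n F n) x).
      have [N _ FN] := xF; rewrite mem_set //.
      apply: cvg_near_cst; exists N.+1 => // n /= Nn.
      rewrite /G (bigD1 (Ordinal Nn)) //= f01 mem_set //= mul0r; ring.
    rewrite memNset //; apply: cvg_near_cst; exists 0%N => // n _.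
    rewrite /G big1 => [|i _]; first by rewrite mulr1 subrr.
    by rewrite f01 memNset //; apply: contra_not xF => ?; exists i.
  apply: (@gz_lim (fun n x => 1 + (-1) * G n x) _ 1) => //.
    by move=> n; apply: gzD; [exact: gz1 | exact: gzZ].
  move=> n x; have : 0 <= G n x <= 1.
    elim: n => [|n IH]; first by rewrite /G big_ord0 lexx ler01.
    move: IH; rewrite /G big_ord_recr /= f01 => /andP[h1 h2].
    by case: (x \notin F n); rewrite ?mulr1 ?mulr0 ?h1 // lexx ler01.
  by move=> /andP[h1 h2]; rewrite mulN1r ger0_norm; lra.
have : (@RGenOInfty.G R).-sigma.-measurable B.
  by rewrite -RGenOInfty.measurableE; exact: mB.
move=> /(_ [set B | gz (\1_B)]); apply; split.
  split.
  - apply: (@gz_ext (fun x => 1 + (-1) * 1)); first by move=> x; rewrite indicE in_set0 mulN1r subrr.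
    by apply: gzD; [exact: gz1 | apply: gzZ; exact: gz1].
  - by move=> B' /= h; rewrite setTD; exact: gC.
  - by move=> F /= h; exact: gU.
move=> _ [a ->] /=.
apply: (@gz_ext (fun x => 2^-1 * (Num.sg (x - a) + Num.sg (x - a) * Num.sg (x - a)))).
  move=> x; rewrite indicE; have [xa|xa|xa] := ltrgtP (x - a) 0.
  - rewrite ltr0_sg // memNset /=; first by field.
    by rewrite in_itv /= andbT; apply/negP; rewrite -leNgt; lra.
  - rewrite gtr0_sg // mem_set /=; first by field.
    by rewrite in_itv /= andbT; lra.
  - rewrite xa sgr0 memNset /=; first by ring.
    by rewrite in_itv /= andbT; apply/negP; rewrite -leNgt; lra.
by apply: gzZ; apply: gzD; [exact: gz_sg | apply: gzM; exact: gz_sg].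
Qed.

End cayley.

(** * Orthogonality of the Cayley powers *)

Section ftcline.
Context {R : realType}.
Local Notation mu := (@lebesgue_measure R).

(** The fundamental theorem of calculus on [-n, n], and dominated convergence. *)
Lemma FTC_line (F g : R -> R) (l l' : R) : (forall x : R, is_derive x 1 F (g x)) ->
  continuous g -> mu.-integrable setT (EFin \o g) ->
  F n%:R @[n --> \oo] --> l -> F (- n%:R) @[n --> \oo] --> l' ->
  \int[mu]_x g x = l - l'.
Proof.
move=> dF cg ig Fl Fl'.
pose D n : set R := `[- n%:R, n%:R]%classic.
have mD n : measurable (D n) by exact: measurable_itv.
have mg : measurable_fun setT g by exact: continuous_measurable_fun.
have cF : continuous F.
  by move=> x; apply: differentiable_continuous; apply/derivable1_diffP; case: (dF x).
have h1 n : (\int[mu]_(x in D n.+1) (g x)%:E = (F n.+1%:R - F (- n.+1%:R))%:E)%E.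
  rewrite (@continuous_FTC2 _ g F) -?EFinB //.
  - by rewrite gtrN.
  - exact: continuous_subspaceT.
  - split; [by move=> x _; case: (dF x) | | ].
      by apply: cvg_at_right_filter; exact: cF.
    by apply: cvg_at_left_filter; exact: cF.
  - by move=> x _; rewrite derive1E; case: (dF x).
have e n : (\int[mu]_x (g x * \1_(D n.+1) x)%:E)%E = (F n.+1%:R - F (- n.+1%:R))%:E.
  rewrite -h1 [RHS]integral_mkcond; apply: eq_integral => x _.
  by rewrite patchE indicE; case: ifP => _; rewrite ?mulr1 ?mulr0.
have m1 n : measurable_fun setT (fun x => (g x * \1_(D n.+1) x)%:E).
  apply/measurable_EFinP; apply: measurable_funM; first exact: mg.
  by apply: measurable_indic; exact: mD.
have c x : (g x * \1_(D n.+1) x)%:E @[n --> \oo] --> (g x)%:E.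
  apply: cvg_near_cst; exists (Num.bound `|x|) => // n /= hn.
  rewrite indicE mem_set ?mulr1 // /D /= in_itv /= -ler_norml.
  have := archi_boundP (normr_ge0 x) => /ltW /le_trans; apply.
  by rewrite ler_nat leqW.
have b n x : (`|(g x * \1_(D n.+1) x)%:E| <= `|(g x)%:E|)%E.
  rewrite lee_fin normrM ler_piMr // indicE.
  by case: (x \in _); rewrite ?normr1 ?normr0.
have [||_ _ h2] := @dominated_convergence _ _ _ mu setT measurableT
  (fun n x => (g x * \1_(D n.+1) x)%:E) (EFin \o g) (fun x => `|(g x)%:E|%E)
  m1 ((measurable_EFinP _ _).2 mg) _ (integrable_abse ig) _.
- exact: aeW.
- by apply: aeW => x n _.
have {}h2 : (F n.+1%:R - F (- n.+1%:R))%:E @[n --> \oo] --> (\int[mu]_x (g x)%:E)%E.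
  by under eq_fun do rewrite -e; exact: h2.
have h3 : F n.+1%:R - F (- n.+1%:R) @[n --> \oo] --> l - l'.
  by apply: cvgB; [have := Fl|have := Fl']; rewrite -(cvg_shiftn 1) //; under eq_fun do rewrite addn1.
have fn : (\int[mu]_x (g x)%:E)%E \is a fin_num by exact: integrable_fin_num ig.
rewrite -(fineK fn) in h2; have h4 : F n.+1%:R - F (- n.+1%:R) @[n --> \oo] --> fine (\int[mu]_x (g x)%:E)%E.
  exact: fine_cvg h2.
rewrite /Rintegral; exact: (@cvg_unique _ (@Rhausdorff R) _ _ _ _ h4 h3).
Qed.

End ftcline.

Section orth.
Context {R : realType}.
Local Notation mu := (@lebesgue_measure R).

Lemma sin_npi n : sin (n%:R * pi : R) = 0.
Proof.
elim: n => [|n IH]; first by rewrite mul0r sin0.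
by rewrite -natr1 mulrDl mul1r sinDpi IH oppr0.
Qed.

Lemma bm_cint_wt (g : R -> R[i]) : bm g -> cint (fun x => g x * (wt x)%:C).
Proof.
move=> [mg [M gM]]; have M0 : 0 <= M by apply: le_trans (gM 0); exact: cm_ge0.
apply: kern_cint; split.
  by apply: cmeasM => //; apply: cmeas_R; exact: wt_meas.
exists M => // x; rewrite cmM cmR (ger0_norm (wt_ge0 x)).
by rewrite ler_wpM2r ?wt_ge0.
Qed.

Lemma atan_nat : atan n%:R @[n --> \oo] --> (pi / 2 : R).
Proof. exact: (cvg_comp _ _ (@cvgr_idn R) (@cvgy_atan R)). Qed.

Lemma atan_natN : atan (- n%:R) @[n --> \oo] --> (- (pi / 2) : R).
Proof. by under eq_fun do rewrite atanN; apply: cvgN; exact: atan_nat. Qed.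

Lemma cayley_orth_nat (n : nat) : cintegral (fun x : R => cayley n.+1%:Z x * (wt x)%:C) = 0.
Proof.
set k : R := 2 * n.+1%:R.
have k0 : k != 0 by rewrite mulf_neq0 ?pnatr_eq0.
have hc := bm_cint_wt (bm_cayley (R := R) n.+1%:Z).
have cat c : continuous (fun x : R => c * atan x).
  by move=> x; apply: cvgM; [exact: cvg_cst | exact: continuous_atan].
have Re_cayley x : complex.Re (cayley n.+1%:Z x * (wt x)%:C) = cos (k * atan x) * wt x.
  by rewrite cReM /= mulr0 subr0 cosN.
have Im_cayley x : complex.Im (cayley n.+1%:Z x * (wt x)%:C) = - sin (k * atan x) * wt x.
  by rewrite cImM /= mulr0 add0r sinN.
have katan (s : R) : sin (k * (s * (pi / 2))) = 0 -> sin (k * (s * (pi / 2))) = 0 by [].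
have slim (u : nat -> R) (l : R) : u m @[m --> \oo] --> l ->
   sin (k * u m) @[m --> \oo] --> sin (k * l).
  move=> ul; apply: (cvg_comp (fun m => k * u m) sin); last exact: continuous_sin.
  by apply: cvgM; [exact: cvg_cst|].
have clim (u : nat -> R) (l : R) : u m @[m --> \oo] --> l ->
   cos (k * u m) @[m --> \oo] --> cos (k * l).
  move=> ul; apply: (cvg_comp (fun m => k * u m) cos); last exact: continuous_cos.
  by apply: cvgM; [exact: cvg_cst|].
have kp : k * (pi / 2) = n.+1%:R * pi by rewrite /k; move: (@pi R) => p; field.
apply: complexP.
  transitivity (\int[mu]_x (cos (k * atan x) * wt x)).
    by apply: eq_Rintegral => x _; exact: Re_cayley.
  have dF (x : R) : is_derive x 1 (fun x => k^-1 * sin (k * atan x)) (cos (k * atan x) * wt x).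
    rewrite (_ : (fun x => _) = k^-1 *: (sin \o (k *: @atan R))) //.
    apply: is_derive_eq; rewrite /wt /=.
    rewrite -[(k *: _) x]/(k * atan x) -![_ *: _]/(_ * _).
    by field; rewrite gt_eqF // ltr_pwDl ?sqr_ge0.
  rewrite (@FTC_line _ _ _ 0 0 dF) ?subr0 //.
  - move=> x; apply: cvgM; last exact: wt_cont.
    by apply: continuous_comp; [exact: cat | exact: continuous_cos].
  - have := cint_Re hc; rewrite (_ : (fun x => complex.Re _) = (fun x => cos (k * atan x) * wt x)) //.
    by apply/funext => x; exact: Re_cayley.
  - rewrite -(mulr0 k^-1); apply: cvgM; first exact: cvg_cst.
    by rewrite -(sin_npi n.+1) -kp; apply: slim; exact: atan_nat.
  - rewrite -(mulr0 k^-1); apply: cvgM; first exact: cvg_cst.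
    rewrite -oppr0 -(sin_npi n.+1) -kp -sinN -mulrN; apply: slim; exact: atan_natN.
transitivity (\int[mu]_x (- sin (k * atan x) * wt x)).
  by apply: eq_Rintegral => x _; exact: Im_cayley.
have dF (x : R) : is_derive x 1 (fun x => k^-1 * cos (k * atan x)) (- sin (k * atan x) * wt x).
  rewrite (_ : (fun x => _) = k^-1 *: (cos \o (k *: @atan R))) //.
  apply: is_derive_eq; rewrite /wt /=.
  rewrite -[(k *: _) x]/(k * atan x) -![_ *: _]/(_ * _).
  by field; rewrite gt_eqF // ltr_pwDl ?sqr_ge0.
rewrite (@FTC_line _ _ _ (k^-1 * cos (n.+1%:R * pi)) (k^-1 * cos (n.+1%:R * pi)) dF) ?subrr //.
- move=> x; apply: cvgM; last exact: wt_cont.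
  by apply: cvgN; apply: continuous_comp; [exact: cat | exact: continuous_sin].
- have := cint_Im hc; rewrite (_ : (fun x => complex.Im _) = (fun x => - sin (k * atan x) * wt x)) //.
  by apply/funext => x; exact: Im_cayley.
- apply: cvgM; first exact: cvg_cst.
  by rewrite -kp; apply: clim; exact: atan_nat.
- apply: cvgM; first exact: cvg_cst.
  by rewrite -kp -cosN -mulrN; apply: clim; exact: atan_natN.
Qed.

(** For n != 0, z^n w is the derivative of a multiple of exp(-2 i n atan x), which has
    the same limits at both ends of the line. *)
Lemma cayley_orth (n : int) : n != 0 -> cintegral (fun x : R => cayley n x * (wt x)%:C) = 0.
Proof.
case: n => [[|n]|n] // _; first exact: cayley_orth_nat.
rewrite NegzE -(conjC0 _) -(cayley_orth_nat n) -cintegral_conj; last first.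
  exact: bm_cint_wt (bm_cayley _).
congr cintegral; apply/funext => x; rewrite -conj_cayley.
by apply: complexP; rewrite !(cReM, cImM, cReC, cImC) /=; ring.
Qed.

End orth.

(** * Trigonometric approximation *)

Section approx.
Context {R : realType} {H : completeNormedModType R[i]}.
Variable ip : {dot H for Num.conj}.
Hypothesis hH : hilbert_norm ip.
Implicit Types f : R -> H.
Local Notation sm := (@strongly_measurable R H).
Local Notation mu := (@lebesgue_measure R).
Local Notation L2 := (@L2 R H).
Local Notation N2 := (@N2 R H).

Variable pj : H -> H.
Hypothesis pj_lc : forall (a : R[i]) u v, pj (a *: u + v) = a *: pj u + pj v.
Hypothesis pj_le : forall v, nm (pj v) <= nm v.
Hypothesis pj_idem : forall v, pj (pj v) = pj v.
(** The range of the idempotent pj, written as its fixed points. *)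
Definition inV v := pj v = v.

Lemma inV0 : inV 0.
Proof.
by have := pj_lc (-1) 0 0; rewrite /inV scaler0 addr0 scaleN1r addNr.
Qed.

Lemma inV_lc (a : R[i]) u v : inV u -> inV v -> inV (a *: u + v).
Proof. by rewrite /inV => hu hv; rewrite pj_lc hu hv. Qed.

(** Trigonometric polynomials in z with vector coefficients, stored as lists of
    frequencies and coefficients. *)
Definition tp (p : seq (int * H)) (x : R) : H := \sum_(q <- p) cayley q.1 x *: q.2.

Lemma tp_nil x : tp [::] x = 0. Proof. by rewrite /tp big_nil. Qed.
Lemma tp_cons q p x : tp (q :: p) x = cayley q.1 x *: q.2 + tp p x.
Proof. by rewrite /tp big_cons. Qed.
Lemma tp_cat p q x : tp (p ++ q) x = tp p x + tp q x.
Proof. by rewrite /tp big_cat. Qed.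

Definition allV (S : int -> bool) (p : seq (int * H)) :=
  forall q, q \in p -> S q.1 /\ inV q.2.

Lemma L2_cayley n v : L2 (fun x : R => cayley n x *: v).
Proof.
apply: (@L2_bounded _ _ _ (nm v)).
  by apply: sm_scale; [exact: (bm_cayley n).1 | exact: sm_cst].
by move=> x; rewrite nmZ cm_cayley mul1r.
Qed.

Lemma L2_tp p : L2 (tp p).
Proof.
elim: p => [|q p IH].
  by rewrite (_ : tp _ = fun=> 0 : H); [exact: L2_0 | apply/funext => x; rewrite tp_nil].
rewrite (_ : tp _ = fun x => 1 *: (cayley q.1 x *: q.2) + tp p x).
  by apply: L2_lc => //; exact: L2_cayley.
by apply/funext => x; rewrite tp_cons scale1r.
Qed.

(** Membership in the N2-closure of the trigonometric polynomials with
    frequencies in S and coefficients in the range of pj. *)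
Definition approximable (S : int -> bool) f :=
  forall e : R, 0 < e -> exists2 p, allV S p &
    (N2 (fun x => f x - tp p x)%R < e%:E)%E.

Lemma smB f (g : R -> H) : sm f -> sm g -> sm (fun x => f x - g x).
Proof.
move=> sf sg; have := sm_lc (-1) sg sf.
by under eq_fun do rewrite scaleN1r addrC.
Qed.

Lemma tp_scale (a : R[i]) p x :
  a *: tp p x = tp [seq (q.1, a *: q.2) | q <- p] x.
Proof.
elim: p => [|q p IH]; first by rewrite !tp_nil scaler0.
by rewrite map_cons !tp_cons scalerDr IH !scalerA mulrC.
Qed.

Lemma approximable_lc S (a : R[i]) f (g : R -> H) : sm f -> sm g -> approximable S f -> approximable S g ->
  approximable S (fun x => a *: f x + g x).
Proof.
move=> sf sg hf hg e e0.
have k0 : 0 < 2 * cm a ^+ 2 + 1 by rewrite ltr_wpDl // mulr_ge0 // sqr_ge0.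
have [|p pV hp] := hf (e / 2 / (2 * cm a ^+ 2 + 1)); first by rewrite !divr_gt0.
have [|q qV hq] := hg (e / 4); first by rewrite divr_gt0.
exists ([seq (q.1, a *: q.2) | q <- p] ++ q).
  move=> r; rewrite mem_cat => /orP[/mapP[r' /pV[h1 h2] ->]|/qV //].
  split => //=; have := inV_lc a h2 inV0; by rewrite addr0.
rewrite (_ : (fun x => _) = (fun x => a *: (f x - tp p x) + (g x - tp q x))); last first.
  by apply/funext => x; rewrite tp_cat -tp_scale scalerBr opprD addrACA.
have s1 := smB sf (L2_tp p).1; have s2 := smB sg (L2_tp q).1.
apply: le_lt_trans (N2_lc a s1 s2) _.
have f1 : N2 (fun x => f x - tp p x) \is a fin_num.
  by rewrite ge0_fin_numE ?N2_ge0 //; apply: lt_trans hp (ltry _).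
have f2 : N2 (fun x => g x - tp q x) \is a fin_num.
  by rewrite ge0_fin_numE ?N2_ge0 //; apply: lt_trans hq (ltry _).
move: hp hq; rewrite -(fineK f1) -(fineK f2) -!EFinM -EFinD !lte_fin.
rewrite ltr_pdivlMr // => h1 h2.
have := fine_ge0 (N2_ge0 (fun x => f x - tp p x)).
by move: (fine _) h1 (fine _) h2 => s h1 t h2 s0; nra.
Qed.

Lemma approximable_lim S (f_ : nat -> R -> H) f : (forall n, sm (f_ n)) -> sm f ->
  (forall n, approximable S (f_ n)) -> N2 (fun x => f_ n x - f x) @[n --> \oo] --> 0%E ->
  approximable S f.
Proof.
move=> sf_ sf hf cv e e0.
have [h1 _] := ev0P (fun n => N2_ge0 (fun x => f_ n x - f x)).
have [|N /(_ N (leqnn _)) hN] := h1 cv (e / 4); first by rewrite divr_gt0.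
have [|p pV hp] := hf N (e / 4); first by rewrite divr_gt0.
exists p => //.
rewrite (_ : (fun x => _) = (fun x => (-1) *: (f_ N x - f x) + (f_ N x - tp p x))); last first.
  by apply/funext => x; rewrite scaleN1r opprB addrA subrK.
have s1 := smB (sf_ N) sf; have s2 := smB (sf_ N) (L2_tp p).1.
apply: le_lt_trans (N2_lc (-1) s1 s2) _.
have f1 : N2 (fun x => f_ N x - f x) \is a fin_num.
  by rewrite ge0_fin_numE ?N2_ge0 //; apply: lt_trans hN (ltry _).
have f2 : N2 (fun x => f_ N x - tp p x) \is a fin_num.
  by rewrite ge0_fin_numE ?N2_ge0 //; apply: lt_trans hp (ltry _).
move: hN hp; rewrite cmN cm1 expr1n -(fineK f1) -(fineK f2) -!EFinM -EFinD !lte_fin.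
by move: (fine _) (fine _) => s t; lra.
Qed.

Lemma approximable_bclass S v : bclass (fun g => bm g /\ approximable S (fun x => g x *: v)).
Proof.
split => [a g h [bg ag] [bh ah]|g_ g M hg b c].
  split; first by exact: (bm_bclass.1 a).
  rewrite (_ : (fun x => _) = (fun x => a *: (g x *: v) + h x *: v)); last first.
    by apply/funext => x; rewrite scalerDl scalerA.
  by apply: approximable_lc => //; apply: sm_scale => //; first [exact: bg.1|exact: bh.1|exact: sm_cst].
have bg : bm g by apply: (bm_bclass.2 g_ g M) => // n; exact: (hg n).1.
split => //.
have s_ n : sm (fun x => g_ n x *: v) by apply: sm_scale; [exact: (hg n).1.1|exact: sm_cst].
have s : sm (fun x => g x *: v) by apply: sm_scale; [exact: bg.1|exact: sm_cst].
have gM x : cm (g x) <= M by apply: cm_lim (c x) => n.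
have Lc : L2 (fun _ : R => (2 * M)%:C *: v).
  by apply: (@L2_bounded _ _ _ (nm ((2 * M)%:C *: v))) => //; exact: sm_cst.
apply: (approximable_lim s_ s); first by move=> n; exact: (hg n).2.
apply: (N2_dct s_ s Lc) => [n x|x _].
  rewrite -scalerBl !nmZ; apply: ler_wpM2r; first exact: nm_ge0.
  rewrite cmR; apply: le_trans (ler_norm _); apply: le_trans (cmD _ _) _.
  by rewrite cmN mulr_natl mulr2n lerD.
apply/cvg_nm.
rewrite (_ : (fun n => _) = (fun n => cm (g_ n x - g x) * nm v)); last first.
  by apply/funext => n; rewrite -scalerBl nmZ.
by rewrite -(mul0r (nm v)); apply: cvgM; [exact: c | exact: cvg_cst].
Qed.

Lemma approximable_indic B v : measurable B -> inV v -> approximable xpredT (fun x => (\1_B x)%:C *: v).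
Proof.
move=> mB Vv.
have [] // := gz_Borel mB (approximable_bclass xpredT v).
move=> _ [n ->]; split; first exact: bm_cayley.
move=> e e0; exists [:: (n, v)].
  by move=> q; rewrite inE => /eqP ->.
rewrite (_ : (fun x => _) = (fun=> 0)); last first.
  by apply/funext => x; rewrite tp_cons tp_nil addr0 subrr.
by rewrite /N2 integral0_eq // => x _; rewrite nm0 expr0n mul0r.
Qed.

Lemma approximable_0 S : approximable S (fun=> 0).
Proof.
move=> e e0; exists [::] => //.
rewrite (_ : (fun x => _) = (fun=> 0)); last first.
  by apply/funext => x; rewrite tp_nil subrr.
by rewrite /N2 integral0_eq // => x _; rewrite nm0 expr0n mul0r.
Qed.

(** Simple functions are sums of indicators, covered by approximable_indic; the
    projection pj keeps approximating simple functions in its range. *)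
Lemma approximable_all f : L2 f -> (forall x, inV (f x)) -> approximable xpredT f.
Proof.
move=> Lf fV; have [s [hs cv]] := N2_simple Lf.
have pjB u v : pj (u - v) = pj u - pj v.
  by have := pj_lc (-1) v u; rewrite !scaleN1r addrC => ->; rewrite addrC.
have s1 n : sm (fun x => pj (s n x)) by apply: sm_simple; apply: tsimple_comp; exact: (hs n).1.
have L1 n : L2 (fun x => pj (s n x)).
  split=> //; apply: le_lt_trans (N2_le (k := 1) (s1 n) (hs n).2.1 _ _) _ => //.
    by move=> x; rewrite mul1r lerXn2r ?nnegrE ?nm_ge0.
  by rewrite mul1e; exact: (hs n).2.2.
apply: (approximable_lim s1 Lf.1).
  move=> n.
  have [] // := simple_ind (V := inV) (Pr := fun f => L2 f /\ approximable xpredT f) _ _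
    (tsimple_comp pj (hs n).1) (fun x => pj_idem (s n x)).
    by split; [exact: L2_0 | exact: approximable_0].
  move=> B v g mB Vv [Lg Ag].
  rewrite (_ : (fun x => _) = fun x => 1 *: ((\1_B x)%:C *: v) + g x); last first.
    by apply/funext => x; rewrite scale1r.
  have Li : L2 (fun x => (\1_B x)%:C *: v) by exact: L2_indic.
  by split; [exact: L2_lc | apply: approximable_lc => //; [exact: Li.1|exact: Lg.1|exact: approximable_indic]].
apply: (@squeeze_cvge _ _ _ _ (fun=> 0%E) _ (fun n => N2 (fun x => s n x - f x))) => //; last exact: cvg_cst.
near=> n; rewrite N2_ge0 /=.
rewrite -[leRHS]mul1e; apply: N2_le => //.
- by apply: smB => //; exact: Lf.1.
- by apply: smB; [exact: (hs n).2.1|exact: Lf.1].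
by move=> x; rewrite mul1r lerXn2r ?nnegrE ?nm_ge0 // -{1}(fV x) -pjB.
Unshelve. all: by end_near. Qed.

Section split.
Variable S : int -> bool.

Definition cayley_wt (n : int) (x : R) : R[i] := cayley n x * (wt x)%:C.

Lemma kern_cayley_wt n : kern (cayley_wt n).
Proof.
split; first by apply: cmeasM; [exact: (bm_cayley n).1|apply: cmeas_R; exact: wt_meas].
by exists 1 => // x; rewrite cmM cm_cayley cmR ger0_norm ?wt_ge0.
Qed.

Lemma pairing_cayley n m v w :
  pairing ip (cayley_wt (- n)) (fun x => cayley m x *: v) w = 
  (if m == n then pi%:C else 0) * cip ip v w.
Proof.
have c := bm_cint_wt (bm_cayley (R := R) (m - n)).
rewrite /pairing (_ : (fun x => _) = fun x => cip ip v w * (cayley (m - n) x * (wt x)%:C)).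
  rewrite cintegralZ // mulrC; congr (_ * _); case: eqP => [->|/eqP mn].
    rewrite subrr (_ : (fun x => _) = fun x : R => (wt x)%:C); last first.
      by apply/funext => x; rewrite cayley0 mul1r.
    apply: complexP => /=; first by rewrite /Rintegral wt_int.
    by rewrite /Rintegral integral0.
  by rewrite cayley_orth ?subr_eq0.
by apply/funext => x; rewrite ipZl /cayley_wt cayleyD; ring.
Qed.

Lemma pairing_tp n p w : ~~ S n -> (forall q, q \in p -> S q.1) ->
  pairing ip (cayley_wt (- n)) (tp p) w = 0.
Proof.
move=> Sn; elim: p => [|q p IH] hp.
  rewrite /pairing (_ : (fun x => _) = fun=> 0).
    by rewrite /cintegral /Rintegral /= integral0.
  by apply/funext => x; rewrite tp_nil ip0l mulr0.
rewrite (_ : tp _ = fun x => 1 *: (cayley q.1 x *: q.2) + tp p x); last first.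
  by apply/funext => x; rewrite tp_cons scale1r.
rewrite pairing_lc //; last 3 first.
- exact: kern_cayley_wt.
- exact: L2_cayley.
- exact: L2_tp.
rewrite IH => [|r rp]; last by apply: hp; rewrite inE rp orbT.
rewrite pairing_cayley ifF ?mul0r ?mulr0 ?addr0 //.
by apply/negP => /eqP qn; move: Sn; rewrite -qn hp // inE eqxx.
Qed.

Lemma cross_tp h q : L2 h -> 
  (forall n w, ~~ S n -> pairing ip (cayley_wt (- n)) h w = 0) ->
  (forall r, r \in q -> ~~ S r.1) ->
  cint (fun x => cip ip (h x) (tp q x) * (wt x)%:C) /\
  cintegral (fun x => cip ip (h x) (tp q x) * (wt x)%:C) = 0.
Proof.
move=> Lh hh; elim: q => [|r q IH] hq.
  rewrite (_ : (fun x => _) = fun x => 0 * (wt x)%:C); last first.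
    by apply/funext => x; rewrite tp_nil ip0r.
  have c0 := bm_cint_wt (bm_cayley (R := R) 0).
  rewrite (_ : (fun x => _) = fun x => 0 * (cayley 0 x * (wt x)%:C)); last first.
    by apply/funext => x; rewrite !mul0r.
  by split; [exact: cintZ|rewrite cintegralZ // mul0r].
have [|i1 i2] := IH; first by move=> r' rq; apply: hq; rewrite inE rq orbT.
have Sr : ~~ S r.1 by apply: hq; rewrite inE eqxx.
rewrite (_ : (fun x => _) = fun x => cayley_wt (- r.1) x * cip ip (h x) r.2 + 
    cip ip (h x) (tp q x) * (wt x)%:C); last first.
  apply/funext => x; rewrite tp_cons ipDr ipZr conj_cayley mulrDl /cayley_wt; congr (_ + _).
  by rewrite mulrAC.
have j1 := pairing_cint hH r.2 (kern_cayley_wt (- r.1)) Lh.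
split; first exact: cintD.
by rewrite cintegralD // i2 addr0; exact: hh.
Qed.

(** Pythagoras: |h|^2 = |h - g|^2 + 2 Re <h, g> - |g|^2, and the mixed term
    integrates to 0. *)
Lemma N2_orth h q : L2 h -> 
  (forall n w, ~~ S n -> pairing ip (cayley_wt (- n)) h w = 0) ->
  (forall r, r \in q -> ~~ S r.1) ->
  (N2 h <= N2 (fun x => h x - tp q x)%R)%E.
Proof.
move=> Lh hh hq; have [i1 i2] := cross_tp Lh hh hq.
have Ld := L2B Lh (L2_tp q).
have ii f : L2 f -> mu.-integrable setT (EFin \o (fun x => nm (f x) ^+ 2 * wt x)).
  move=> [sf lf]; apply/integrableP; split; first exact: N2_emeas.
  under eq_integral => x _ do rewrite gee0_abs ?N2_enn //.
  exact: lf.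
have N2R f : L2 f -> N2 f = (\int[mu]_x (nm (f x) ^+ 2 * wt x))%:E.
  by move=> lf; rewrite fineK //; exact: integrable_fin_num (ii f lf).
rewrite !N2R // lee_fin.
have re0 : \int[mu]_x complex.Re (cip ip (h x) (tp q x) * (wt x)%:C) = 0.
  by move: i2 => /(congr1 (@complex.Re R)).
have i3 := cint_Re i1.
have i4 : mu.-integrable setT
    (EFin \o (fun x => 2 * complex.Re (cip ip (h x) (tp q x) * (wt x)%:C))).
  rewrite (_ : _ \o _ = fun x => (2%:E * (complex.Re (cip ip (h x) (tp q x) * (wt x)%:C))%:E)%E) //.
  exact: integrableZl.
have -> : \int[mu]_x (nm (h x - tp q x) ^+ 2 * wt x) =
  \int[mu]_x (nm (h x - tp q x) ^+ 2 * wt x + 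
     2 * complex.Re (cip ip (h x) (tp q x) * (wt x)%:C)).
  rewrite RintegralD //; last exact: (ii _ Ld).
  by rewrite RintegralZl // re0 mulr0 addr0.
apply: le_Rintegral => //; first exact: (ii _ Lh).
  rewrite (_ : _ \o _ = (EFin \o (fun x => (nm (h x - tp q x) ^+ 2 * wt x))) \+
     (EFin \o (fun x => 2 * complex.Re (cip ip (h x) (tp q x) * (wt x)%:C)))) //.
  by apply: integrableD => //; exact: (ii _ Ld).
move=> x _; rewrite cReM /= mulr0 subr0 (nmB_sqr hH) -/(rip ip _ _).
have := sqr_ge0 (nm (tp q x)); have := wt_ge0 x.
by move: (nm (h x)) (nm (tp q x)) (rip _ _ _) (wt x) => a b c d d0 b0; nra.
Qed.

(** Approximate f by p and drop from p the frequencies outside S.  The remainder is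
    orthogonal to what was dropped, so that the error does not increase. *)
Lemma trig_split f : L2 f -> (forall x, inV (f x)) ->
  (forall n w, ~~ S n -> pairing ip (cayley_wt (- n)) f w = 0) -> approximable S f.
Proof.
move=> Lf fV hf e e0; have [p pV hp] := approximable_all Lf fV e0.
pose p1 := [seq q <- p | S q.1]; pose p2 := [seq q <- p | ~~ S q.1].
have p1S q : q \in p1 -> S q.1 by rewrite mem_filter => /andP[].
have p2S q : q \in p2 -> ~~ S q.1 by rewrite mem_filter => /andP[].
exists p1; first by move=> q; rewrite mem_filter => /andP[h /pV[]].
have E x : tp p x = tp p1 x + tp p2 x.
  rewrite /tp /p1 /p2 !big_filter [LHS](bigID (fun q => S q.1)) //.
have Lh : L2 (fun x => f x - tp p1 x) by apply: L2B => //; exact: L2_tp.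
apply: le_lt_trans (N2_orth Lh _ p2S) _.
  move=> n w Sn; rewrite pairingB ?hf //; last 2 first.
  - exact: kern_cayley_wt.
  - exact: L2_tp.
  by rewrite pairing_tp ?subr0.
rewrite (_ : (fun x => _) = (fun x => f x - tp p x)) //.
by apply/funext => x; rewrite E opprD addrA.
Qed.

End split.
End approx.

(** * Smooth functions of compact support *)

Section calculus.
Context {R : realType}.
Implicit Types u v : R -> R.

(** n-fold differentiability by existence of derivatives, which makes closure
    under products and inverses plain inductions. *)
Fixpoint Cn (n : nat) (u : R -> R) : Prop :=
  if n is m.+1 then exists2 v, (forall x : R, is_derive x 1 u (v x)) & Cn m v else True.

Definition Cinf u := forall n, Cn n u.

Lemma CnW n u : Cn n.+1 u -> Cn n u.
Proof.
elim: n u => [//|n IH] u [v uv hv]; exists v => //.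
exact: IH.
Qed.

Lemma derive1_fun u v : (forall x : R, is_derive x 1 u (v x)) -> derive1 u = v.
Proof.
by move=> uv; apply/funext => x; rewrite derive1E; have := uv x => d; rewrite derive_val.
Qed.

Lemma Cinf_derive u : Cinf u -> exists2 v, (forall x : R, is_derive x 1 u (v x)) & Cinf v.
Proof.
move=> h; have [v uv _] := h 1; exists v => // n.
have [v' uv' hv'] := h n.+1.
by rewrite -(derive1_fun uv) (derive1_fun uv').
Qed.

Lemma CinfP u : Cinf u <-> forall n x, derivable (derive1n n u) x 1.
Proof.
split.
  move=> h n; elim: n u h => [|n IH] u /Cinf_derive[v uv hv] x; first by have [] := uv x.
  by rewrite /derive1n iterSr (derive1_fun uv); exact: IH.
move=> h n; elim: n u h => [//|n IH] u h; exists (derive1 u) => [x|].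
  by rewrite derive1E; apply: DeriveDef => //; exact: (h 0).
by apply: IH => m x; have := h m.+1 x; rewrite /derive1n iterSr.
Qed.

Lemma CnD n u v : Cn n u -> Cn n v -> Cn n (fun x => u x + v x).
Proof.
elim: n u v => [//|n IH] u v [u' du hu] [v' dv hv].
exists (fun x => u' x + v' x); last exact: IH.
by move=> x; have := du x; have := dv x => h1 h2; exact: is_deriveD.
Qed.

Lemma Cn_cst n (c : R) : Cn n (fun=> c).
Proof.
elim: n c => [//|n IH] c; exists (fun=> 0); last exact: IH.
by move=> x; exact: is_derive_cst.
Qed.

Lemma Cn_id n : Cn n (fun x : R => x).
Proof.
case: n => [//|n]; exists (fun=> 1); last exact: Cn_cst.
by move=> x; exact: is_derive_id.
Qed.

Lemma CnM n u v : Cn n u -> Cn n v -> Cn n (fun x => u x * v x).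
Proof.
elim: n u v => [//|n IH] u v hu hv; have hu1 := CnW hu; have hv1 := CnW hv.
have [u' du hu'] := hu; have [v' dv hv'] := hv.
exists (fun x => u x * v' x + v x * u' x); last by apply: CnD; exact: IH.
by move=> x; have := du x; have := dv x => h1 h2; exact: is_deriveM.
Qed.

Lemma CnN n u : Cn n u -> Cn n (fun x => - u x).
Proof.
move=> h; rewrite (_ : (fun x => _) = (fun x => -1 * u x)).
  by apply: CnM => //; exact: Cn_cst.
by apply/funext => x; rewrite mulN1r.
Qed.

Lemma CnV n u : (forall x, u x != 0) -> Cn n u -> Cn n (fun x => (u x)^-1).
Proof.
move=> u0; elim: n => [//|n IH] hu; have hu1 := IH (CnW hu).
have [u' du hu'] := hu.
exists (fun x => - ((u x)^-1 * (u x)^-1) * u' x); last first.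
  by apply: CnM => //; apply: CnN; exact: CnM.
move=> x; have [d1 <-] := du x; split; first exact: derivableV.
by rewrite deriveV // /GRing.scale /= expr2 invfM.
Qed.

Lemma Cn_aff n (a b : R) u : Cn n u -> Cn n (fun x => u (a * x + b)).
Proof.
elim: n u => [//|n IH] u [u' du hu].
exists (fun x => a * u' (a * x + b)); last by apply: CnM; [exact: Cn_cst|exact: IH].
move=> x.
have h1 : is_derive x 1 (fun x : R => a * x + b) a.
  have := is_deriveD (is_deriveZ a (is_derive_id x (1 : R))) (is_derive_cst b x 1).
  by move=> h; apply: is_derive_eq h _; rewrite addr0 /GRing.scale /= mulr1.
have := du (a * x + b) => h2.
by have := @is_derive1_comp _ u (fun x => a * x + b) x (u' (a * x + b)) a h2 h1; rewrite mulrC.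
Qed.

(** The family x^-k exp(-1/x), closed under differentiation up to linear
    combinations; k = 0 is the usual flat function. *)
Definition flat (k : nat) (x : R) : R := if 0 < x then x^-1 ^+ k * expR (- x^-1) else 0.

(** With y = 1/x this says that y^(k+1) exp(-y) is bounded, which follows from
    exp(y) = exp(y / (k+1))^(k+1) and 1 + t <= exp(t). *)
Lemma flat_bnd k : exists2 C : R, 0 <= C & forall x : R, `|flat k x| <= C * `|x|.
Proof.
exists (k.+1%:R ^+ k.+1) => [|x]; first exact: exprn_ge0.
rewrite /flat; case: ifPn => x0; last first.
  by rewrite normr0 mulr_ge0 // exprn_ge0.
have y0 : 0 < x^-1 by rewrite invr_gt0.
rewrite ger0_norm ?mulr_ge0 ?exprn_ge0 ?expR_ge0 ?(ltW y0) // gtr0_norm //.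
rewrite -ler_pdivrMr //.
move: (x^-1) y0 => y y0.
rewrite mulrAC -exprSr expRN ler_pdivrMr ?expR_gt0 //.
have -> : expR y = expR (y / k.+1%:R) ^+ k.+1.
  by rewrite -expRM_natl mulrC divfK // pnatr_eq0.
rewrite -exprMn lerXn2r ?nnegrE ?mulr_ge0 ?expR_ge0 ?(ltW y0) //.
rewrite mulrC -ler_pdivrMr ?ltr0n //; apply: le_trans (expR_ge1Dx _).
by rewrite lerDr.
Qed.

(** At 0 the difference quotient of x^-k exp(-1/x) is x^-(k+1) exp(-1/x), which
    flat_bnd bounds by a multiple of |x|. *)
Lemma flat_derive k (x : R) :
  is_derive x 1 (flat k) (flat k.+2 x - k%:R * flat k.+1 x).
Proof.
have [x0|x0|->] := ltgtP x 0.
- apply: (@near_eq_is_derive _ _ _ (cst 0)); last first.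
    rewrite /flat ltNge (ltW x0) /= mulr0 subr0; exact: is_derive_cst.
  have : \forall y \near x, y < 0.
    have c : (y : R) @[y --> x] --> x by exact: cvg_id.
    exact: (@cvgr_lt _ _ _ _ _ _ c _ x0).
  by apply: filterS => y y0; rewrite /flat ltNge (ltW y0).
- apply: (@near_eq_is_derive _ _ _ (fun y : R => y^-1 ^+ k * expR (- y^-1))).
    have : \forall y \near x, 0 < y.
    have c : (y : R) @[y --> x] --> x by exact: cvg_id.
    exact: (@cvgr_gt _ _ _ _ _ _ c _ x0).
    by apply: filterS => y y0; rewrite /flat y0.
  have xn0 : x != 0 by rewrite gt_eqF.
  have dV : is_derive x 1 (fun y : R => y^-1) (- x^-1 ^+ 2).
    split; first exact: derivableV.
    by rewrite deriveV // derive_id /GRing.scale /= mulr1 exprVn.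
  have dN : is_derive x 1 (fun y : R => - y^-1) (x^-1 ^+ 2).
    by have := is_deriveN dV; rewrite opprK.
  have dE := @is_derive1_comp _ expR (fun y => - y^-1) x _ _ (is_derive_expR _) dN.
  have dX : is_derive x 1 (fun y : R => y^-1 ^+ k) (k%:R * x^-1 ^+ k.-1 * (- x^-1 ^+ 2)).
    rewrite (_ : (fun y => _) = (fun y : R => y^-1) ^+ k); last first.
      by apply/funext => y; elim: (k) => [|m IH]; rewrite ?expr0 // !exprS IH.
    exact: (is_deriveX k dV).
  have h := is_deriveM dX dE; apply: (@is_derive_eq _ _ _ _ _ _ _ _ h).
  rewrite /flat x0 /GRing.scale /=.
  move: (x^-1) (expR _) => y e; case: (k) => [|m] /=; first by rewrite !expr0 expr2; ring.
  by rewrite -mulr_natl !exprS; ring.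
have -> : flat k.+2 0 - k%:R * flat k.+1 0 = 0 by rewrite /flat ltxx mulr0 subr0.
have [C C0 hC] := flat_bnd k.+1.
have c : h^-1 *: (flat k (h *: 1 + 0) - flat k 0) @[h --> 0^'] --> (0 : R).
  apply/norm_cvg0P.
  have c2 : C * `|h| @[h --> (0 : R)^'] --> C * `|0 : R|.
    apply: cvgM; first exact: cvg_cst.
    have ci : (h : R) @[h --> (0 : R)^'] --> (0 : R) by exact: cvg_within.
    exact: (cvg_norm ci).
  rewrite normr0 mulr0 in c2.
  apply: squeeze_cvgr c2; last exact: cvg_cst.
  near=> h; rewrite normr_ge0 /=.
  apply: le_trans (hC h).
  rewrite /GRing.scale /= mulr1 addr0 (_ : flat k 0 = 0) ?subr0; last by rewrite /flat ltxx.
  rewrite /flat; case: ifP => h0; last by rewrite mulr0.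
  by rewrite mulrA -exprS.
by split; [apply/cvg_ex; exists 0 | exact: cvg_lim c].
Unshelve. all: by end_near. Qed.

Lemma Cn_flat n k : Cn n (flat k).
Proof.
elim: n k => [//|n IH] k; exists (fun x => flat k.+2 x - k%:R * flat k.+1 x).
  exact: flat_derive.
by apply: CnD => //; apply: CnN; apply: CnM => //; exact: Cn_cst.
Qed.

Lemma flat_ge0 k x : 0 <= flat k x.
Proof.
rewrite /flat; case: ifP => // x0.
by rewrite mulr_ge0 ?expR_ge0 // exprn_ge0 // invr_ge0 ltW.
Qed.

Lemma flat_gt0 k (x : R) : 0 < x -> 0 < flat k x.
Proof.
by move=> x0; rewrite /flat x0 mulr_gt0 ?expR_gt0 // exprn_gt0 // invr_gt0.
Qed.

Lemma flat_le0 k (x : R) : x <= 0 -> flat k x = 0.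
Proof. by move=> x0; rewrite /flat ltNge x0. Qed.

(** The quotient f(x - a) / (f(x - a) + f(b - x)) for the flat function f. *)
Lemma smooth_step (a b : R) : a < b -> exists2 s : R -> R, Cinf s &
  (forall x, x <= a -> s x = 0) /\ (forall x, b <= x -> s x = 1).
Proof.
move=> ab.
pose d x := flat 0 (x - a) + flat 0 (b - x).
have d0 x : d x != 0.
  rewrite gt_eqF // /d; have [xa|xa] := leP x a.
    by rewrite ltr_wpDl ?flat_ge0 // flat_gt0 // subr_gt0 (le_lt_trans xa).
  by rewrite ltr_pwDl ?flat_ge0 // flat_gt0 // subr_gt0.
exists (fun x => flat 0 (x - a) * (d x)^-1).
  move=> n; have h1 : Cn n (fun x => flat 0 (x - a)).
    have := Cn_aff 1 (- a) (Cn_flat n 0); congr (Cn n _).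
    by apply/funext => x; rewrite mul1r.
  apply: CnM => //; apply: CnV => //; apply: CnD => //.
  have := Cn_aff (-1) b (Cn_flat n 0); congr (Cn n _).
  by apply/funext => x; rewrite mulN1r addrC.
split => x hx; first by rewrite flat_le0 ?mul0r // subr_le0.
rewrite /d (@flat_le0 _ (b - x)) ?subr_le0 // addr0 divff //.
by rewrite gt_eqF // flat_gt0 // subr_gt0 (lt_le_trans ab).
Qed.

Definition test u := Cinf u /\ exists M : R, forall x, M < `|x| -> u x = 0.

Lemma testM u v : test u -> Cinf v -> test (fun x => u x * v x).
Proof.
move=> [su [M hM]] sv; split; first by move=> n; exact: CnM.
by exists M => x /hM ->; rewrite mul0r.
Qed.

Lemma test_aff u (a b : R) : a != 0 -> test u -> test (fun x => u (a * x + b)).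
Proof.
move=> a0 [su [M hM]]; split; first by move=> n; exact: Cn_aff.
have a1 : 0 < `|a| by rewrite normr_gt0.
exists ((`|M| + `|b|) / `|a|) => x; rewrite ltr_pdivrMr // => hx; apply: hM.
have h1 := ler_norm M.
have : `|a * x| <= `|a * x + b| + `|b| by have := ler_normB (a * x + b) b; rewrite addrK.
rewrite normrM mulrC; lra.
Qed.

Lemma test_derive u : test u -> exists2 v, (forall x : R, is_derive x 1 u (v x)) & test v.
Proof.
move=> [su [M hM]]; have [v uv sv] := Cinf_derive su; exists v => //; split=> //.
exists M => x hx; have [_ <-] := uv x.
rewrite -(derive_cst (0 : R) x 1); apply: near_eq_derive.
have : \forall y \near x, M < `|y|.
  have c : `|y| @[y --> x] --> `|x| by apply: cvg_norm; exact: cvg_id.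
  exact: (@cvgr_gt _ _ _ _ _ _ c _ hx).
by apply: filterS => y /hM.
Qed.

Lemma test_cont u : test u -> continuous u.
Proof.
move=> [/(_ 1)[v uv _] _] x; have [h _] := uv x.
exact/differentiable_continuous/derivable1_diffP.
Qed.

Lemma test_bnd u : test u -> exists2 K : R, 0 <= K & forall x, `|u x| <= K.
Proof.
move=> tu; have [_ [M hM]] := tu.
have cu : continuous (fun x => `|u x|).
  by move=> x; apply: cvg_norm; exact: (test_cont tu).
have MM : - `|M| <= `|M| by have := normr_ge0 M; lra.
have [c _ hc] := EVT_max MM (continuous_subspaceT cu).
exists `|u c| => [|x]; first exact: normr_ge0.
have [h|h] := leP `|x| `|M|.
  by apply: hc; rewrite in_itv /= -ler_norml.
by rewrite hM ?normr0 ?normr_ge0 //; apply: le_lt_trans (ler_norm M) h.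
Qed.

Lemma test_schwartz u : test u -> schwartz_real u.
Proof.
move=> tu; split; first exact/CinfP/tu.1.
move=> k n.
have td : test (derive1n n u).
  elim: n u tu => [//|n IH] u /test_derive[v uv tv].
  by rewrite /derive1n iterSr (derive1_fun uv); exact: IH.
have [K K0 hK] := test_bnd td; have [_ [M hM]] := td.
exists (`|M| ^+ k * K) => x; have [h|h] := leP `|x| `|M|.
  by rewrite ler_pM // ?exprn_ge0 // lerXn2r ?nnegrE.
rewrite hM ?normr0 ?mulr0 ?mulr_ge0 ?exprn_ge0 //.
exact: le_lt_trans (ler_norm M) h.
Qed.

Lemma schwartz_test u (M : R) : schwartz_real u -> (forall x, M < `|x| -> u x = 0) -> test u.
Proof. by move=> [su _] h; split; [exact/CinfP|exists M]. Qed.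

End calculus.

(** * Translation and reflection of integrals *)

Section moves.
Context {R : realType}.
Local Notation mu := (@lebesgue_measure R).

Lemma mu_shift (t : R) (A : set R) : measurable A -> mu ((fun x => x + t) @^-1` A) = mu A.
Proof.
move=> mA; apply/esym.
have mf : measurable_fun setT (fun x : R => x + t) by apply: measurable_funD.
pose mx := isMeasurableFun.Build _ _ (measurableTypeR R) (measurableTypeR R) _ mf.
pose pk := MeasurableFun.Pack (MeasurableFun.Class mx).
apply: (@lebesgue_measure_unique R (pushforward mu pk)) => //= _ [[a b]] _ <-.
rewrite /pushforward.
have -> : (fun x : R => x + t) @^-1` `]a, b]%classic = `]a - t, b - t]%classic.
  apply/seteqP; split => x /=; rewrite !in_itv /= => /andP[h1 h2]; apply/andP; split; lra.
rewrite !lebesgue_measure_itv /= !lte_fin ltrD2r; case: ifP => // _.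
by rewrite -!EFinD; congr _%:E; ring.
Qed.

(** The pushforward of Lebesgue measure under such a map is Lebesgue measure. *)
Lemma int_move (s : R -> R) (f : R -> \bar R) : measurable_fun setT s ->
  (forall A, measurable A -> mu (s @^-1` A) = mu A) ->
  measurable_fun setT f -> (\int[mu]_x f (s x) = \int[mu]_x f x)%E.
Proof.
move=> ms hs mf.
have E (g : R -> \bar R) : measurable_fun setT g -> (forall x, 0 <= g x)%E ->
    (\int[mu]_x g (s x) = \int[mu]_x g x)%E.
  move=> mg g0; pose mx := isMeasurableFun.Build _ _ (measurableTypeR R) (measurableTypeR R) _ ms.
  pose pk := MeasurableFun.Pack (MeasurableFun.Class mx).
  transitivity (\int[pushforward mu pk]_x g x)%E.
    by rewrite ge0_integral_pushforward.
  by apply: eq_measure_integral => A mA _; exact: hs.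
rewrite integralE [RHS]integralE; congr (_ - _)%E.
  have m := measurable_funepos mf.
  transitivity (\int[mu]_x (f^\+ (s x)))%E; first by apply: eq_integral => x _; rewrite !funeposE.
  by apply: E.
have m := measurable_funeneg mf.
transitivity (\int[mu]_x (f^\- (s x)))%E; first by apply: eq_integral => x _; rewrite !funenegE.
by apply: E.
Qed.

Lemma Rint_move (s : R -> R) (f : R -> R) : measurable_fun setT s ->
  (forall A, measurable A -> mu (s @^-1` A) = mu A) ->
  measurable_fun setT f -> \int[mu]_x f (s x) = \int[mu]_x f x.
Proof.
move=> ms hs mf; rewrite /Rintegral; congr fine.
have mf' : measurable_fun setT (EFin \o f) by exact/measurable_EFinP.
exact: (int_move ms hs mf').
Qed.

Lemma cintegral_move (s : R -> R) (f : R -> R[i]) : measurable_fun setT s ->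
  (forall A, measurable A -> mu (s @^-1` A) = mu A) ->
  cmeas f -> cintegral (fun x => f (s x)) = cintegral f.
Proof.
by move=> ms hs [m1 m2]; apply: complexP => /=; apply: (Rint_move ms hs).
Qed.

Lemma mu_opp (A : set R) : measurable A -> mu ((fun x => - x) @^-1` A) = mu A.
Proof. by move=> mA; rewrite -[RHS]lebesgue_measureN. Qed.

End moves.

(** * Cosine transforms of test functions *)

Section cosine_transform.
Context {R : realType}.
Implicit Types u v : R -> R.
Local Notation mu := (@lebesgue_measure R).

Lemma int_wt u (K : R) : measurable_fun setT u -> 0 <= K -> (forall x, `|u x| <= K * wt x) ->
  mu.-integrable setT (EFin \o u).
Proof.
move=> mu' K0 uK.
have h : kern (fun x => (u x)%:C).
  split; first exact: cmeas_R.
  by exists K => // x; rewrite cmR.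
exact: cint_Re (kern_cint h).
Qed.

Lemma cont_meas u : continuous u -> measurable_fun setT u.
Proof. exact: continuous_measurable_fun. Qed.

Lemma test_wt u : test u -> exists2 K : R, 0 <= K & forall x, `|u x| <= K * wt x.
Proof.
move=> tu; have [K K0 hK] := test_bnd tu; have [_ [M hM]] := tu.
have p : 0 < 1 + `|M| ^+ 2 by rewrite ltr_wpDr // sqr_ge0.
exists (K * (1 + `|M| ^+ 2)) => [|x]; first by rewrite mulr_ge0 // ltW.
have q : 0 < 1 + x ^+ 2 by rewrite ltr_wpDr // sqr_ge0.
have [h|h] := leP `|x| `|M|.
  apply: le_trans (hK x) _; rewrite -mulrA -[leLHS]mulr1 ler_wpM2l //.
  rewrite /wt ler_pdivlMr // mul1r lerD2l -(real_normK (num_real x)).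
  by rewrite lerXn2r ?nnegrE.
rewrite hM ?normr0; last exact: le_lt_trans (ler_norm M) h.
by rewrite !mulr_ge0 ?wt_ge0 // ltW.
Qed.

Lemma test_int u (g : R -> R) : test u -> measurable_fun setT g -> (forall x, `|g x| <= 1) ->
  mu.-integrable setT (EFin \o (fun y => u y * g y)).
Proof.
move=> tu mg g1; have [K K0 hK] := test_wt tu.
apply: (@int_wt _ K) => //.
  by apply: measurable_funM => //; apply: cont_meas; exact: test_cont.
move=> x; rewrite normrM -[leRHS]mulr1; apply: ler_pM => //.
Qed.

Lemma cos_aff_meas (x c : R) : measurable_fun setT (fun y : R => cos (x * y + c)).
Proof.
apply: measurableT_comp; first exact: cont_meas (@continuous_cos R).
by apply: measurable_funD => //; exact: measurable_funM.
Qed.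

Lemma norm_cos (t : R) : `|cos t| <= 1.
Proof. by rewrite ler_norml cos_geN1 cos_le1. Qed.

Lemma norm_sin (t : R) : `|sin t| <= 1.
Proof. by rewrite ler_norml sin_geN1 sin_le1. Qed.

(** A phase c treats sine and cosine transforms at once: differentiating in x
    shifts c by pi / 2. *)
Definition Kc (c : R) u (x : R) : R := \int[mu]_y (u y * cos (x * y + c)).

Lemma test_id u : test u -> test (fun y => y * u y).
Proof.
move=> tu; have := testM tu (fun n => Cn_id n); congr (test _).
by apply/funext => y; rewrite mulrC.
Qed.

Lemma Kc_int c u x : test u -> mu.-integrable setT (EFin \o (fun y => u y * cos (x * y + c))).
Proof. by move=> tu; apply: test_int => //; [exact: cos_aff_meas|move=> y; exact: norm_cos]. Qed.

Lemma is_derive_cos_aff (y c x : R) :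
  is_derive x 1 (fun x : R => cos (x * y + c)) (y * cos (x * y + (c + pi / 2))).
Proof.
have h1 : is_derive x 1 (fun x : R => x * y + c) y.
  have h := is_deriveD (is_deriveZ y (is_derive_id x (1 : R))) (is_derive_cst c x 1).
  rewrite (_ : (fun x => _) = (y *: id + cst c)); last first.
    by apply/funext => z; rewrite mulrC.
  by apply: (@is_derive_eq _ _ _ _ _ _ _ _ h); rewrite addr0 /GRing.scale /= mulr1.
have h2 := @is_derive1_comp _ cos (fun x => x * y + c) x _ _ (is_derive_cos _) h1.
apply: (@is_derive_eq _ _ _ _ _ _ _ _ h2).
by rewrite addrA cosDpihalf mulrC.
Qed.

Lemma Kc_derive c u (x : R) : test u -> is_derive x 1 (Kc c u) (Kc (c + pi / 2) (fun y => y * u y) x).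
Proof.
move=> tu; have tv := test_id tu.
pose f x y := u y * cos (x * y + c).
have df y (z : R) : is_derive z 1 (f ^~ y) (y * u y * cos (z * y + (c + pi / 2))).
  have h := is_deriveZ (u y) (is_derive_cos_aff y c z).
  by apply: (@is_derive_eq _ _ _ _ _ _ _ _ h); rewrite /GRing.scale /=; ring.
have p1 y z : partial1of2 f z y = y * u y * cos (z * y + (c + pi / 2)).
  by rewrite partial1of2E; have h := df y z; rewrite derive_val.
have Ix : `]x - 1, x + 1[%classic x by rewrite /= in_itv /=; apply/andP; split; lra.
have G0 y : 0 <= `|y * u y| by [].
have iG : mu.-integrable setT (EFin \o (fun y : R => `|y * u y|)).
  have [K K0 hK] := test_wt tv; apply: (int_wt _ K0) => [|y]; last by rewrite normr_id.
  by apply: measurableT_comp => //; apply: cont_meas; exact: test_cont.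
have b z y : `]x - 1, x + 1[%classic z -> [set: R] y -> `|partial1of2 f z y| <= `|y * u y|.
  by move=> _ _; rewrite p1 normrM ler_piMr // norm_cos.
have i1 z : `]x - 1, x + 1[%classic z -> mu.-integrable setT (EFin \o f z).
  by move=> _; exact: Kc_int.
have d1 z y : `]x - 1, x + 1[%classic z -> [set: R] y -> derivable (f ^~ y) z 1.
  by move=> _ _; have [] := df y z.
split.
  exact: (derivable_under_integral measurableT Ix i1 d1 G0 iG b).
rewrite -derive1E (differentiation_under_integral measurableT Ix i1 d1 G0 iG b).
by apply: eq_Rintegral => y _; exact: p1.
Qed.

Lemma Kc_cont c u : test u -> continuous (Kc c u).
Proof.
move=> tu x; have [h _] := Kc_derive c x tu.
exact/differentiable_continuous/derivable1_diffP.
Qed.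

Lemma cst_cvg_eventually (F : R -> R) (M : R) : (forall x, M < `|x| -> F x = 0) ->
  F n%:R @[n --> \oo] --> 0 /\ F (- n%:R) @[n --> \oo] --> 0.
Proof.
move=> h.
have e : \forall n \near \oo, M < (n%:R : R).
  exists (Num.truncn `|M|).+1 => // n /= hn.
  apply: le_lt_trans (ler_norm M) _; apply: lt_le_trans (truncnS_gt _) _.
  by rewrite ler_nat.
split; apply: cvg_near_cst; apply: filterS e => n hn; rewrite h ?normrN ?ger0_norm //.
Qed.

(** Two integrations by parts: the integrand is the derivative in y of
    u' cos(x y + c) + x u sin(x y + c), which has compact support. *)
Lemma Kc_ibp c u v w x : test u -> (forall y : R, is_derive y 1 u (v y)) ->
  test v -> (forall y : R, is_derive y 1 v (w y)) -> test w ->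
  Kc c w x + x ^+ 2 * Kc c u x = 0.
Proof.
move=> tu uv tv vw tw.
pose F y := v y * cos (x * y + c) + x * (u y * sin (x * y + c)).
have da (y : R) : is_derive y 1 (fun y : R => x * y + c) x.
  have h := is_deriveD (is_deriveZ x (is_derive_id y (1 : R))) (is_derive_cst c y 1).
  by apply: (@is_derive_eq _ _ _ _ _ _ _ _ h); rewrite addr0 /GRing.scale /= mulr1.
have dF (y : R) : is_derive y 1 F (w y * cos (x * y + c) + x ^+ 2 * (u y * cos (x * y + c))).
  have hc := @is_derive1_comp _ cos _ y _ _ (is_derive_cos _) (da y).
  have hs := @is_derive1_comp _ sin _ y _ _ (is_derive_sin _) (da y).
  have h := is_deriveD (is_deriveM (vw y) hc) (is_deriveZ x (is_deriveM (uv y) hs)).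
  by apply: (@is_derive_eq _ _ _ _ _ _ _ _ h); rewrite /GRing.scale /=; ring.
have [_ [M1 h1]] := tu; have [_ [M2 h2]] := tv.
have [F1 F2] : F n%:R @[n --> \oo] --> 0 /\ F (- n%:R) @[n --> \oo] --> 0.
  apply: (@cst_cvg_eventually _ (Num.max M1 M2)) => y; rewrite gt_max => /andP[/h1 e1 /h2 e2].
  by rewrite /F e1 e2 !mul0r mulr0 addr0.
have i1 := Kc_int c x tw; have i2 := Kc_int c x tu.
have i3 : mu.-integrable setT (EFin \o (fun y => x ^+ 2 * (u y * cos (x * y + c)))).
  rewrite (_ : _ \o _ = fun y => ((x ^+ 2)%:E * (u y * cos (x * y + c))%:E)%E) //.
  exact: integrableZl.
have cc (g : R -> R) : test g -> continuous (fun y => g y * cos (x * y + c)).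
  move=> tg y.
  apply: cvgM; first exact: test_cont.
  apply: (@continuous_comp _ _ _ (fun y => x * y + c) cos); last exact: continuous_cos.
  by apply: cvgD; [apply: cvgM; [exact: cvg_cst|exact: cvg_id]|exact: cvg_cst].
have := @FTC_line _ F _ 0 0 dF _ _ F1 F2.
rewrite subrr RintegralD // RintegralZl // => -> //.
- move=> y; apply: cvgD; first exact: cc.
  by apply: cvgM; [exact: cvg_cst|exact: cc].
- rewrite (_ : _ \o _ = (EFin \o (fun y => w y * cos (x * y + c))) \+
     (EFin \o (fun y => x ^+ 2 * (u y * cos (x * y + c))))) //.
  exact: integrableD.
Qed.

(** By Kc_ibp, (1 + x^2) times the transform of u is the transform of u - u''. *)
Lemma Kc_decay c u : test u -> exists2 K : R, 0 <= K & forall x, `|Kc c u x| <= K * wt x.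
Proof.
move=> tu; have [v uv tv] := test_derive tu; have [w vw tw] := test_derive tv.
have bd g : test g -> exists2 K : R, 0 <= K & forall x, `|Kc c g x| <= K.
  move=> tg; have [K K0 hK] := test_wt tg; exists (K * pi); first by rewrite mulr_ge0 ?pi_ge0.
  move=> x; have iw : mu.-integrable setT (EFin \o (fun y => K * wt y)).
    apply: (@int_wt _ K) => //.
      by apply: measurable_funM => //; exact: wt_meas.
    by move=> y; rewrite ger0_norm // mulr_ge0 // wt_ge0.
  apply: le_trans (le_normr_Rintegral _ (Kc_int c x tg)) _ => //.
  have -> : K * pi = \int[mu]_y (K * wt y).
    rewrite RintegralZl //; first by rewrite /Rintegral wt_int.
    apply: (@int_wt _ 1) => //; first exact: wt_meas.
    by move=> y; rewrite mul1r ger0_norm // wt_ge0.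
  apply: le_Rintegral => //.
    exact: integrable_norm (Kc_int c x tg).
  move=> y _; rewrite normrM; apply: le_trans (hK y).
  by rewrite ler_piMr // norm_cos.
have [K1 K10 h1] := bd u tu; have [K2 K20 h2] := bd w tw.
exists (K1 + K2) => [|x]; first exact: addr_ge0.
have q : 0 < 1 + x ^+ 2 by rewrite ltr_wpDr // sqr_ge0.
rewrite /wt ler_pdivlMr // -[X in _ * X]ger0_norm ?(ltW q) // -normrM.
have -> : Kc c u x * (1 + x ^+ 2) = Kc c u x - Kc c w x.
  have := Kc_ibp c x tu uv tv vw tw; move: (Kc c u x) (Kc c w x) => a b; lra.
by apply: le_trans (ler_normB _ _) _; exact: lerD.
Qed.

Lemma wt_nat_cvg : (wt n%:R : R) @[n --> \oo] --> 0.
Proof.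
apply: squeeze_cvgr (@cvg_harmonic R); last exact: cvg_cst.
near=> n; rewrite wt_ge0 /= /wt lef_pV2 ?posrE ?ltr_pwDl ?sqr_ge0 ?ltr0n //.
rewrite -natr1 addrC lerD2l -natrX ler_nat.
by case: (n) => // m; rewrite expnS leq_pmulr // expn_gt0.
Unshelve. all: by end_near. Qed.

(** The transform of y u(y) is the derivative of another transform of u, which tends
    to 0 at both ends.  This is the inversion formula at the origin, where y u(y)
    vanishes. *)
Lemma Kc_int0 c u : test u -> \int[mu]_x Kc c (fun y => y * u y) x = 0.
Proof.
move=> tu; have tv := test_id tu; have [K K0 hK] := Kc_decay (c - pi / 2) tu.
have [L L0 hL] := Kc_decay c tv.
have lim (s : nat -> R) : (forall n, wt (s n) = wt n%:R) ->
    Kc (c - pi / 2) u (s n) @[n --> \oo] --> 0.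
  move=> hs; apply/norm_cvg0P.
  have h : K * wt (n%:R : R) @[n --> \oo] --> K * 0.
    by apply: cvgM; [exact: cvg_cst|exact: wt_nat_cvg].
  rewrite mulr0 in h; apply: squeeze_cvgr h; last exact: cvg_cst.
  by near=> n; rewrite normr_ge0 -hs /= hK.
rewrite -[RHS](subrr (0 : R)).
apply: (@FTC_line _ (Kc (c - pi / 2) u)).
- by move=> x; have := Kc_derive (c - pi / 2) x tu; rewrite subrK.
- exact: Kc_cont.
- by apply: (int_wt _ L0 hL); apply: cont_meas; exact: Kc_cont.
- exact: lim.
- by apply: lim => n; rewrite /wt sqrrN.
Unshelve. all: by end_near. Qed.

End cosine_transform.

(** * Localisation and Fourier transforms of test functions *)

Section local_global.
Context {R : realType}.

(** Smooth steps split a function supported in an interval into two pieces;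
    hence the supremum of the right ends up to which L vanishes cannot lie inside
    a bounded interval. *)
Lemma local_global (L : (R -> R) -> R[i]) :
  (forall g h, Cinf g -> Cinf h -> L (fun y => g y + h y) = L g + L h) ->
  (forall x : R, exists2 e : R, 0 < e & forall g, Cinf g ->
     (forall y, e <= `|y - x| -> g y = 0) -> L g = 0) ->
  forall g, test g -> L g = 0.
Proof.
move=> Ladd Lloc g [sg [M hM]].
(* g vanishes off ]a, B[ *)
pose a := - `|M| - 1; pose B := `|M| + 1.
pose Good b := forall h, Cinf h -> (forall y, y <= a \/ b <= y -> h y = 0) -> L h = 0.
have down b b' : b' <= b -> Good b -> Good b'.
  move=> bb' gb h sh hh; apply: gb => // y [ya|yb]; apply: hh; [by left|right].
  exact: le_trans bb' yb.
have [|nG] := pselect (Good B).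
  move=> GB; apply: GB => // y hy; apply: hM.
  apply: le_lt_trans (ler_norm M) _; rewrite /a /B in hy.
  by rewrite ltr_normr; case: hy => hy; apply/orP; [right|left]; lra.
exfalso.
pose S := [set b | Good b].
have ubS : ubound S B.
  by move=> b Gb; rewrite leNgt; apply/negP => Bb; apply: nG; exact: down (ltW Bb) Gb.
have S0 : S !=set0.
  have [e e0 he] := Lloc a; exists (a + e) => h sh hh; apply: he => // y.
  by rewrite ler_normr => /orP[h1|h1]; apply: hh; [right|left]; lra.
have hs : has_sup S by split => //; exists B.
have [e e0 he] := Lloc (sup S).
have [b Sb hb] := sup_adherent e0 hs.
have bs : b <= sup S by exact: sup_upper_bound hs _ Sb.
suff : S (sup S + e) by move/(sup_upper_bound hs); lra.
move=> h sh hh.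
have [p [h1 h2]] : exists p, sup S - e < p /\ p < b by exists ((sup S - e + b) / 2); lra.
have [s ss [s0 s1]] := smooth_step h2.
have sN : Cinf (fun y => 1 - s y).
  by move=> n; apply: CnD; [exact: Cn_cst|exact: CnN].
have c1 : Cinf (fun y => h y * s y) by move=> n; exact: CnM.
have c2 : Cinf (fun y => h y * (1 - s y)) by move=> n; apply: CnM => //; exact: sN.
rewrite (_ : h = fun y => h y * s y + h y * (1 - s y)); last first.
  by apply/funext => y; ring.
rewrite Ladd // he //; last first.
  move=> y; rewrite ler_normr => /orP[hy|hy].
    by rewrite hh ?mul0r //; right; lra.
  by rewrite s0 ?mulr0 //; lra.
rewrite add0r; apply: Sb => // y [ya|yb].
  by rewrite hh ?mul0r //; left.
by rewrite s1 // subrr mulr0.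
Qed.

End local_global.

Section complex_tests.
Context {R : realType}.
Implicit Types phi psi : R -> R[i].
Local Notation mu := (@lebesgue_measure R).

Definition ctest phi :=
  test (fun x => complex.Re (phi x)) /\ test (fun x => complex.Im (phi x)).

Lemma supp_sub phi (B : set R) : closed B -> (forall x, ~ B x -> phi x = 0) ->
  supp phi `<=` B.
Proof.
move=> cB h; rewrite /supp (closure_id B).1 //; apply: closure_subset => x /= /eqP p0.
by apply: contrapT => /h.
Qed.

Lemma supp0 phi x : ~ supp phi x -> phi x = 0.
Proof.
move=> h; apply/eqP; apply: contrapT => /negP p0; apply: h.
exact: subset_closure.
Qed.

Lemma ctestP phi : ctest phi <-> schwartz phi /\ compact (supp phi).
Proof.
split=> [[t1 t2]|[[s1 s2] /compact_bounded[M [Mr hM]]]].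
  split; first by split; exact: test_schwartz.
  have [_ [M1 h1]] := t1; have [_ [M2 h2]] := t2.
  pose M := Num.max M1 M2.
  apply: (@subclosed_compact _ _ `[- `|M|, `|M|]%classic).
  - exact: closed_closure.
  - exact: segment_compact.
  - apply: supp_sub; first exact: itv_closed.
    move=> x /= hx.
    have : M < `|x|.
      rewrite ltNge; apply/negP => hx'; apply: hx.
      by rewrite in_itv /= -ler_norml; apply: le_trans hx' (ler_norm M).
    rewrite gt_max => /andP[/h1 e1 /h2 e2]; apply: complexP => /=; by rewrite ?e1 ?e2.
have h x : M + 1 < `|x| -> phi x = 0.
  move=> hx; apply: supp0 => /(hM (M + 1)) hx'.
  by have := lt_le_trans hx (hx' _); rewrite ltxx => /(_ _)/[!ltrDl] /(_ ltr01).
split.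
- by apply: (@schwartz_test _ _ (M + 1)) => // x /h ->.
- by apply: (@schwartz_test _ _ (M + 1)) => // x /h ->.
Qed.

Lemma ctestM phi (g : R -> R) : ctest phi -> Cinf g -> ctest (fun x => phi x * (g x)%:C).
Proof.
move=> [p1 p2] sg; split.
  rewrite (_ : (fun x => _) = (fun x => complex.Re (phi x) * g x)); first exact: testM.
  by apply/funext => x; rewrite cReM /= mulr0 subr0.
rewrite (_ : (fun x => _) = (fun x => complex.Im (phi x) * g x)); first exact: testM.
by apply/funext => x; rewrite cImM /= mulr0 add0r.
Qed.

Lemma ctest_aff phi (a b : R) : a != 0 -> ctest phi -> ctest (fun x => phi (a * x + b)).
Proof.
move=> a0 [p1 p2]; split; first exact: (test_aff b a0 p1).
exact: (test_aff b a0 p2).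
Qed.

Lemma sin_cos (t : R) : sin t = cos (t + - (pi / 2)).
Proof. by rewrite -[t in LHS](subrK (pi / 2)) sinDpihalf. Qed.

Lemma ctest_cmeas phi : ctest phi -> cmeas phi.
Proof. by move=> [p1 p2]; split; apply: cont_meas; exact: test_cont. Qed.

Lemma expi_meas (x : R) : cmeas (fun y : R => expi (x * y)).
Proof.
have m : measurable_fun setT (fun y : R => x * y) by apply: measurable_funM.
split => /=.
  apply: (measurableT_comp (cont_meas (@continuous_cos R)) m).
apply: (measurableT_comp (cont_meas (@continuous_sin R)) m).
Qed.

Lemma ctest_cint phi x : ctest phi -> cint (fun y => phi y * expi (x * y)).
Proof.
move=> tp; have [p1 p2] := tp; have [K K0 hK] := test_wt p1.
have [L L0 hL] := test_wt p2.
apply: kern_cint; split; first by apply: cmeasM; [exact: ctest_cmeas|exact: expi_meas].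
exists (K + L) => [|y]; first exact: addr_ge0.
rewrite cmM cm_expi mulr1 mulrDl; apply: le_trans (cm_le _) _.
exact: lerD.
Qed.

Lemma fourierE phi x : ctest phi -> fourier phi x = ((Num.sqrt (2 * pi))^-1)%:C *
  ((Kc 0 (fun y => complex.Re (phi y)) x - Kc (- (pi / 2)) (fun y => complex.Im (phi y)) x) +i*
   (Kc (- (pi / 2)) (fun y => complex.Re (phi y)) x + Kc 0 (fun y => complex.Im (phi y)) x)).
Proof.
move=> [p1 p2]; rewrite /fourier; congr (_ * _); apply: complexP => /=.
  rewrite -RintegralB //; try exact: Kc_int.
  by apply: eq_Rintegral => y _; rewrite cReM /= addr0 sin_cos.
rewrite -RintegralD //; try exact: Kc_int.
by apply: eq_Rintegral => y _; rewrite cImM /= addr0 sin_cos.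
Qed.

Lemma fourier_kern phi : ctest phi -> kern (fourier phi).
Proof.
move=> tp; have [p1 p2] := tp.
rewrite (funext (fun x => fourierE x tp)).
have m c u : test u -> measurable_fun setT (Kc c u) by move=> tu; apply: cont_meas; exact: Kc_cont.
have [K1 K10 h1] := Kc_decay 0 p1; have [K2 K20 h2] := Kc_decay (- (pi / 2)) p2.
have [K3 K30 h3] := Kc_decay (- (pi / 2)) p1; have [K4 K40 h4] := Kc_decay 0 p2.
split.
  apply: cmeasM; first exact: cmeas_cst.
  by split => /=; [apply: measurable_funB|apply: measurable_funD]; exact: m.
exists (`|(Num.sqrt (2 * pi))^-1| * (K1 + K2 + (K3 + K4))) => [|x].
  by rewrite mulr_ge0 // !addr_ge0.
rewrite cmM cmR -mulrA ler_wpM2l //; apply: le_trans (cm_le _) _ => /=.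
rewrite [leRHS]mulrDl; apply: lerD; rewrite [leRHS]mulrDl.
  by apply: le_trans (ler_normB _ _) _; exact: lerD.
by apply: le_trans (ler_normD _ _) _; exact: lerD.
Qed.

Lemma fourierD phi psi x : ctest phi -> ctest psi ->
  fourier (fun y => phi y + psi y) x = fourier phi x + fourier psi x.
Proof.
move=> tp tq; rewrite /fourier -mulrDr -cintegralD; try exact: ctest_cint.
by congr (_ * cintegral _); apply/funext => y; rewrite mulrDl.
Qed.

Lemma fourier_shift phi (t x : R) : ctest phi ->
  fourier (fun y => phi (y - t)) x = expi (x * t) * fourier phi x.
Proof.
move=> tp; rewrite /fourier mulrCA; congr (_ * _).
rewrite -cintegralZ; last exact: ctest_cint.
have m : cmeas (fun y => expi (x * t) * (phi y * expi (x * y))).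
  by apply: cmeasM; [exact: cmeas_cst|exact: (ctest_cint x tp).1].
rewrite -(@cintegral_move _ (fun y => y + - t) _ _ _ m).
- congr cintegral; apply/funext => y; rewrite mulrCA -expiD; congr (_ * expi _); ring.
- exact: measurable_funD.
- exact: mu_shift.
Qed.

Lemma fourier_opp phi (x : R) : ctest phi ->
  fourier (fun y => phi (- y)) x = fourier phi (- x).
Proof.
move=> tp; rewrite /fourier; congr (_ * _).
have m := (ctest_cint (- x) tp).1.
rewrite -(@cintegral_move _ (fun y => - y) _ _ _ m).
- by congr cintegral; apply/funext => y; rewrite mulrNN.
- exact: oppr_measurable.
- exact: mu_opp.
Qed.

(** Divide by y^2 + f(t - y) f(t + y) with f flat: this is positive everywhere and
    equal to y^2 where u does not vanish. *)
Lemma test_div (u : R -> R) (t : R) : 0 < t -> test u -> (forall y, y <= t -> u y = 0) ->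
  exists2 v, test v & u = fun y => y * v y.
Proof.
move=> t0 tu hu.
pose m (y : R) := y * y + flat 0 (t - y) * flat 0 (t + y).
have m0 y : m y != 0.
  rewrite gt_eqF // /m; have [->|y0] := eqVneq y 0.
    by rewrite mulr0 add0r subr0 addr0 mulr_gt0 // flat_gt0.
  by rewrite ltr_pwDl ?mulr_ge0 ?flat_ge0 // -expr2 exprn_even_gt0.
have sm n : Cn n m.
  apply: CnD; first by apply: CnM; exact: Cn_id.
  apply: CnM.
    have := Cn_aff (-1) t (Cn_flat n 0); congr (Cn n _).
    by apply/funext => y; rewrite mulN1r addrC.
  have := Cn_aff 1 t (Cn_flat n 0); congr (Cn n _).
  by apply/funext => y; rewrite mul1r addrC.
exists (fun y => u y * (y * (m y)^-1)).
  by apply: testM => // n; apply: CnM; [exact: Cn_id|exact: CnV].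
apply/funext => y; have [yt|yt] := leP y t; first by rewrite hu // mul0r mulr0.
have y0 : y != 0 by rewrite gt_eqF // (lt_trans t0).
rewrite {1}/m (@flat_le0 _ _ (t - y)) ?subr_le0 ?(ltW yt) // mul0r addr0.
by field.
Qed.

Lemma Kc_integrable c (u : R -> R) : test u -> mu.-integrable setT (EFin \o Kc c u).
Proof.
move=> tu; have [K K0 hK] := Kc_decay c tu.
by apply: (int_wt _ K0 hK); apply: cont_meas; exact: Kc_cont.
Qed.

(** The integral of the Fourier transform is a multiple of the value at 0; writing
    phi = y chi reduces this to Kc_int0. *)
Lemma fourier_int0 phi (t : R) : 0 < t -> ctest phi -> (forall y, y <= t -> phi y = 0) ->
  cintegral (fourier phi) = 0.
Proof.
move=> t0 tp hp; have [p1 p2] := tp.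
rewrite (funext (fun x => fourierE x tp)).
have [|u1 t1 e1] := test_div t0 p1; first by move=> y /hp ->.
have [|u2 t2 e2] := test_div t0 p2; first by move=> y /hp ->.
have k1 c : \int[mu]_x Kc c (fun y => complex.Re (phi y)) x = 0.
  by rewrite e1; exact: Kc_int0.
have k2 c : \int[mu]_x Kc c (fun y => complex.Im (phi y)) x = 0.
  by rewrite e2; exact: Kc_int0.
have h (f g : R -> R) : cint (fun x => f x +i* g x) -> \int[mu]_x f x = 0 -> \int[mu]_x g x = 0 ->
   cintegral (fun x => ((Num.sqrt (2 * pi))^-1)%:C * (f x +i* g x)) = 0.
  move=> hc f0 g0; rewrite cintegralZ // (_ : cintegral _ = 0) ?mulr0 //.
  by apply: complexP.
have i1 c := Kc_integrable c p1; have i2 c := Kc_integrable c p2.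
apply: h => //.
- have fk := fourier_kern tp; have := kern_cint fk.
  move=> /(cintZ (Num.sqrt (2 * pi))%:C); congr cint; apply/funext => x.
  rewrite fourierE // mulrA -rmorphM /= divff ?mul1r // gt_eqF // sqrtr_gt0.
  by rewrite mulr_gt0 // pi_gt0.
- by rewrite RintegralB // k1 k2 subr0.
- by rewrite RintegralD // k1 k2 addr0.
Qed.

End complex_tests.

(** * The support condition *)

Lemma cutoff {R : realType} (M : R) :
  exists2 g : R -> R, test g & forall y, `|y| <= M -> g y = 1.
Proof.
have lt : - M - 1 < - M by lra.
have [s ss [s0 s1]] := smooth_step lt.
have sN : Cinf (fun y => s (- y)).
  by move=> n; have := Cn_aff (-1) 0 (ss n); congr (Cn n _); apply/funext => y; rewrite mulN1r addr0.
exists (fun y => s y * s (- y)).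
  split; first by move=> n; exact: CnM.
  exists (M + 1) => y; rewrite ltr_normr => /orP[hy|hy].
    by rewrite (s0 (- y)) ?mulr0 //; lra.
  by rewrite s0 ?mul0r //; lra.
by move=> y; rewrite ler_norml => /andP[h1 h2]; rewrite !s1 ?mulr1 //; lra.
Qed.

Section spectral_condition.
Context {R : realType} {H : completeNormedModType R[i]}.
Variable ip : {dot H for Num.conj}.
Hypothesis hH : hilbert_norm ip.
Implicit Types f : R -> H.
Implicit Types phi psi : R -> R[i].
Local Notation mu := (@lebesgue_measure R).
Local Notation L2 := (@L2 R H).

(** The kernel of Xi f on the test function phi. *)
Definition ck phi (x : R) : R[i] := Num.conj (fourier phi x).

Lemma kern_ck phi : ctest phi -> kern (ck phi).
Proof.
move=> tp; have [m [K K0 hK]] := fourier_kern tp; split; first exact: cmeas_conj.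
by exists K => // x; rewrite cm_conj.
Qed.

(** The weak integral exists and is unique, so that Xi f phi vanishes exactly when all
    its scalar products do. *)
Lemma Xi_eq0 f phi : L2 f -> ctest phi ->
  Xi ip f phi = 0 <-> forall w, pairing ip (ck phi) f w = 0.
Proof.
move=> Lf tp; have [v hv] := pairing_rep hH (kern_ck tp) Lf.
rewrite /Xi /vintegral.
set S := [set _ | _].
have SE u : S u <-> forall w, cip ip u w = pairing ip (ck phi) f w.
  split=> h w; have := h w; rewrite /pairing => e.
    rewrite /cip e; congr cintegral; apply/funext => x; exact: ipZl.
  rewrite -/(cip ip u w) e; congr cintegral; apply/funext => x; by rewrite -/(cip ip _ _) ipZl.
have uniq u : S u -> u = v.
  move=> /SE hu; apply/eqP; rewrite -subr_eq0; apply/eqP; apply: (ip_ext hH) => w.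
  by rewrite ipBl hu hv subrr.
have Sv : S v by apply/SE.
rewrite (xget_unique 0 Sv uniq); split=> [v0 w|h].
  by rewrite -hv v0 ip0l.
by apply: (ip_ext hH) => w; rewrite hv h.
Qed.

(** Xi f kills all test functions supported off S, stated through scalar products.
    In this form the condition is visibly stable under linear combinations and limits. *)
Definition ann f (S : set R) := forall phi, ctest phi -> supp phi `<=` ~` S ->
  forall w, pairing ip (ck phi) f w = 0.

Lemma ckD phi psi x : ctest phi -> ctest psi -> 
  ck (fun y => phi y + psi y) x = ck phi x + ck psi x.
Proof. by move=> tp tq; rewrite /ck fourierD // rmorphD. Qed.

Lemma pairingDk (k l : R -> R[i]) f w : kern k -> kern l -> L2 f ->
  pairing ip (fun x => k x + l x) f w = pairing ip k f w + pairing ip l f w.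
Proof.
move=> hk hl Lf; rewrite /pairing -cintegralD; try exact: pairing_cint.
by congr cintegral; apply/funext => x; rewrite mulrDl.
Qed.

Lemma pairing0k f w : pairing ip (fun=> 0) f w = 0.
Proof.
rewrite /pairing (_ : (fun x => _) = fun=> 0); last by apply/funext => x; rewrite mul0r.
by rewrite /cintegral /Rintegral /= integral0.
Qed.

Lemma ck0 : ck (fun=> 0) = fun=> 0.
Proof.
apply/funext => x; rewrite /ck /fourier (_ : (fun y => _) = fun=> 0).
  by rewrite /cintegral /Rintegral /= integral0 mulr0 conjC0.
by apply/funext => y; rewrite mul0r.
Qed.

(** The complement of the support is a union of open sets on which Xi f vanishes;
    local_global shows that Xi f vanishes on the union. *)
Lemma dsupport_ann f (S : set R) : closed S -> L2 f ->
  dsupport (Xi ip f) `<=` S <-> ann f S.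
Proof.
move=> cS Lf; split=> [h phi tp sp w|h x hx].
  pose L (g : R -> R) := pairing ip (ck (fun y => phi y * (g y)%:C)) f w.
  have tM g : Cinf g -> ctest (fun y => phi y * (g y)%:C) by exact: ctestM.
  have [_ [M1 h1]] := tp.1; have [_ [M2 h2]] := tp.2.
  have [g tg g1] := cutoff (Num.max M1 M2).
  have <- : L g = pairing ip (ck phi) f w.
    rewrite /L; congr (pairing ip (ck _) f w); apply/funext => y.
    have [hy|hy] := leP `|y| (Num.max M1 M2); first by rewrite g1 // mulr1.
    rewrite (_ : phi y = 0) ?mul0r //; move: hy; rewrite gt_max => /andP[/h1 e1 /h2 e2].
    by apply: complexP.
  apply: local_global tg => [g1' g2' s1 s2|x].
    rewrite /L (_ : (fun y => _) = fun y => phi y * (g1' y)%:C + phi y * (g2' y)%:C).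
      by rewrite (funext (fun x => ckD x (tM _ s1) (tM _ s2))) pairingDk //; apply: kern_ck; exact: tM.
    by apply/funext => y; rewrite -mulrDr -[in RHS]rmorphD.
  have [sx|sx] := pselect (supp phi x); last first.
    have : open (~` supp phi) by apply: closed_openC; exact: closed_closure.
    rewrite openE => /(_ x sx)/nbhs_ballP[e /= e0 he]; exists e => // g' _ hg'.
    rewrite /L (_ : (fun y => _) = fun=> 0) ?ck0 ?pairing0k //.
    apply/funext => y; have [hy|hy] := leP e `|y - x|; first by rewrite hg' // mulr0.
    by rewrite supp0 ?mul0r //; apply: he; rewrite /ball /= distrC.
  have : (\bigcup_(O in [set O | open O /\ vanishes_on (Xi ip f) O]) O) x.
    by apply: contrapT => nO; apply: (sp _ sx); apply: h.
  case=> O [oO vO] Ox; move: (oO); rewrite openE => /(_ x Ox)/nbhs_ballP[e /= e0 he].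
  exists (e / 2); first by rewrite divr_gt0.
  move=> g' sg' hg'; have tq := tM _ sg'; have [sq cq] := (ctestP _).1 tq.
  suff X0 : Xi ip f (fun y => phi y * (g' y)%:C) = 0 by exact: ((Xi_eq0 Lf tq).1 X0 w).
  apply: vO => //.
  apply: (@subset_trans _ `[x - e / 2, x + e / 2]%classic).
    apply: supp_sub; first exact: itv_closed.
    move=> y hy; rewrite hg' ?mulr0 // leNgt; apply/negP; rewrite ltr_norml => /andP[h3 h4].
    by apply: hy; rewrite /= in_itv /=; apply/andP; split; lra.
  move=> y; rewrite /= in_itv /= => /andP[h3 h4]; apply: he.
  by rewrite /ball /= ltr_norml; apply/andP; split; lra.
apply: contrapT => nS; apply: hx; exists (~` S) => //; split; first exact: closed_openC.
move=> phi sp cp sS; have tp : ctest phi by exact/ctestP.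
by apply/(Xi_eq0 Lf tp) => w; exact: h.
Qed.

Lemma ann_lc (a : R[i]) f (g : R -> H) S : L2 f -> L2 g -> ann f S -> ann g S ->
  ann (fun x => a *: f x + g x) S.
Proof.
move=> Lf Lg hf hg phi tp sp w; rewrite pairing_lc // ?hf ?hg ?mulr0 ?addr0 //.
exact: kern_ck.
Qed.

(** Pairing with a kernel dominated by the weight is continuous for N2. *)
Lemma ann_cvg (f_ : nat -> R -> H) f S : (forall n, L2 (f_ n)) -> L2 f ->
  N2 (fun x => f_ n x - f x) @[n --> \oo] --> 0%E -> (forall n, ann (f_ n) S) -> ann f S.
Proof.
move=> L_ Lf cv h phi tp sp w.
have c := pairing_cvg hH w (kern_ck tp) L_ Lf cv.
apply: cm_eq0.
have e : (fun n => cm (pairing ip (ck phi) (f_ n) w - pairing ip (ck phi) f w)) =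
   fun=> cm (pairing ip (ck phi) f w).
  by apply/funext => n; rewrite h // sub0r cmN.
rewrite e in c.
exact: (@cvg_unique _ (@Rhausdorff R) _ _ _ _ (cvg_cst _) c).
Qed.

Lemma supp_comp phi (s r : R -> R) : continuous r -> cancel s r -> cancel r s ->
  supp (fun y => phi (r y)) `<=` r @^-1` supp phi.
Proof.
move=> cr sr rs; apply: supp_sub.
  by apply: closed_comp; [move=> x _; exact: cr|exact: closed_closure].
by move=> x hx; exact: supp0.
Qed.

Lemma ck_shift phi (t x : R) : ctest phi ->
  ck (fun y => phi (y - t)) x = expi (- (t * x)) * ck phi x.
Proof.
move=> tp; rewrite /ck fourier_shift // rmorphM; congr (_ * _).
by rewrite mulrC; exact: conj_expi.
Qed.

(** Multiplying f by exp(-i t x) amounts to translating the test function. *)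
Lemma ann_shift f (S : set R) (t : R) : ann f S ->
  ann (fun x => expi (- (t * x)) *: f x) [set y | S (y + t)].
Proof.
move=> h phi tp sp w.
have tq : ctest (fun y => phi (y - t)).
  have := ctest_aff (- t) (oner_neq0 R) tp; congr ctest.
  by apply/funext => y; rewrite mul1r.
rewrite -(h _ tq _ w).
  by congr cintegral; apply/funext => x; rewrite ipZl ck_shift // mulrCA mulrA.
apply: subset_trans (supp_comp (s := fun y => y + t) _ _ _) _.
- by move=> y; apply: cvgD; [exact: cvg_id|exact: cvg_cst].
- exact: addrK.
- exact: subrK.
- by move=> y /sp /= hy Sy; apply: hy; rewrite subrK.
Qed.

Lemma L2_opp f : L2 f -> L2 (fun x => f (- x)).
Proof.
move=> [sf lf]; split; first exact: sm_oppx.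
rewrite /N2; have m := N2_emeas sf.
have E : (\int[mu]_x (nm (f (- x)) ^+ 2 * wt (- x))%:E = N2 f)%E.
  exact: (int_move (@oppr_measurable R setT) (@mu_opp R) m).
apply: le_lt_trans lf; rewrite -E le_eqVlt; apply/orP; left; apply/eqP.
by apply: eq_integral => x _; rewrite /wt sqrrN.
Qed.

Lemma pairing_opp (k : R -> R[i]) f w : kern k -> L2 f ->
  pairing ip (fun x => k (- x)) f w = pairing ip k (fun x => f (- x)) w.
Proof.
move=> hk Lf; have [m _] := pairing_cint hH w hk (L2_opp Lf).
rewrite /pairing -[RHS](cintegral_move (@oppr_measurable R setT) (@mu_opp R) m).
by congr cintegral; apply/funext => x; rewrite opprK.
Qed.

Lemma ann_opp f (S : set R) : L2 f -> ann f S -> ann (fun x => f (- x)) [set y | S (- y)].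
Proof.
move=> Lf h phi tp sp w.
have tq : ctest (fun y => phi (- y)).
  have := ctest_aff 0 (_ : -1 != 0) tp; rewrite oppr_eq0 oner_neq0 => /(_ isT); congr ctest.
  by apply/funext => y; rewrite mulN1r addr0.
rewrite -pairing_opp //; last exact: kern_ck.
rewrite -(h _ tq _ w).
  by congr cintegral; apply/funext => x; rewrite /ck fourier_opp.
apply: subset_trans (supp_comp (s := fun y => - y) _ _ _) _.
- by move=> y; exact: cvgN cvg_id.
- exact: opprK.
- exact: opprK.
- by move=> y /sp /= hy Sy; apply: hy; rewrite opprK.
Qed.

(** After translation by t > 0 the test function vanishes on ]-oo, t], and its Fourier
    transform has integral 0. *)
Lemma ann_exp (v : H) (t : R) : 0 < t ->
  ann (fun x => expi (- (t * x)) *: v) [set y | y <= 0].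
Proof.
move=> t0 phi tp sp w.
have tq : ctest (fun y => phi (y - t)).
  have := ctest_aff (- t) (oner_neq0 R) tp; congr ctest.
  by apply/funext => y; rewrite mul1r.
have k0 := kern_cint (kern_ck tq).
rewrite /pairing (_ : (fun x => _) = fun x => cip ip v w * ck (fun y => phi (y - t)) x).
  rewrite cintegralZ // cintegral_conj; last exact: kern_cint (fourier_kern tq).
  rewrite (fourier_int0 t0 tq) ?conjC0 ?mulr0 // => y yt.
  by apply: supp0 => /sp /=; apply; rewrite subr_le0.
by apply/funext => x; rewrite ipZl ck_shift // mulrCA mulrA mulrC.
Qed.

End spectral_condition.

(** * One-sided spectra *)

Section onesided.
Context {R : realType} {H : completeNormedModType R[i]}.
Variable ip : {dot H for Num.conj}.
Hypothesis hH : hilbert_norm ip.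
Implicit Types f : R -> H.
Local Notation mu := (@lebesgue_measure R).
Local Notation L2 := (@L2 R H).

(** Dominated convergence with the majorant K |w| |f(x)| / (1 + x^2). *)
Lemma pairing_dct (k_ : nat -> R -> R[i]) k f w (K : R) : 0 <= K ->
  (forall n, cmeas (k_ n)) -> cmeas k -> L2 f ->
  (forall n x, cm (k_ n x) <= K * wt x) ->
  (forall x, cm (k_ n x - k x) @[n --> \oo] --> 0) ->
  cm (pairing ip (k_ n) f w - pairing ip k f w) @[n --> \oo] --> 0.
Proof.
move=> K0 mk_ mk Lf kK ck_.
have mf := sm_cip hH w Lf.1.
have mG : measurable_fun setT (fun x => K * nm w * (nm (f x) * wt x)).
  apply: measurable_funM => //; apply: measurable_funM; [exact: sm_nm Lf.1|exact: wt_meas].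
have iG : (\int[mu]_x (K * nm w * (nm (f x) * wt x))%:E < +oo)%E.
  under eq_integral => x _ do rewrite EFinM.
  rewrite ge0_integralZl_EFin //.
  - by apply: lte_mul_pinfty; rewrite ?lee_fin ?mulr_ge0 ?nm_ge0 // (N1_fin Lf).
  - by move=> x _; rewrite lee_fin mulr_ge0 ?nm_ge0 ?wt_ge0.
  - by apply/measurable_EFinP; apply: measurable_funM; [exact: sm_nm Lf.1|exact: wt_meas].
  - by rewrite mulr_ge0 ?nm_ge0.
have [] // := @cintegral_dct _ (fun n x => k_ n x * cip ip (f x) w)
  (fun x => k x * cip ip (f x) w) (fun x => K * nm w * (nm (f x) * wt x)).
- by move=> n; exact: cmeasM.
- exact: cmeasM.
- move=> n x; rewrite cmM; apply: (@le_trans _ _ (K * wt x * (nm (f x) * nm w))).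
    by apply: ler_pM; rewrite ?cm_ge0 ?nm_ge0 //; exact: ip_cs.
  by rewrite le_eqVlt; apply/orP; left; apply/eqP; ring.
- move=> x; under eq_fun do rewrite -mulrBl cmM.
  by rewrite -(mul0r (cm (cip ip (f x) w))); apply: cvgM; [exact: ck_|exact: cvg_cst].
Qed.

(** Vanishing of an integral against a fixed integrable function passes to bounded
    pointwise limits. *)
Lemma pairing_bclass (k : R -> R[i]) f w : kern k -> L2 f ->
  bclass (fun g => bm g /\ pairing ip (fun x => k x * g x) f w = 0).
Proof.
move=> kk Lf; have [mk [K K0 hK]] := kk.
split => [a g h [bg g0] [bh h0]|g_ g M hg b c].
  split; first exact: (bm_bclass.1 a).
  have k1 : kern (fun x => k x * g x) by have [m [N hN]] := bg; exact: kernM hN.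
  have k2 : kern (fun x => k x * h x) by have [m [N hN]] := bh; exact: kernM hN.
  rewrite (_ : (fun x => _) = fun x => a * (k x * g x) + k x * h x); last first.
    by apply/funext => x; ring.
  have k3 : kern (fun x => a * (k x * g x)).
    have := kernM (M := cm a) k1 (cmeas_cst a) (fun x => lexx _); congr kern.
    by apply/funext => x; rewrite mulrC.
  rewrite pairingDk // h0 addr0 /pairing (_ : (fun x => _) =
     fun x => a * (k x * g x * cip ip (f x) w)); last by apply/funext => x; ring.
  by rewrite cintegralZ; [rewrite -/(pairing ip _ _ _) g0 mulr0|exact: pairing_cint].
have bg : bm g by apply: (bm_bclass.2 g_ g M) => // n; exact: (hg n).1.
split => //.
have M0 : 0 <= M by apply: le_trans (b 0 0); exact: cm_ge0.
have := @pairing_dct (fun n x => k x * g_ n x) (fun x => k x * g x) f w (K * M) (mulr_ge0 K0 M0).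
move=> h; have {}h := h _ _ Lf _ _.
have e : (fun n => cm (pairing ip (fun x => k x * g_ n x) f w -
   pairing ip (fun x => k x * g x) f w)) = fun=> cm (pairing ip (fun x => k x * g x) f w).
  by apply/funext => n; rewrite (hg n).2 sub0r cmN.
rewrite e in h; apply: cm_eq0.
suff c0 : cm (pairing ip (fun x => k x * g x) f w) @[_ --> \oo] --> 0.
  exact: (@cvg_unique _ (@Rhausdorff R) _ _ _ _ (cvg_cst _) c0).
apply: h.
- by move=> n; apply: cmeasM => //; exact: (hg n).1.1.
- by apply: cmeasM => //; exact: bg.1.
- move=> n x; rewrite cmM mulrAC; apply: ler_pM; rewrite ?cm_ge0 //.
- move=> x; under eq_fun do rewrite -mulrBr cmM.
  by rewrite -(mulr0 (cm (k x))); apply: cvgM; [exact: cvg_cst|exact: c].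
Qed.

Lemma bump (e : R) : 0 < e -> exists2 u : R -> R, test u &
  [/\ forall y, 0 <= u y, forall y, y <= 0 \/ e <= y -> u y = 0 & \int[mu]_y u y = 1].
Proof.
move=> e0.
pose b y : R := flat 0 y * flat 0 (e - y).
have tb : test b.
  split.
    move=> n; apply: CnM; first exact: Cn_flat.
    have := Cn_aff (-1) e (Cn_flat n 0); congr (Cn n _).
    by apply/funext => y; rewrite mulN1r addrC.
  exists e => y; rewrite ltr_normr => /orP[hy|hy].
    by rewrite /b (@flat_le0 _ _ (e - y)) ?mulr0 //; lra.
  by rewrite /b flat_le0 ?mul0r //; lra.
have b0 y : 0 <= b y by rewrite mulr_ge0 ?flat_ge0.
have ib : mu.-integrable setT (EFin \o b).
  by have := test_int tb (@measurable_cst _ _ _ _ setT (1 : R)) (fun=> ltac:(by rewrite normr1));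
  congr (mu.-integrable setT _); apply/funext => y; rewrite /= mulr1.
have I0 : 0 < \int[mu]_y b y.
  rewrite lt_neqAle Rintegral_ge0 // andbT eq_sym; apply/eqP => h.
  have mb : measurable_fun setT (EFin \o b) by have /integrableP[] := ib.
  have : (\int[mu]_(y in setT) `|(EFin \o b) y| = 0)%E.
    under eq_integral => y _ do rewrite gee0_abs ?lee_fin //.
    by have /fineK <- := integrable_fin_num measurableT ib; rewrite -/(Rintegral _ _ _) h.
  move/(ae_eq_integral_abs mu measurableT mb) => [N [mN N0 hN]].
  pose J : set R := `]0, e[%classic.
  have : (mu J <= mu N)%E.
    apply: le_measure; rewrite ?inE; [exact: measurable_itv|exact: mN|].
    move=> y; rewrite /J /= in_itv /= => /andP[y0 ye]; apply: hN => /= /(_ I) [] /eqP.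
    by rewrite gt_eqF // mulr_gt0 // flat_gt0 // subr_gt0.
  by rewrite N0 /J lebesgue_measure_itv /= lte_fin e0 -EFinD subr0 lee_fin leNgt e0.
have i0 : 0 <= (\int[mu]_y b y)^-1 by rewrite invr_ge0 ltW.
exists (fun y => b y * (\int[mu]_y b y)^-1).
  by apply: testM => // n; exact: Cn_cst.
split=> [y|y hy|].
- exact: mulr_ge0.
- by case: hy => hy; rewrite /b ?(flat_le0 _ hy) ?mul0r // (@flat_le0 _ _ (e - y)) ?subr_le0 // mulr0 mul0r.
- by rewrite RintegralZr // divff // gt_eqF.
Qed.

Lemma cos_lip (a b : R) : `|cos a - cos b| <= `|a - b|.
Proof.
wlog ab : a b / b <= a.
  by move=> h; have [/h //|/ltW/h] := leP b a; rewrite distrC (distrC b).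
have [|c _ ->] := @MVT_segment R cos (fun x => - sin x) b a ab.
  by apply: continuous_subspaceT; exact: continuous_cos.
by rewrite normrM normrN ler_piMl // norm_sin.
Qed.

(** On the support of u the argument x y is at most |x| e, and the cosine is
    1-Lipschitz. *)
Lemma Kc_near (u : R -> R) (e c x : R) : 0 < e -> test u -> (forall y, 0 <= u y) ->
  (forall y, y <= 0 \/ e <= y -> u y = 0) -> \int[mu]_y u y = 1 ->
  `|Kc c u x - cos c| <= `|x| * e.
Proof.
move=> e0 tu u0 hu iu.
have i1 := Kc_int c x tu.
have iu' : mu.-integrable setT (EFin \o u).
  by have := Kc_int 0 0 tu; congr (mu.-integrable setT _); apply/funext => y; rewrite /= mul0r addr0 cos0 mulr1.
have iZ k : mu.-integrable setT (EFin \o (fun y => k * u y)).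
  rewrite (_ : _ \o _ = fun y => (k%:E * (u y)%:E)%E) //.
  exact: integrableZl.
have -> : Kc c u x - cos c = \int[mu]_y (u y * cos (x * y + c) - cos c * u y).
  by rewrite RintegralB // RintegralZl // iu mulr1.
have i3 : mu.-integrable setT (EFin \o (fun y => u y * cos (x * y + c) - cos c * u y)).
  by have := integrableB measurableT i1 (iZ (cos c)).
apply: le_trans (le_normr_Rintegral _ i3) _ => //.
have -> : `|x| * e = \int[mu]_y (`|x| * e * u y) by rewrite RintegralZl // iu mulr1.
apply: le_Rintegral => //; first exact: integrable_norm i3.
move=> y _; rewrite (mulrC (cos c)) -mulrBr normrM (ger0_norm (u0 y)) mulrC.
have [hy|hy] := leP y 0; first by rewrite hu ?mulr0 //; left.
have [hy'|hy'] := leP e y; first by rewrite hu ?mulr0 //; right.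
apply: ler_wpM2r => //; apply: le_trans (_ : `|x * y| <= _); last first.
  by rewrite normrM ler_wpM2l // gtr0_norm // ltW.
by apply: le_trans (cos_lip _ _) _; rewrite addrK.
Qed.

Lemma Kc_le (u : R -> R) (c x : R) : test u -> (forall y, 0 <= u y) ->
  \int[mu]_y u y = 1 -> `|Kc c u x| <= 1.
Proof.
move=> tu u0 iu; have i1 := Kc_int c x tu.
have iu' : mu.-integrable setT (EFin \o u).
  by have := Kc_int 0 0 tu; congr (mu.-integrable setT _); apply/funext => y; rewrite /= mul0r addr0 cos0 mulr1.
apply: le_trans (le_normr_Rintegral _ i1) _ => //; rewrite -iu.
apply: le_Rintegral => //; first exact: integrable_norm i1.
by move=> y _; rewrite normrM (ger0_norm (u0 y)) ler_piMr // norm_cos.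
Qed.

Lemma ck_real (u : R -> R) x : test u -> (Num.sqrt (2 * pi))%:C * ck (fun y => (u y)%:C) x =
  Num.conj (Kc 0 u x +i* Kc (- (pi / 2)) u x).
Proof.
move=> tu; have t0 : test (fun _ : R => 0 : R).
  by split; [move=> n; exact: Cn_cst|exists 0].
have tc : ctest (fun y => (u y)%:C) by [].
have s0 : Num.sqrt (2 * pi : R) != 0.
  by rewrite gt_eqF // sqrtr_gt0 mulr_gt0 // pi_gt0.
have K0 c : Kc c (fun _ : R => 0 : R) x = 0.
  by rewrite /Kc /Rintegral integral0_eq // => y _; rewrite mul0r.
rewrite /ck fourierE // rmorphM /= !K0 subr0 addr0 mulrA.
rewrite (_ : (Num.sqrt _)%:C * _ = 1) ?mul1r //.
apply: complexP; rewrite ?cReM ?cImM /=; move: (Num.sqrt _) s0 => s s0; by field.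
Qed.

(** For a bump u_j supported in [0, 1/(j+1)], its translates by s > 0 are supported in
    ]0, +oo[, so that f times the conjugate Fourier transform of u_j is
    orthogonal to all exp(i s x), s > 0, hence pairs to 0 with z^(n+1) w.
    As j grows these Fourier transforms, suitably normalised, tend boundedly to 1. *)
Lemma ann_moments f : L2 f -> ann ip f [set y | y <= 0] ->
  forall n w, pairing ip (cayley_wt n.+1%:Z) f w = 0.
Proof.
move=> Lf hf n w.
have e0 j : 0 < j.+1%:R^-1 :> R by rewrite invr_gt0.
have hb j := bump (e0 j).
pose Bu (j : nat) (u : R -> R) := test u /\
  [/\ forall y, 0 <= u y, forall y, y <= 0 \/ j.+1%:R^-1 <= y -> u y = 0 &
     \int[mu]_y u y = 1].
have [u tu] : exists u : nat -> R -> R, forall j, Bu j (u j).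
  have hb' j : exists u, Bu j u by have [u h1 h2] := hb j; exists u.
  by have [u hu] := choice hb'; exists u.
(* the kernel of Xi f on u_j, freed of the factor (2 pi)^(-1/2) *)
pose k_ j (x : R) := Num.conj (Kc 0 (u j) x +i* Kc (- (pi / 2)) (u j) x) * cayley_wt n.+1%:Z x.
have kE j x : k_ j x = (Num.sqrt (2 * pi))%:C * (ck (fun y => (u j y)%:C) x * cayley_wt n.+1%:Z x).
  by rewrite /k_ -ck_real ?mulrA //; exact: (tu j).1.
have t0 : test (fun _ : R => 0 : R) by split; [move=> m; exact: Cn_cst|exists 0].
have tc j : ctest (fun y => (u j y)%:C) by split; [exact: (tu j).1|].
have z j : pairing ip (k_ j) f w = 0.
  have kc := kern_ck (tc j).
  have [] // := geS_kernel n (pairing_bclass w kc Lf).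
    move=> _ [s s0 ->]; split; first by apply: eS_bm; exists s.
    rewrite -(hf (fun y => (u j (y - s))%:C) _ _ w).
    - congr cintegral; apply/funext => x; rewrite (ck_shift s x (tc j)).
      by congr (_ * _); rewrite mulrC.
    - have := ctest_aff (- s) (oner_neq0 R) (tc j); congr ctest.
      by apply/funext => y; rewrite mul1r.
    - apply: (@subset_trans _ `[s, +oo[%classic).
        apply: supp_sub; first exact: rray_closed.
        move=> y hy; have [_ [_ -> //]] := tu j; left; rewrite subr_le0 leNgt.
        by apply/negP => sy; apply: hy; rewrite /= in_itv /= (ltW sy).
      by move=> y; rewrite /= in_itv /= andbT => sy; apply/negP; rewrite -ltNge (lt_le_trans s0).
  move=> bg g0; rewrite /pairing (_ : (fun x => _) = fun x => (Num.sqrt (2 * pi))%:C *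
      (ck (fun y => (u j y)%:C) x * cayley_wt n.+1%:Z x * cip ip (f x) w)).
    rewrite cintegralZ; first by rewrite -/(pairing ip _ _ _) g0 mulr0.
    have [mg [M gM]] := bg.
    exact: (pairing_cint hH w (kernM kc mg gM) Lf).
  by apply/funext => x; rewrite kE; ring.
have mk j : cmeas (k_ j).
  rewrite (funext (kE j)); apply: cmeasM; first exact: cmeas_cst.
  by apply: cmeasM; [exact: (kern_ck (tc j)).1 | exact: (kern_cayley_wt n.+1%:Z).1].
have two0 : 0 <= 2 :> R by [].
have c := @pairing_dct k_ (cayley_wt n.+1%:Z) f w 2 two0 mk (kern_cayley_wt n.+1%:Z).1 Lf.
have e : (fun j => cm (pairing ip (k_ j) f w - pairing ip (cayley_wt n.+1%:Z) f w)) =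
   fun=> cm (pairing ip (cayley_wt n.+1%:Z) f w).
  by apply/funext => j; rewrite z sub0r cmN.
rewrite e in c; apply: cm_eq0.
suff c0 : cm (pairing ip (cayley_wt n.+1%:Z) f w) @[_ --> \oo] --> 0.
  exact: (@cvg_unique _ (@Rhausdorff R) _ _ _ _ (cvg_cst _) c0).
apply: c => [j x|x].
  have [t1 [t2 t3 t4]] := tu j.
  rewrite cmM cm_conj; apply: ler_pM; rewrite ?cm_ge0 //.
    apply: le_trans (cm_le _) _ => /=.
    by have := Kc_le 0 x t1 t2 t4; have := Kc_le (- (pi / 2)) x t1 t2 t4; move: (`|_|) (`|_|) => a b; lra.
  by rewrite cmM cm_cayley mul1r cmR ger0_norm // wt_ge0.
apply: (@squeeze_cvgr _ _ _ _ (fun=> 0) (fun j => 2 * `|x| * cm (cayley_wt n.+1%:Z x) * j.+1%:R^-1)).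
- near=> j; rewrite cm_ge0 /=; have [t1 [t2 t3 t4]] := tu j.
  rewrite -[X in cm (_ - X)]mul1r -mulrBl cmM -mulrAC ler_wpM2r ?cm_ge0 //.
  have cE1 (d : R[i]) : cm (Num.conj d - 1) = cm (d - 1).
    by rewrite -[in LHS](rmorph1 Num.conj) -rmorphB cm_conj.
  rewrite cE1.
  have a1 := Kc_near 0 x (e0 j) t1 t2 t3 t4; have a2 := Kc_near (- (pi / 2)) x (e0 j) t1 t2 t3 t4.
  rewrite cos0 in a1; rewrite cosN cos_pihalf subr0 in a2.
  apply: le_trans (cm_le _) _; rewrite cReD cImD /= oppr0 addr0.
  by apply: le_trans (lerD a1 a2) _; rewrite -[in leRHS]mulrA mulr_natl mulr2n.
- exact: cvg_cst.
- rewrite -(mulr0 (2 * `|x| * cm (cayley_wt n.+1%:Z x))).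
  by apply: cvgM; [exact: cvg_cst|exact: cvg_harmonic].
Unshelve. all: by end_near. Qed.

Lemma ann_halfline f : L2 f -> ann ip f [set y | y <= 0] ->
  forall (n : int) w, ~~ (0 <= n)%R -> pairing ip (cayley_wt (- n)) f w = 0.
Proof.
by move=> Lf hf [n|n] w // _; rewrite NegzE opprK; exact: ann_moments.
Qed.

(** Half of the frequencies are excluded by f itself, the other half by f(-x). *)
Lemma ann_origin f : L2 f -> ann ip f [set 0] ->
  forall (n : int) w, n != 0 -> pairing ip (cayley_wt (- n)) f w = 0.
Proof.
move=> Lf hf n w n0.
have sub g (S T : set R) : S `<=` T -> ann ip g S -> ann ip g T.
  by move=> ST h phi tp sp; apply: h => //; apply: subset_trans sp _; exact: subsetC.
have zy (y : R) : [set 0] y -> y <= 0 by move=> ->.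
have [n1|n1] := boolP (0 <= n)%R; last first.
  by apply: ann_halfline n1 => //; apply: sub hf => y; exact: zy.
have Lo := L2_opp Lf; have ho := ann_opp hH Lf hf.
have := @ann_halfline _ Lo _ (- n) w; rewrite opprK.
have kzo : (fun x : R => cayley_wt n (- x)) = cayley_wt (- n).
  by apply/funext => x; rewrite /cayley_wt /cayley atanN /wt sqrrN; congr (expi _ * _); rewrite rmorphN /=; ring.
rewrite -pairing_opp //; last exact: kern_cayley_wt.
rewrite kzo; apply.
  by apply: sub ho => y /= /eqP; rewrite oppr_eq0 => /eqP ->; rewrite /= lexx.
by rewrite oppr_ge0 -ltNge lt_neqAle eq_sym n0.
Qed.

End onesided.

(** * Window functions in the completion *)

Section completion.
Context {R : realType} {H : completeNormedModType R[i]}.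
Variable ip : {dot H for Num.conj}.
Hypothesis hH : hilbert_norm ip.
Variable A : operator H.
Hypothesis hA : self_adjoint ip A.
Hypothesis hA0 : nonneg_operator ip A.
Hypothesis hker : ker_operator A = [set 0].
Variable P : pvm ip.
Hypothesis hP : is_spectral_measure A P.
Variable E : completeNormedModType R[i].
Variable ipE : {dot E for Num.conj}.
Variable J : (R -> H) -> E.
Hypothesis hE : is_L2_completion ip A ipE J.
Local Notation Q := (Qop A).
Local Notation mu := (@lebesgue_measure R).
Local Notation L2 := (@L2 R H).
Local Notation N2 := (@N2 R H).
Local Notation pre := (preL2 ip A).
Local Notation sm := (@strongly_measurable R H).
Implicit Types f : R -> H.

Definition q f (x : R) : R := rip ip (Q x (f x)) (f x).
Definition QN f : \bar R := (\int[mu]_x (q f x)%:E)%E.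

Lemma q_ge0 f x : 0 <= q f x.
Proof. exact: (rQ_ge0T hH hA hA0). Qed.

Lemma q_meas f : sm f -> measurable_fun setT (q f).
Proof.
move=> sf; apply: sm_qform => //; first exact: measurable_Q.
by move=> x u v x0; exact: (rQ_sym hH hA).
Qed.

Lemma q_emeas f : sm f -> measurable_fun setT (fun x => (q f x)%:E).
Proof. by move=> sf; apply/measurable_EFinP; exact: q_meas. Qed.

Lemma QN_ge0 f : (0 <= QN f)%E.
Proof. by apply: integral_ge0 => x _; rewrite lee_fin q_ge0. Qed.

(** The form of Q x is nonnegative, so that the parallelogram identity applies. *)
Lemma q_lc (a : R[i]) f (g : R -> H) x : x != 0 ->
  q (fun x => a *: f x + g x) x <= 2 * cm a ^+ 2 * q f x + 2 * q g x.
Proof.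
move=> x0; rewrite /q.
have h : 0 <= rip ip (Q x (a *: f x - g x)) (a *: f x - g x) by exact: (rQ_ge0T hH hA hA0).
have Qa v : Q x (a *: v) = a *: Q x v.
  exact: (QZ hH hA).
have e : rip ip (Q x (a *: f x)) (a *: f x) = cm a ^+ 2 * rip ip (Q x (f x)) (f x).
  rewrite /rip Qa ipZl ipZr mulrA.
  have -> : a * Num.conj a = (cm a ^+ 2)%:C.
    by apply: complexP; rewrite ?cReM ?cImM ?cReC ?cImC ?cm_sqr /=; ring.
  by rewrite cReM /= mul0r subr0.
move: h; rewrite (QB hH hA) // (QD hH hA) // !ripBl !ripBr !ripDl !ripDr e.
have s := rQ_sym hH hA (a *: f x) (g x) x0.
rewrite (ripC ip (Q x (g x)) (a *: f x)).
move: (rip ip (Q x (f x)) (f x)) => p; move: (rip ip (Q x (g x)) (g x)) => r.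
move: s; rewrite -(ripC ip (Q x (g x)) (a *: f x)) => ->; rewrite -[2 * _ * p]mulrA.
by move: (rip ip (Q x (g x)) (a *: f x)) (cm a ^+ 2 * p) => s t; lra.
Qed.

Lemma QN_le f (g : R -> H) (k : R) : sm f -> sm g -> 0 <= k ->
  (forall x, x != 0 -> q f x <= k * q g x) -> (QN f <= k%:E * QN g)%E.
Proof.
move=> sf sg k0 fg; rewrite /QN -ge0_integralZl_EFin //; last 2 first.
- by move=> x _; rewrite lee_fin q_ge0.
- exact: q_emeas.
apply: ge0_le_integral0.
- exact: q_emeas.
- by apply: measurable_funeM; exact: q_emeas.
- by move=> x; rewrite lee_fin q_ge0.
- by move=> x; rewrite -EFinM lee_fin mulr_ge0 ?q_ge0.
- by move=> x x0; rewrite -EFinM lee_fin fg.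
Qed.

Lemma pre_lc (a : R[i]) f (g : R -> H) : pre f -> pre g -> pre (fun x => a *: f x + g x).
Proof.
move=> [sf hf] [sg hg]; split; first exact: sm_lc.
rewrite -/(q _ _) -/(QN _).
apply: (@le_lt_trans _ _ ((2 * cm a ^+ 2)%:E * QN f + 2%:E * QN g)%E); last first.
  have fin (k : R) u : 0 <= k -> (QN u < +oo)%E -> (k%:E * QN u < +oo)%E.
    by move=> k0 hu; apply: lte_mul_pinfty => //; rewrite lee_fin.
  by apply: lte_add_pinfty; apply: fin => //; rewrite mulr_ge0 ?sqr_ge0.
have k0 : 0 <= 2 * cm a ^+ 2 by rewrite mulr_ge0 ?sqr_ge0.
rewrite /QN -ge0_integralZl_EFin //; [|by move=> x _; rewrite lee_fin q_ge0|exact: q_emeas].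
rewrite -ge0_integralZl_EFin //; [|by move=> x _; rewrite lee_fin q_ge0|exact: q_emeas].
rewrite -ge0_integralD //; last 4 first.
- by move=> x _; rewrite -EFinM lee_fin mulr_ge0 ?q_ge0.
- by apply: measurable_funeM; exact: q_emeas.
- by move=> x _; rewrite -EFinM lee_fin mulr_ge0 ?q_ge0.
- by apply: measurable_funeM; exact: q_emeas.
apply: ge0_le_integral0.
- by apply: q_emeas; exact: sm_lc.
- by apply: emeasurable_funD; apply: measurable_funeM; exact: q_emeas.
- by move=> x; rewrite lee_fin q_ge0.
- by move=> x; rewrite -!EFinM -EFinD lee_fin addr_ge0 // mulr_ge0 ?q_ge0.
- by move=> x x0; rewrite -!EFinM -EFinD lee_fin q_lc.
Qed.

Lemma J_lc (a : R[i]) f (g : R -> H) : pre f -> pre g ->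
  J (fun x => a *: f x + g x) = a *: J f + J g.
Proof. by case: hE => _ h _ _; exact: h. Qed.

Lemma subE f (g : R -> H) : (fun x => f x - g x) = fun x => (-1) *: g x + f x.
Proof. by apply/funext => x; rewrite scaleN1r addrC. Qed.

Lemma preB f (g : R -> H) : pre f -> pre g -> pre (fun x => f x - g x).
Proof. by move=> pf pg; rewrite subE; exact: pre_lc. Qed.

Lemma JB f (g : R -> H) : pre f -> pre g -> J (fun x => f x - g x) = J f - J g.
Proof. by move=> pf pg; rewrite subE J_lc // scaleN1r addrC. Qed.

Lemma nmJ f : pre f -> ((nm (J f)) ^+ 2)%:E = QN f.
Proof.
move=> pf; have [hn _ hip _] := hE.
rewrite -(rip_nm (ip := ipE) hn) /rip /cip hip //= fineK //.
by rewrite ge0_fin_numE ?QN_ge0 //; exact: pf.2.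
Qed.

Lemma pre_cst v : pre (fun=> v).
Proof. by split; [exact: sm_cst | exact: (Qint_fin hH hA hA0 hker hP v)]. Qed.

Section window.
Variables a b : R.
Hypotheses (a0 : 0 < a) (ab : a < b).
Local Notation pj := (P `[a, b]%classic).
Local Notation V := (inV pj).

Lemma V_lc (c : R[i]) u v : V u -> V v -> V (c *: u + v).
Proof. by rewrite /inV => hu hv; rewrite pvm_linear // hu hv. Qed.

Lemma VB u v : V u -> V v -> V (u - v).
Proof. by move=> hu hv; rewrite addrC -scaleN1r; exact: V_lc. Qed.

Lemma VP v : V (pj v). Proof. by rewrite /inV pvm_idem. Qed.

Lemma V0 : V 0. Proof. by rewrite /inV pvm0. Qed.

Lemma V_closed : closed V.
Proof.
apply/closed_seq => u l hu ul; apply: (@cvg_uniq _ _ u) => //.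
have := pvm_cvg hH (P := P) (measurable_itv `[a, b]) ul.
by apply: cvg_trans; apply: near_eq_cvg; near=> n; rewrite hu.
Unshelve. all: by end_near. Qed.

Lemma Hab_V v : Hab P a b v <-> V v.
Proof. by split=> [[u _ <-]|h]; [exact: VP | exists v]. Qed.

(** On a window the norm of E and the weighted norm are equivalent, by rQ_wt. *)
Lemma window : exists c C : R, [/\ 0 < c, 0 < C & forall f, sm f -> (forall x, V (f x)) ->
  (c%:E * N2 f <= QN f)%E /\ (QN f <= C%:E * N2 f)%E].
Proof.
have [c [C [c0 C0 h]]] := rQ_wt hH hA hA0 hP a0 ab; exists c, C; split => // f sf Vf.
split.
  rewrite /N2 -ge0_integralZl_EFin //; [|by move=> x _; exact: N2_enn|exact: N2_emeas|exact: ltW].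
  apply: ge0_le_integral0.
  - by apply: measurable_funeM; exact: N2_emeas.
  - exact: q_emeas.
  - by move=> x; rewrite -EFinM lee_fin mulr_ge0 ?(ltW c0) // N2_nn.
  - by move=> x; rewrite lee_fin q_ge0.
  - move=> x x0; rewrite -EFinM lee_fin; have /andP[h1 _] := h x (f x) x0 (Vf x).
    by apply: le_trans h1; rewrite le_eqVlt; apply/orP; left; apply/eqP; ring.
rewrite /N2 -ge0_integralZl_EFin //; [|by move=> x _; exact: N2_enn|exact: N2_emeas|exact: ltW].
apply: ge0_le_integral0.
- exact: q_emeas.
- by apply: measurable_funeM; exact: N2_emeas.
- by move=> x; rewrite lee_fin q_ge0.
- by move=> x; rewrite -EFinM lee_fin mulr_ge0 ?(ltW C0) // N2_nn.
- move=> x x0; rewrite -EFinM lee_fin; have /andP[_ h1] := h x (f x) x0 (Vf x).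
  by apply: le_trans h1 _; rewrite le_eqVlt; apply/orP; left; apply/eqP; ring.
Qed.

Lemma L2_pre f : L2 f -> (forall x, V (f x)) -> pre f.
Proof.
move=> [sf lf] Vf; split => //; have [c [C [c0 C0 h]]] := window.
apply: le_lt_trans (h f sf Vf).2 _.
by rewrite lte_mul_pinfty // lee_fin ltW.
Qed.

Lemma pre_L2 f : pre f -> (forall x, V (f x)) -> L2 f.
Proof.
move=> [sf lf] Vf; split => //; have [c [C [c0 C0 h]]] := window.
have h1 := le_lt_trans (h f sf Vf).1 lf.
rewrite ltNge leye_eq; apply/negP => /eqP e; move: h1.
by rewrite e gt0_muley ?lte_fin // ltxx.
Qed.

Lemma nmJ_bnd : exists c C : R, [/\ 0 < c, 0 < C & forall f g, L2 f -> L2 g ->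
  (forall x, V (f x)) -> (forall x, V (g x)) ->
  (c%:E * N2 (fun x => f x - g x)%R <= ((nm (J f - J g)) ^+ 2)%:E)%E /\
  (((nm (J f - J g)) ^+ 2)%:E <= C%:E * N2 (fun x => f x - g x)%R)%E].
Proof.
have [c [C [c0 C0 h]]] := window; exists c, C; split => // f g Lf Lg Vf Vg.
have pf := L2_pre Lf Vf; have pg := L2_pre Lg Vg.
rewrite -JB // nmJ; last exact: preB.
by apply: h => [|x]; [exact: (L2B Lf Lg).1 | exact: VB].
Qed.

Lemma J_cvg (f_ : nat -> R -> H) f : (forall n, L2 (f_ n)) -> L2 f ->
  (forall n x, V (f_ n x)) -> (forall x, V (f x)) ->
  N2 (fun x => f_ n x - f x) @[n --> \oo] --> 0%E <-> J (f_ n) @[n --> \oo] --> J f.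
Proof.
move=> L_ Lf V_ Vf; have [c [C [c0 C0 h]]] := nmJ_bnd.
have [h1 h2] := ev0P (fun n => N2_ge0 (fun x => f_ n x - f x)).
have fin n : N2 (fun x => f_ n x - f x) \is a fin_num.
  by rewrite ge0_fin_numE ?N2_ge0 //; exact: (L2B (L_ n) Lf).2.
split.
  move=> /h1 cv; apply/cvg_nm/cvgrPdist_lt => e e0.
  have [|N hN] := cv (e ^+ 2 / C); first by rewrite divr_gt0 // exprn_gt0.
  exists N => // n /= /hN; rewrite sub0r normrN ger0_norm ?nm_ge0 //.
  have [_] := h _ _ (L_ n) Lf (V_ n) Vf.
  rewrite -(fineK (fin n)) -EFinM lee_fin lte_fin ltr_pdivlMr // mulrC => k1 k2.
  by rewrite -(ltr_pXn2r (n := 2)) ?nnegrE ?nm_ge0 ?(ltW e0) //; exact: le_lt_trans k1 k2.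
move=> /cvg_nm /cvgrPdist_lt cv; apply: h2 => e e0.
have e1 : 0 < Num.sqrt (c * e) by rewrite sqrtr_gt0 mulr_gt0.
have [N _ hN] := cv _ e1; exists N => n nN.
have := hN n nN; rewrite sub0r normrN ger0_norm ?nm_ge0 // => k2.
have [k1 _] := h _ _ (L_ n) Lf (V_ n) Vf; move: k1.
rewrite -(fineK (fin n)) -EFinM lee_fin lte_fin => k1.
rewrite -(ltr_pM2l c0); apply: le_lt_trans k1 _.
rewrite -(sqr_sqrtr (ltW (mulr_gt0 c0 e0))).
by rewrite ltr_pXn2r ?nnegrE ?nm_ge0 ?(ltW e1).
Qed.

(** The class in E determines a window function up to a null set, and hence its
    Fourier support; this is what makes the spectral subspaces independent of
    representatives. *)
Lemma J_eq f g : L2 f -> L2 g -> (forall x, V (f x)) -> (forall x, V (g x)) ->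
  J f = J g -> N2 (fun x => f x - g x) = 0%E.
Proof.
move=> Lf Lg Vf Vg e; have [c [C [c0 C0 h]]] := nmJ_bnd.
have [k1 _] := h _ _ Lf Lg Vf Vg.
move: k1; rewrite e subrr nm0 expr0n /= => k1.
apply/eqP; rewrite eq_le N2_ge0 andbT.
have fin : N2 (fun x => f x - g x) \is a fin_num.
  by rewrite ge0_fin_numE ?N2_ge0 //; exact: (L2B Lf Lg).2.
by move: k1; rewrite -(fineK fin) -EFinM !lee_fin pmulr_rle0.
Qed.

Lemma ann_J f g (S : set R) : L2 f -> L2 g -> (forall x, V (f x)) -> (forall x, V (g x)) ->
  J f = J g -> ann ip f S -> ann ip g S.
Proof.
move=> Lf Lg Vf Vg e hf; apply: (ann_cvg hH (f_ := fun=> f)) => //.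
by rewrite (J_eq Lf Lg Vf Vg e); exact: cvg_cst.
Qed.

End window.

Lemma dense_ind (C : set E) : closed C -> (forall f, pre f -> C (J f)) -> forall xi, C xi.
Proof.
move=> cC h xi; have [_ _ _ d] := hE.
have : closure (J @` [set f | pre f]) xi by rewrite d.
rewrite (closure_id C).1 //; apply: closure_subset => _ [f pf <-]; exact: h.
Qed.

End completion.

(** * The operators of the model *)

Section hilbert_maps.
Context {R : realType} {E : completeNormedModType R[i]}.
Implicit Types F G : E -> E.

Lemma cont_seq G (u : nat -> E) (l : E) : continuous G ->
  u n @[n --> \oo] --> l -> G (u n) @[n --> \oo] --> G l.
Proof. by move=> cG ul; apply: continuous_cvg => //; exact: cG. Qed.

Lemma eq_closed F G : continuous F -> continuous G -> closed [set xi | F xi = G xi].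
Proof.
move=> cF cG; apply/closed_seq => u l /= h ul.
apply: (@cvg_uniq _ _ (fun n => F (u n))); first exact: cont_seq.
by under eq_fun do rewrite h; exact: cont_seq.
Qed.

Lemma cont_comp F G : continuous F -> continuous G -> continuous (fun x => F (G x)).
Proof. by move=> cF cG x; exact: (continuous_comp (cG x) (cF _)). Qed.

Lemma smallest_subspace (G : set E) :
  closed_subspace (smallest (@closed_subspace R E) G).
Proof.
split; first split.
- by move=> M [[[M0 _] _] _].
- by move=> a u v hu hv M hM; have [[[_ Ml] _] _] := hM; apply: Ml; [exact: hu|exact: hv].
- apply/closed_seq => u l hu ul M hM; have [[_ cM] _] := hM.
  by move/closed_seq : cM; apply; [move=> n; exact: hu|exact: ul].
Qed.

End hilbert_maps.

Section model_operators.
Context {R : realType} {H : completeNormedModType R[i]}.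
Variable ip : {dot H for Num.conj}.
Hypothesis hH : hilbert_norm ip.
Variable A : operator H.
Hypothesis hA : self_adjoint ip A.
Hypothesis hA0 : nonneg_operator ip A.
Hypothesis hker : ker_operator A = [set 0].
Variable P : pvm ip.
Hypothesis hP : is_spectral_measure A P.
Variable E : completeNormedModType R[i].
Variable ipE : {dot E for Num.conj}.
Variable J : (R -> H) -> E.
Hypothesis hE : is_L2_completion ip A ipE J.
Variable U : R -> E -> E.
Hypothesis hU : is_translation_group ip A J U.
Variable theta : E -> E.
Hypothesis htheta : is_reflection ip A J theta.
Variable Pab : R -> R -> E -> E.
Hypothesis hPab : is_cutoff A P J Pab.
Local Notation Q := (Qop A).
Local Notation mu := (@lebesgue_measure R).
Local Notation L2 := (@L2 R H).
Local Notation N2 := (@N2 R H).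
Local Notation pre := (preL2 ip A).
Local Notation sm := (@strongly_measurable R H).
Local Notation spec := (spectral_subspace A P J Pab).
Implicit Types f : R -> H.

Lemma ext_eq (F G : E -> E) : continuous F -> continuous G ->
  (forall f, pre f -> F (J f) = G (J f)) -> forall xi, F xi = G xi.
Proof. by move=> cF cG h; apply: (dense_ind hE (eq_closed cF cG)). Qed.

Lemma sm_cutoff f (B : set R) : measurable B -> sm f -> sm (fun x => P B (f x)).
Proof. by move=> mB; apply: sm_comp => u v; exact: (pvm_cvg hH). Qed.

Lemma sm_expi f (t : R) : sm f -> sm (fun x => expi (- (t * x)) *: f x).
Proof.
move=> sf; apply: sm_scale => //; have := expi_meas (- t); congr cmeas.
by apply/funext => x; rewrite mulNr.
Qed.

Lemma pre_le f (g : R -> H) (k : R) : sm f -> pre g -> 0 <= k ->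
  (forall x, x != 0 -> q ip A f x <= k * q ip A g x) -> pre f.
Proof.
move=> sf [sg hg] k0 fg; split => //.
apply: le_lt_trans (QN_le hH hA hA0 sf sg k0 fg) _.
by apply: lte_mul_pinfty; rewrite ?lee_fin.
Qed.

Lemma pre_cutoff f (B : set R) : measurable B -> pre f -> pre (fun x => P B (f x)).
Proof.
move=> mB pf; apply: (@pre_le _ f 1) => //; first exact: sm_cutoff pf.1.
by move=> x x0; rewrite mul1r; exact: (rQ_pvm_le hH hA hA0 hP).
Qed.

Lemma pre_expi f (t : R) : pre f -> pre (fun x => expi (- (t * x)) *: f x).
Proof.
move=> pf; apply: (@pre_le _ f 2) => //; first exact: sm_expi pf.1.
move=> x x0; have := q_lc hH hA hA0 (expi (- (t * x))) f (fun=> 0) x0.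
by rewrite cm_expi expr1n mulr1 /q !addr0 rip0r mulr0 addr0.
Qed.

(** Q x depends on x only through its square. *)
Lemma pre_opp f : pre f -> pre (fun x => f (- x)).
Proof.
move=> [sf hf]; split; first exact: sm_oppx.
have m := q_emeas hH hA sf.
have h : (\int[mu]_x (q ip A f (- x))%:E = \int[mu]_x (q ip A f x)%:E)%E.
  exact: (int_move (@oppr_measurable R setT) (@mu_opp R) m).
apply: le_lt_trans hf; rewrite -/(QN ip A f) /QN -h le_eqVlt; apply/orP; left; apply/eqP.
by apply: eq_integral => x _; rewrite /q /Qop sqrrN.
Qed.

Section window.
Variables a b : R.
Hypotheses (a0 : 0 < a) (ab : a < b).
Local Notation pj := (P `[a, b]%classic).
Local Notation V := (inV pj).

Let mI : measurable `[a, b]%classic. Proof. exact: measurable_itv. Qed.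

Lemma Pab_cont : continuous (Pab a b). Proof. by have [] := hPab a0 ab. Qed.

Lemma PabJ f : pre f -> Pab a b (J f) = J (fun x => pj (f x)).
Proof. by have [_] := hPab a0 ab; exact. Qed.

Lemma Pab_U t xi : Pab a b (U t xi) = U t (Pab a b xi).
Proof.
have [cU hUJ] := hU t; move: xi; apply: ext_eq; try by apply: cont_comp => //; exact: Pab_cont.
move=> f pf; rewrite (hUJ _ pf) (PabJ (pre_expi t pf)) (PabJ pf) hUJ; last exact: pre_cutoff.
by congr J; apply/funext => x; rewrite pvmZ.
Qed.

Lemma Pab_theta xi : Pab a b (theta xi) = theta (Pab a b xi).
Proof.
have [cT hT] := htheta; move: xi; apply: ext_eq; try by apply: cont_comp => //; exact: Pab_cont.
by move=> f pf; rewrite (hT _ pf) (PabJ (pre_opp pf)) (PabJ pf) hT //; exact: pre_cutoff.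
Qed.

Lemma Pab_lc (c : R[i]) xi eta : Pab a b (c *: xi + eta) = c *: Pab a b xi + Pab a b eta.
Proof.
have lc (u v : nat -> E) (k l : E) : u n @[n --> \oo] --> k -> v n @[n --> \oo] --> l ->
    c *: u n + v n @[n --> \oo] --> c *: k + l.
  by move=> uk vl; apply: cvgD => //; exact: cvgZr.
have cl eta' : closed [set xi | Pab a b (c *: xi + eta') = c *: Pab a b xi + Pab a b eta'].
  apply/closed_seq => u l /= h ul.
  have c1 := cont_seq Pab_cont (lc _ _ _ _ ul (cvg_cst eta')).
  have c2 := lc _ _ _ _ (cont_seq Pab_cont ul) (cvg_cst (Pab a b eta')).
  rewrite (_ : (fun n => _) = fun n => c *: Pab a b (u n) + Pab a b eta') in c1; last by apply/funext => n; rewrite h.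
  exact: (cvg_uniq (c1 _) (c2 _)).
have cr xi' : closed [set eta | Pab a b (c *: xi' + eta) = c *: Pab a b xi' + Pab a b eta].
  apply/closed_seq => u l /= h ul.
  have c1 := cont_seq Pab_cont (lc _ _ _ _ (cvg_cst xi') ul).
  have c2 := lc _ _ _ _ (cvg_cst (Pab a b xi')) (cont_seq Pab_cont ul).
  rewrite (_ : (fun n => _) = fun n => c *: Pab a b xi' + Pab a b (u n)) in c1; last by apply/funext => n; rewrite h.
  exact: (cvg_uniq (c1 _) (c2 _)).
move: xi; apply: (dense_ind hE (cl eta)) => f pf /=; move: eta; apply: (dense_ind hE (cr (J f))) => g pg /=.
rewrite -(J_lc hE) // PabJ; last exact: pre_lc.
rewrite !PabJ // -(J_lc hE) //; try exact: pre_cutoff.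
by congr J; apply/funext => x; rewrite pvm_linear.
Qed.

Lemma Pab_le xi : nm (Pab a b xi) <= nm xi.
Proof.
have cl : closed [set xi | nm (Pab a b xi) <= nm xi].
  apply/closed_seq => u l /= h ul.
  apply: ler_cvg_to (nm_cvg (cont_seq Pab_cont ul)) (nm_cvg ul) _.
  by near=> n; exact: h.
move: xi; apply: (dense_ind hE cl) => f pf /=; rewrite PabJ //.
rewrite -(ler_pXn2r (n := 2)) ?nnegrE ?nm_ge0 // -lee_fin.
rewrite !(nmJ hH hA hA0 hE) //; last exact: pre_cutoff.
rewrite -[leRHS]mul1e; apply: (QN_le hH hA hA0) => //.
- exact: sm_cutoff pf.1.
- exact: pf.1.
- by move=> x x0; rewrite mul1r; exact: (rQ_pvm_le hH hA hA0 hP).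
Unshelve. all: by end_near. Qed.

Lemma PabB xi eta : Pab a b (xi - eta) = Pab a b xi - Pab a b eta.
Proof. by rewrite addrC -scaleN1r Pab_lc scaleN1r addrC. Qed.

Lemma V_cutoff_L2 f : pre f -> L2 (fun x => pj (f x)) /\ forall x, V (pj (f x)).
Proof.
move=> pf; have Vf x : V (pj (f x)) by exact: VP.
by split => //; apply: (pre_L2 hH hA hA0 hP a0 ab) => //; exact: pre_cutoff.
Qed.

Lemma V_simple f : L2 f -> (forall x, V (f x)) -> exists s : nat -> R -> H,
  [/\ forall n, tsimple (s n), forall n, L2 (s n), forall n x, V (s n x) &
      N2 (fun x => s n x - f x) @[n --> \oo] --> 0%E].
Proof.
move=> Lf Vf; have [s [hs cv]] := N2_simple Lf.
have L1 n : L2 (fun x => pj (s n x)).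
  split; first exact: sm_cutoff (hs n).2.1.
  apply: le_lt_trans (N2_le (k := 1) (sm_cutoff mI (hs n).2.1) (hs n).2.1 _ _) _ => //.
    by move=> x; rewrite mul1r lerXn2r ?nnegrE ?nm_ge0 //; exact: (pvm_le hH).
  by rewrite mul1e; exact: (hs n).2.2.
exists (fun n x => pj (s n x)); split=> [n|//|n x|].
- by apply: tsimple_comp; exact: (hs n).1.
- exact: VP.
- apply: (@squeeze_cvge _ _ _ _ (fun=> 0%E) _ (fun n => N2 (fun x => s n x - f x))) => //; last exact: cvg_cst.
  near=> n; rewrite N2_ge0 /=.
  rewrite -[leRHS]mul1e; apply: N2_le => //.
  + exact: (L2B (L1 n) Lf).1.
  + exact: (L2B (hs n).2 Lf).1.
  by move=> x; rewrite mul1r lerXn2r ?nnegrE ?nm_ge0 // -{1}(Vf x) -pvmB //; exact: (pvm_le hH).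
Unshelve. all: by end_near. Qed.

(** The vector is a limit of classes of simple window functions; these are Cauchy in the
    weighted space, and Riesz-Fischer provides the limit function. *)
Lemma Pab_repr xi : exists f, [/\ L2 f, forall x, V (f x) & Pab a b xi = J f].
Proof.
have [_ _ _ d] := hE.
have : closure (J @` [set f | pre f]) xi by rewrite d.
move=> /closure_seq[u hu uxi].
have hs n : exists s, [/\ tsimple s, L2 s, forall x, V (s x) & nm (J s - Pab a b (u n)) < n.+1%:R^-1].
  have [f pf uf] := hu n; have [Lf Vf] := V_cutoff_L2 pf.
  have [s [ts Ls Vs cs]] := V_simple Lf Vf.
  have [h _] := J_cvg hH hA hA0 hP hE a0 ab Ls Lf Vs Vf.
  move: (h cs) => /cvg_nm /cvgrPdist_lt /(_ n.+1%:R^-1); rewrite invr_gt0 ltr0n => /(_ isT)[N _ hN].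
  exists (s N); split => //; have := hN N (leqnn N).
  by rewrite sub0r normrN ger0_norm ?nm_ge0 // -uf PabJ.
have [s {}hs] := choice hs.
have ts n : tsimple (s n) by have [] := hs n.
have Ls n : L2 (s n) by have [] := hs n.
have Vs n x : V (s n x) by have [] := hs n.
have cs : J (s n) @[n --> \oo] --> Pab a b xi.
  apply/cvg_nm.
  have cu := (cvg_nm _ _).1 (cont_seq Pab_cont uxi).
  have c2 : n.+1%:R^-1 + nm (Pab a b (u n) - Pab a b xi) @[n --> \oo] --> (0 + 0 : R).
    by apply: cvgD => //; exact: cvg_harmonic.
  rewrite addr0 in c2; apply: squeeze_cvgr c2; last exact: cvg_cst.
  near=> n; rewrite nm_ge0 /=; apply: le_trans (nm_tri (Pab a b (u n)) _ _) _.
  by rewrite lerD2r; apply: ltW; have [] := hs n.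
have [c [C [c0 C0 h]]] := nmJ_bnd hH hA hA0 hP hE a0 ab.
have [|f [Lf Vf cf]] := riesz_fischer (V0 P a b) (V_closed hH (P := P) (a := a) (b := b)) ts Vs Ls _.
  move=> e e0; have e1 : 0 < Num.sqrt (c * e) / 2 by rewrite divr_gt0 // sqrtr_gt0 mulr_gt0.
  move: cs => /cvg_nm /cvgrPdist_lt /(_ _ e1)[N _ hN]; exists N => n m nN mN.
  have [k1 _] := h _ _ (Ls n) (Ls m) (Vs n) (Vs m).
  have := hN n nN; have := hN m mN; rewrite !sub0r !normrN !ger0_norm ?nm_ge0 // => hm hn.
  have hnm : nm (J (s n) - J (s m)) < Num.sqrt (c * e).
    apply: le_lt_trans (nm_tri (Pab a b xi) _ _) _; rewrite (nmB (Pab a b xi)).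
    by rewrite [ltRHS]splitr ltrD.
  have fin : N2 (fun x => s n x - s m x) \is a fin_num.
    by rewrite ge0_fin_numE ?N2_ge0 //; exact: (L2B (Ls n) (Ls m)).2.
  move: k1; rewrite -(fineK fin) -EFinM lee_fin lte_fin => k1.
  rewrite -(ltr_pM2l c0); apply: le_lt_trans k1 _.
  rewrite -(sqr_sqrtr (ltW (mulr_gt0 c0 e0))).
  by rewrite ltr_pXn2r ?nnegrE ?nm_ge0 ?sqrtr_ge0.
exists f; split => //; apply: (cvg_uniq cs).
exact: (J_cvg hH hA hA0 hP hE a0 ab Ls Lf Vs Vf).1.
Unshelve. all: by end_near. Qed.

End window.

(** For a function f the defect is the integral of <Q(x) g, g> with g the part of
    f(x) outside the window; dominated convergence applies.  The contractivity of the
    cutoffs extends this to the completion. *)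
Lemma Pab_id xi : Pab n.+1%:R^-1 n.+2%:R xi @[n --> \oo] --> xi.
Proof.
have n0 n : 0 < n.+1%:R^-1 :> R by rewrite invr_gt0.
have nn n : n.+1%:R^-1 < n.+2%:R :> R.
  by apply: (@le_lt_trans _ _ 1); rewrite ?invf_le1 ?ler1n ?ltr1n.
have cl : closed [set xi | Pab n.+1%:R^-1 n.+2%:R xi @[n --> \oo] --> xi].
  apply/closed_seq => u l /= h ul; apply/cvg_nm/cvgrPdist_lt => e e0.
  have e3 : 0 < e / 3 by rewrite divr_gt0.
  move/cvg_nm/cvgrPdist_lt : ul => /(_ _ e3)[N _ hN].
  have := hN N (leqnn N); rewrite sub0r normrN ger0_norm ?nm_ge0 // => hN'.
  move/cvg_nm/cvgrPdist_lt : (h N) => /(_ _ e3)[M _ hM]; exists M => // n /= /hM.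
  rewrite !sub0r !normrN !ger0_norm ?nm_ge0 // => hn.
  apply: le_lt_trans (nm_tri (Pab n.+1%:R^-1 n.+2%:R (u N)) _ _) _.
  apply: le_lt_trans (lerD (lexx _) (nm_tri (u N) _ _)) _.
  rewrite -PabB //; have h1 := Pab_le (n0 n) (nn n) (l - u N); rewrite (nmB l (u N)) in h1.
  by move: h1 hn hN'; move: (nm _) (nm _) (nm _) => x y z; lra.
move: xi; apply: (dense_ind hE cl) => f pf /=.
have mI n : measurable (Iab n : set R) by exact: measurable_itv.
have mC n : measurable (~` (Iab n : set R)) by exact: measurableC.
pose g n x := P (~` Iab n) (f x).
have sg n : sm (g n) by exact: sm_cutoff pf.1.
have gE n : ((nm (Pab n.+1%:R^-1 n.+2%:R (J f) - J f)) ^+ 2)%:E = QN ip A (g n).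
  rewrite PabJ // nmB -(JB hE) //; last by exact: pre_cutoff.
  rewrite (_ : (fun x => _) = g n); last by apply/funext => x; rewrite /g pvm_setC.
  by rewrite (nmJ hH hA hA0 hE) //; exact: pre_cutoff.
(* masking the point 0, where the majorant q f need not dominate *)
pose w n x := \1_(~` [set 0 : R]) x * q ip A (g n) x.
have w1 (x : R) : x != 0 -> \1_(~` [set 0 : R]) x = 1 :> R.
  by move=> /eqP x0; rewrite indicE mem_set.
have i0 (x : R) : 0 <= \1_(~` [set 0 : R]) x :> R by rewrite indicE.
have mw n : measurable_fun setT (w n).
  apply: measurable_funM; last exact: (q_meas hH hA).
  by apply: measurable_indic; apply: measurableC; exact: measurable_set1.
have w0 n x : 0 <= w n x by rewrite mulr_ge0 // (q_ge0 hH hA hA0).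
have c0 : (\int[mu]_x (w n x)%:E)%E @[n --> \oo] --> 0%E.
  apply: (dct0 (G := q ip A f)) => //.
  - exact: (q_meas hH hA pf.1).
  - move=> n x; rewrite w0 /= /w; have [->|x0] := eqVneq x 0.
      by rewrite indicE memNset ?mul0r ?(q_ge0 hH hA hA0) //= => /(_ erefl).
    by rewrite w1 // mul1r; exact: (rQ_pvm_le hH hA hA0 hP).
  - exact: pf.2.
  - move=> x x0.
    have c1 : nm (P (Iab n) (f x) - f x) @[n --> \oo] --> 0.
      by apply/cvg_nm; exact: (pvm_approx hH hA hA0 hP hker).
    have c2 : (pi * `|x|)^-1 * nm (P (Iab n) (f x) - f x) * nm (P (Iab n) (f x) - f x)
        @[n --> \oo] --> (pi * `|x|)^-1 * 0 * 0.
      by apply: cvgM => //; apply: cvgM => //; exact: cvg_cst.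
    rewrite mulr0 in c2; apply: squeeze_cvgr c2; last exact: cvg_cst.
    near=> n; rewrite w0 /= /w w1 // mul1r /q.
    have -> : nm (P (Iab n) (f x) - f x) = nm (g n x) by rewrite nmB /g pvm_setC.
    apply: le_trans (ler_norm _) _; apply: le_trans (rip_cs hH _ _) _.
    by apply: ler_wpM2r; [exact: nm_ge0 | exact: (Q_bnd hH hA)].
have c3 : QN ip A (g n) @[n --> \oo] --> 0%E.
  apply: (squeeze_cvge _ (cvg_cst _) c0); near=> n; rewrite (QN_ge0 hH hA hA0) /=.
  apply: ge0_le_integral0.
  - exact: (q_emeas hH hA).
  - by apply/measurable_EFinP.
  - by move=> x; rewrite lee_fin (q_ge0 hH hA hA0).
  - by move=> x; rewrite lee_fin.
  - by move=> x x0; rewrite /w w1 // mul1r.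
apply/cvg_nm; apply: sqr_cvg0 => [n|]; first exact: nm_ge0.
have c4 : fine (QN ip A (g n)) @[n --> \oo] --> 0 by exact: (fine_cvg c3).
apply: cvg_trans c4; apply: near_eq_cvg; near=> n.
by rewrite /= -gE.
Unshelve. all: by end_near. Qed.

End model_operators.

(** * The spectral subspaces *)

Section spectral.
Context {R : realType} {H : completeNormedModType R[i]}.
Variable ip : {dot H for Num.conj}.
Hypothesis hH : hilbert_norm ip.
Variable A : operator H.
Hypothesis hA : self_adjoint ip A.
Hypothesis hA0 : nonneg_operator ip A.
Hypothesis hker : ker_operator A = [set 0].
Variable P : pvm ip.
Hypothesis hP : is_spectral_measure A P.
Variable E : completeNormedModType R[i].
Variable ipE : {dot E for Num.conj}.
Variable J : (R -> H) -> E.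
Hypothesis hE : is_L2_completion ip A ipE J.
Variable U : R -> E -> E.
Hypothesis hU : is_translation_group ip A J U.
Variable theta : E -> E.
Hypothesis htheta : is_reflection ip A J theta.
Variable Pab : R -> R -> E -> E.
Hypothesis hPab : is_cutoff A P J Pab.
Local Notation L2 := (@L2 R H).
Local Notation N2 := (@N2 R H).
Local Notation pre := (preL2 ip A).
Local Notation sm := (@strongly_measurable R H).
Local Notation spec := (spectral_subspace A P J Pab).
Local Notation V a b := (inV (P `[a, b]%classic)).
Local Notation Ep := (Eplus J U).
Implicit Types f : R -> H.
Implicit Types F : set R.

Lemma oppimE F : [set - x | x in F] = [set y | F (- y)].
Proof.
by apply/seteqP; split => [_ [x Fx <-] /=|y Fy]; [rewrite opprK|exists (- y); rewrite ?opprK].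
Qed.

Lemma closed_oppim F : closed F -> closed [set y | F (- y)].
Proof.
move=> cF; apply: (@closed_comp _ _ (fun y : R => - y) F) => // x _; exact: (cvgN cvg_id).
Qed.

(** Window functions in the pre-Hilbert space are exactly those square
    integrable for the weight, and the support condition becomes ann. *)
Lemma specP F xi : closed F -> spec F xi <-> forall a b : R, 0 < a -> a < b -> exists f,
  [/\ L2 f, forall x, V a b (f x), Pab a b xi = J f & ann ip f [set y | F (- y)]].
Proof.
move=> cF; have cN := closed_oppim cF.
split=> h a b a0 ab; have [f [h1 h2 h3 h4]] := h a b a0 ab.
  have Vf x : V a b (f x) by apply/Hab_V; exact: h2.
  have Lf := pre_L2 hH hA hA0 hP a0 ab h1 Vf.
  by exists f; split => //; apply/(dsupport_ann hH cN Lf); rewrite -oppimE.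
exists f; split => //.
- exact: (L2_pre hH hA hA0 hP a0 ab).
- by move=> x; apply/Hab_V.
- by rewrite oppimE; apply/(dsupport_ann hH cN h1).
Qed.

Lemma J_zero : J (fun=> 0) = 0.
Proof.
have p0 := pre_cst hH hA hA0 hker hP 0.
by have := JB hE p0 p0; rewrite !subrr.
Qed.

Lemma ann0 (S : set R) : ann ip (fun=> 0) S.
Proof.
move=> phi _ _ w; rewrite -[RHS](pairing0k ip (fun=> 0) w) /pairing.
by congr cintegral; apply/funext => x; rewrite ip0l !mulr0.
Qed.

(** A convergent sequence in the subspace has representatives converging in
    the weighted space, where ann is a closed condition. *)
Lemma spec_subspace F : closed F -> closed_subspace (spec F).
Proof.
move=> cF; split; first split.
- apply/specP => // a b a0 ab; exists (fun=> 0); split.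
  + exact: L2_0.
  + by move=> x; exact: V0.
  + by rewrite -J_zero (PabJ hPab a0 ab) ?pvm0 //; exact: (pre_cst hH hA hA0 hker hP).
  + exact: ann0.
- move=> c xi eta /(specP _ cF) h1 /(specP _ cF) h2; apply/(specP _ cF) => a b a0 ab.
  have [f [Lf Vf Jf af]] := h1 a b a0 ab; have [g [Lg Vg Jg ag]] := h2 a b a0 ab.
  exists (fun x => c *: f x + g x); split.
  + exact: L2_lc.
  + by move=> x; exact: V_lc.
  + rewrite (Pab_lc hH hA hA0 hP hE hPab a0 ab) Jf Jg (J_lc hE) //; exact: (L2_pre hH hA hA0 hP a0 ab).
  + exact: ann_lc.
- apply/closed_seq => u l hu ul; apply/(specP _ cF) => a b a0 ab.
  have [f_ hf_] := choice (fun n => (specP (u n) cF).1 (hu n) a b a0 ab).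
  have [f [Lf Vf Jf]] := Pab_repr hH hA hA0 hP hE hPab a0 ab l.
  have Lf_ n : L2 (f_ n) by have [] := hf_ n.
  have Vf_ n x : V a b (f_ n x) by have [] := hf_ n.
  exists f; split => //; apply: (ann_cvg hH Lf_ Lf) => [|n]; last by have [] := hf_ n.
  apply/(J_cvg hH hA hA0 hP hE a0 ab Lf_ Lf Vf_ Vf); rewrite -Jf.
  rewrite (_ : (fun n => J (f_ n)) = fun n => Pab a b (u n)).
    exact: (cont_seq (Pab_cont hPab a0 ab)).
  by apply/funext => n; have [] := hf_ n.
Qed.

Lemma L2_expi f (t : R) : L2 f -> L2 (fun x => expi (- (t * x)) *: f x).
Proof.
move=> [sf lf]; split; first exact: sm_expi.
by rewrite /N2; under eq_integral => x _ do rewrite nmZ cm_expi mul1r.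
Qed.

Lemma V_scale a b (c : R[i]) v : V a b v -> V a b (c *: v).
Proof. by rewrite /inV => h; rewrite pvmZ // h. Qed.

Lemma U_spec F t xi : closed F -> spec F xi -> spec [set x + t | x in F] (U t xi).
Proof.
move=> cF /(specP _ cF) h.
have imE : [set x + t | x in F] = [set y | F (y - t)].
  by apply/seteqP; split => [_ [x Fx <-] /=|y Fy]; [rewrite addrK|exists (y - t); rewrite ?subrK].
have cFt : closed [set x + t | x in F].
  rewrite imE; apply: (@closed_comp _ _ (fun y : R => y - t) F) => // x _.
  by apply: cvgB; [exact: cvg_id|exact: cvg_cst].
apply/(specP _ cFt) => a b a0 ab; have [f [Lf Vf Jf af]] := h a b a0 ab.
exists (fun x => expi (- (t * x)) *: f x); split.
- exact: L2_expi.
- by move=> x; exact: V_scale.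
- rewrite (Pab_U hH hA hA0 hP hE hU hPab a0 ab) Jf; have [_ ->] := hU t => //.
  exact: (L2_pre hH hA hA0 hP a0 ab).
- have := @ann_shift _ _ ip f _ t af; rewrite imE.
  by congr (ann ip _ _); apply/funext => y /=; rewrite opprD.
Qed.

Lemma UK t xi : U t (U (- t) xi) = xi.
Proof.
have [c1 h1] := hU t; have [c2 h2] := hU (- t).
apply: (ext_eq hE (F := fun xi => U t (U (- t) xi)) (G := id)).
- exact: cont_comp.
- by move=> x; exact: cvg_id.
- move=> f pf; rewrite (h2 _ pf) h1; last exact: (pre_expi hH hA hA0).
  congr J; apply/funext => x; rewrite scalerA -expiD (_ : _ + _ = 0) ?expi0 ?scale1r //; ring.
Qed.

Lemma U_spec_eq F t : closed F -> U t @` spec F = spec [set x + t | x in F].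
Proof.
move=> cF; apply/seteqP; split => [_ [xi hxi <-]|xi hxi]; first exact: U_spec.
exists (U (- t) xi); last exact: UK.
have imE : [set x + t | x in F] = [set y | F (y - t)].
  by apply/seteqP; split => [_ [x Fx <-] /=|y Fy]; [rewrite addrK|exists (y - t); rewrite ?subrK].
have cFt : closed [set x + t | x in F].
  rewrite imE; apply: (@closed_comp _ _ (fun y : R => y - t) F) => // x _.
  by apply: cvgB; [exact: cvg_id|exact: cvg_cst].
have := U_spec (- t) cFt hxi; congr (spec _ _); apply/seteqP; split.
  by move=> _ [_ [x Fx <-] <-]; rewrite addrK.
by move=> x Fx; exists (x + t); rewrite ?addrK //; exists x.
Qed.

Lemma halflineE : [set y : R | `[0, +oo[%classic (- y)] = [set y | y <= 0].
Proof. by apply/seteqP; split => y; rewrite /= in_itv /= andbT oppr_ge0. Qed.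

Lemma Eplus_sub : Ep `<=` spec `[0, +oo[%classic.
Proof.
have cF : closed (`[0, +oo[%classic : set R) by exact: rray_closed.
apply: smallest_sub; first exact: spec_subspace.
move=> _ [t [v [t0 ->]]]; apply/(specP _ cF) => a b a0 ab.
have pv := pre_cst hH hA hA0 hker hP v.
have Lv : L2 (fun _ : R => P `[a, b]%classic v).
  by apply: (@L2_bounded _ _ _ (nm (P `[a, b]%classic v))) => //; exact: sm_cst.
exists (fun x => expi (- (t * x)) *: P `[a, b]%classic v); split.
- exact: L2_expi.
- by move=> x; apply: V_scale; exact: VP.
- have [_ hUJ] := hU t.
  rewrite (Pab_U hH hA hA0 hP hE hU hPab a0 ab) (PabJ hPab a0 ab) // hUJ //.
  exact: (pre_cutoff hH hA hA0 hP).
- by rewrite halflineE; exact: ann_exp.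
Qed.

Lemma Ep_subspace : closed_subspace Ep.
Proof. exact: smallest_subspace. Qed.

Section window.
Variables a b : R.
Hypotheses (a0 : 0 < a) (ab : a < b).
Local Notation V := (inV (P `[a, b]%classic)).

Lemma pre_mul (g : R -> R[i]) v : bm g -> V v ->
  L2 (fun x => g x *: v) /\ forall x, V (g x *: v).
Proof.
move=> [mg [M gM]] Vv; split; last by move=> x; exact: V_scale.
apply: (@L2_bounded _ _ _ (M * nm v)); first by apply: sm_scale => //; exact: sm_cst.
by move=> x; rewrite nmZ ler_wpM2r ?nm_ge0.
Qed.

(** Bounded pointwise convergence of scalar factors implies convergence in the
    completion, as v lies in a window. *)
Lemma Ep_bclass v : V v -> bclass (fun g => bm g /\ Ep (J (fun x => g x *: v))).
Proof.
move=> Vv; have [[_ El] cE] := Ep_subspace.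
split => [c g h [bg eg] [bh eh]|g_ g M hg gb cg].
  split; first exact: (bm_bclass.1 c).
  have [Lg Vg] := pre_mul bg Vv; have [Lh Vh] := pre_mul bh Vv.
  rewrite (_ : (fun x => _) = fun x => c *: (g x *: v) + h x *: v); last first.
    by apply/funext => x; rewrite scalerDl scalerA.
  rewrite (J_lc hE); [exact: El|exact: (L2_pre hH hA hA0 hP a0 ab)|exact: (L2_pre hH hA hA0 hP a0 ab)].
have bg : bm g by apply: (bm_bclass.2 g_ g M) => // n; exact: (hg n).1.
split => //.
have hL n := (pre_mul (hg n).1 Vv).1; have hV n := (pre_mul (hg n).1 Vv).2.
have [Lg Vg] := pre_mul bg Vv.
have gM x : cm (g x) <= M by apply: cm_lim (cg x) => n.
have Lc : L2 (fun _ : R => (2 * M)%:C *: v).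
  by apply: (@L2_bounded _ _ _ (nm ((2 * M)%:C *: v))) => //; exact: sm_cst.
have cv : N2 (fun x => g_ n x *: v - g x *: v) @[n --> \oo] --> 0%E.
  apply: (N2_dct (fun n => (hL n).1) Lg.1 Lc) => [n x|x _].
    rewrite -scalerBl !nmZ; apply: ler_wpM2r; first exact: nm_ge0.
    rewrite cmR; apply: le_trans (ler_norm _); apply: le_trans (cmD _ _) _.
    by rewrite cmN mulr_natl mulr2n lerD.
  apply/cvg_nm.
  rewrite (_ : (fun n => _) = (fun n => cm (g_ n x - g x) * nm v)); last first.
    by apply/funext => n; rewrite -scalerBl nmZ.
  by rewrite -(mul0r (nm v)); apply: cvgM; [exact: cg | exact: cvg_cst].
move/closed_seq : cE; apply; [|exact: (J_cvg hH hA hA0 hP hE a0 ab hL Lg hV Vg).1 cv].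
by move=> n; exact: (hg n).2.
Qed.

Lemma Ep_cayley v (n : nat) : V v -> Ep (J (fun x => cayley n%:Z x *: v)).
Proof.
move=> Vv; have [] // := geS_cayley n (Ep_bclass Vv).
move=> _ [s s0 ->]; split; first by apply: eS_bm; exists s.
have [_ hUJ] := hU s; rewrite -hUJ; last exact: (pre_cst hH hA hA0 hker hP).
by move=> M [_ GM]; apply: GM; exists s, v.
Qed.

Lemma tp_V (S : int -> bool) p : allV (P `[a, b]%classic) S p -> forall x, V (tp p x).
Proof.
elim: p => [|r p IH] hp x; first by rewrite tp_nil; exact: V0.
rewrite tp_cons; apply: V_lc; first by apply: (hp r _).2; rewrite inE eqxx.
by apply: IH => r' hr; apply: hp; rewrite inE hr orbT.
Qed.

Lemma Ep_tp p : allV (P `[a, b]%classic) (fun n => 0 <= n)%R p -> Ep (J (tp p)).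
Proof.
have [[E0 El] cE] := Ep_subspace.
elim: p => [|r p IH] hp.
  rewrite (_ : tp _ = fun=> 0) ?J_zero //; by apply/funext => x; rewrite tp_nil.
have hp' : allV (P `[a, b]%classic) (fun n => 0 <= n)%R p.
  by move=> r' hr; apply: hp; rewrite inE hr orbT.
have [r0 Vr] := hp r (mem_head _ _).
rewrite (_ : tp _ = fun x => 1 *: (cayley r.1 x *: r.2) + tp p x); last first.
  by apply/funext => x; rewrite tp_cons scale1r.
rewrite (J_lc hE); last 2 first.
- apply: (L2_pre hH hA hA0 hP a0 ab); first exact: L2_cayley.
  by move=> x; exact: V_scale.
- by apply: (L2_pre hH hA hA0 hP a0 ab); [exact: L2_tp|exact: tp_V hp'].
apply: El; last exact: IH.
by case: (r.1) r0 => // n _; exact: Ep_cayley.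
Qed.

Lemma approximable_J (S : int -> bool) f (C : set E) : L2 f -> (forall x, V (f x)) ->
  approximable (P `[a, b]%classic) S f -> closed C ->
  (forall p, allV (P `[a, b]%classic) S p -> C (J (tp p))) -> C (J f).
Proof.
move=> Lf Vf hf cC hC.
have hp (n : nat) : exists p, allV (P `[a, b]%classic) S p /\
    (N2 (fun x => f x - tp p x)%R < (n.+1%:R^-1)%:E)%E.
  by have [|p h1 h2] := hf n.+1%:R^-1; [rewrite invr_gt0|exists p].
have [p {}hp] := choice hp.
have Lp n : L2 (tp (p n)) by exact: L2_tp.
have Vp n x : V (tp (p n) x) by exact: tp_V (hp n).1 x.
have cv : N2 (fun x => tp (p n) x - f x) @[n --> \oo] --> 0%E.
  have c0 : (n.+1%:R^-1)%:E @[n --> \oo] --> (0%R : R)%:E.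
    by apply: cvg_EFin; [near=> n|exact: cvg_harmonic].
  apply: (squeeze_cvge _ (cvg_cst _) c0); near=> n; rewrite N2_ge0 /=.
  apply: ltW; apply: le_lt_trans (hp n).2; rewrite le_eqVlt; apply/orP; left; apply/eqP.
  by apply: eq_integral => x _; rewrite nmB.
move/closed_seq : cC; apply; last exact: (J_cvg hH hA hA0 hP hE a0 ab Lp Lf Vp Vf).1 cv.
by move=> n; apply: hC; exact: (hp n).1.
Unshelve. all: by end_near. Qed.

Lemma V_split (S : int -> bool) f : L2 f -> (forall x, V (f x)) ->
  (forall n w, ~~ S n -> pairing ip (cayley_wt (- n)) f w = 0) -> approximable (P `[a, b]%classic) S f.
Proof.
move=> Lf Vf; apply: (trig_split hH _ _ _ Lf Vf).
- by move=> c u v; exact: pvm_linear.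
- by move=> v; exact: (pvm_le hH).
- by move=> v; rewrite pvm_idem.
Qed.

End window.

Lemma limit_windows (C : set E) xi : closed C ->
  (forall a b : R, 0 < a -> a < b -> C (Pab a b xi)) -> C xi.
Proof.
move=> cC h; apply: ((closed_seq C).1 cC (fun n => Pab n.+1%:R^-1 n.+2%:R xi)); last first.
  exact: (Pab_id hH hA hA0 hker hP hE hPab).
move=> n /=; apply: h; first by rewrite invr_gt0.
by apply: (@le_lt_trans _ _ 1); rewrite ?invf_le1 ?ler1n ?ltr1n.
Qed.

(** An element supported on the half-line is, on each window, a limit of combinations of
    z^n v with n >= 0, which belong to E_+ by Ep_cayley. *)
Lemma Eplus_eq : Ep = spec `[0, +oo[%classic.
Proof.
have cF : closed (`[0, +oo[%classic : set R) by exact: rray_closed.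
apply/seteqP; split; first exact: Eplus_sub.
move=> xi /(specP _ cF) h; apply: limit_windows; first exact: Ep_subspace.2.
move=> a b a0 ab; have [f [Lf Vf -> af]] := h a b a0 ab.
rewrite halflineE in af.
apply: (approximable_J a0 ab Lf Vf (S := fun n => 0 <= n)).
- by apply: V_split => // n w; exact: ann_halfline.
- exact: Ep_subspace.2.
- exact: Ep_tp.
Qed.

(** An element of E_+ fixed by theta has its support in a half-line and in its
    reflection.  Conversely, support {0} leaves only the frequency n = 0, that is, limits
    of constants. *)
Lemma Ezero_eq : Ezero J U theta = spec [set 0].
Proof.
have cF : closed (`[0, +oo[%classic : set R) by exact: rray_closed.
have c0 : closed [set 0 : R] by rewrite -set_itv1; exact: itv_closed.
have N0 : [set y : R | [set 0] (- y)] = [set 0].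
  by apply/seteqP; split => y /= => [/eqP|->]; rewrite ?oppr0 // oppr_eq0 => /eqP.
have [cT hT] := htheta.
apply/seteqP; split.
  move=> xi [/Eplus_sub/(specP _ cF) h tx]; apply/(specP _ c0) => a b a0 ab.
  have [f [Lf Vf Jf af]] := h a b a0 ab; exists f; split => //.
  rewrite N0; rewrite halflineE in af.
  have pf := L2_pre hH hA hA0 hP a0 ab Lf Vf.
  have e : J (fun x => f (- x)) = J f.
    by rewrite -hT // -Jf -(Pab_theta hH hA hA0 hP hE htheta hPab a0 ab) tx.
  have Lo := L2_opp Lf.
  have ao := ann_J hH hA hA0 hP hE a0 ab Lo Lf (fun x => Vf (- x)) Vf e (ann_opp hH Lf af).
  apply/(dsupport_ann hH c0 Lf) => y hy.
  have cl : closed [set y : R | y <= 0] by rewrite -halflineE; exact: closed_oppim.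
  have h1 := (dsupport_ann hH cl Lf).2 af _ hy.
  have h2 := (dsupport_ann hH (closed_oppim cl) Lf).2 ao _ hy.
  by apply/eqP; move: h1 h2 => /= h1; rewrite oppr_le0 => h2; rewrite eq_le h1 h2.
move=> xi h; have {h} h := (specP xi c0).1 h; split.
  rewrite Eplus_eq; apply/(specP _ cF) => a b a0 ab; have [f [Lf Vf Jf af]] := h a b a0 ab.
  exists f; split => //; rewrite halflineE => phi tp sp; apply: af => //.
  by apply: subset_trans sp _; apply: subsetC; rewrite N0 => y ->; rewrite /= lexx.
have cl := eq_closed cT (fun x => cvg_id : id x @[x --> x] --> x).
apply: (limit_windows cl) => a b a0 ab; have [f [Lf Vf -> af]] := h a b a0 ab.
rewrite N0 in af.
apply: (approximable_J a0 ab Lf Vf (S := fun n => n == 0) _ cl) => [|p hp /=].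
  by apply: V_split => // n w; exact: ann_origin.
rewrite hT; last by apply: (L2_pre hH hA hA0 hP a0 ab); [exact: L2_tp|exact: tp_V hp].
congr J; apply/funext => x; rewrite /tp; apply: eq_big_seq => r /hp[/eqP -> _].
by rewrite !cayley0.
Qed.

End spectral.

Theorem proposition4p2
    (R : realType)
    (H : completeNormedModType R[i]) (ip : {dot H for Num.conj})
    (hH : hilbert_norm ip)
    (A : operator H) (hA : self_adjoint ip A) (hA0 : nonneg_operator ip A)
    (hker : ker_operator A = [set 0])
    (P : pvm ip) (hP : is_spectral_measure A P)
    (C : R -> H -> H) (hC : is_exp_semigroup P C)
    (E : completeNormedModType R[i]) (ipE : {dot E for Num.conj})
    (J : (R -> H) -> E) (hE : is_L2_completion ip A ipE J)
    (U : R -> E -> E) (hU : is_translation_group ip A J U)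
    (theta : E -> E) (htheta : is_reflection ip A J theta)
    (Pab : R -> R -> E -> E) (hPab : is_cutoff A P J Pab) :
  [/\ forall F : set R, closed F ->
        closed_subspace (spectral_subspace A P J Pab F),
      forall (F : set R) (t : R), closed F ->
        U t @` spectral_subspace A P J Pab F =
        spectral_subspace A P J Pab [set x + t | x in F],
      Ezero J U theta = spectral_subspace A P J Pab [set 0] &
      Eplus J U = spectral_subspace A P J Pab `[0, +oo[%classic].
Proof.
split.
- by move=> F cF; exact: (spec_subspace hH hA hA0 hker hP hE hPab).
- by move=> F t cF; exact: (U_spec_eq hH hA hA0 hP hE hU hPab).
- exact: (Ezero_eq hH hA hA0 hker hP hE hU htheta hPab).
- exact: (Eplus_eq hH hA hA0 hker hP hE hU hPab).
Qed.
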